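(* Let $n\ge2$ and let $a,b$ satisfy $0<a\le1$, $0<b\le\frac12$, $2a\ge1+b$. Set $$s:=\frac14+\frac{n-1}{2(n+1)}\big(n-(n-1)a-b\big),$$ and, for $k\ge k_0$, $R_k=2^k$, $D_k=R_k^{(n-(n-1)a+nb)/(n+1)}$, $Q_k=R_k^{\frac{n-1}{n+1}(2a-b-1)}$. Define $$g_{a,b}=\sum_{k\ge k_0}R_k^{-s}\,\frac{k}{\|f^{(k)}\|_{L^2}}\,f^{(k)},$$ where $f^{(k)}$ is the function $f_D$ (defined in the context) with $R=R_k$ and $D=D_k$. Let $F$ be the $(a,b)$-set of divergence (with slab constant $c$). Then, provided $k_0$ is sufficiently large and $0<c_1\ll c\ll1$, with $c_0:=\frac{1}{10}c_1$, there is a set $\Omega\subset\mathbb{R}^n$ with $\mathcal{H}^\gamma(\Omega)=0$ for every $\gamma>n-2s$ such that $$\limsup_{t\to0^+}\big|e^{it\hbar\Delta/2}g_{a,b}(x)\big|=\infty\qquad\text{for every } x\in\big(F\cap([c_0,c_1]\times[0,c_1]^{n-1})\big)\setminus\Omega.$$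
   Context: $\hbar=1/(2\pi)$; $\hat f(\xi)=\int f(x)e^{-2\pi ix\cdot\xi}dx$. For $f\in H^{\sigma}(\mathbb{R}^n)$ the solution is defined pointwise by $e^{it\hbar\Delta/2}f(x)=\lim_{N\to\infty}\int_{Q(N)}\hat f(\xi)e^{i(-\pi t|\xi|^2+2\pi x\cdot\xi)}d\xi$ at each $x$ where this limit exists, $Q(N)$ being the cube of side $N$ centered at $0$. Fix a smooth positive $\varphi$ on $\mathbb{R}$ with $\operatorname{supp}\hat\varphi\subset(-1,1)$ and $\varphi(0)=1$, and for $R,D>0$ let $f_D(x)=e^{2\pi i Rx_1}\varphi(R^{1/2}x_1)\prod_{j=2}^n\varphi(x_j)\big(\sum_{l_j\in\mathbb{Z},\ R/(2D)<l_j<R/D}e^{2\pi iDl_jx_j}\big)$. A point $(p_1/q,\dots,p_n/q)$, $p_j,q\in\mathbb{Z}$, is an admissible fraction if $\gcd(p_1,q)=1$ and: $p_2,\dots,p_n$ arbitrary when $q$ is odd; $p_2,\dots,p_n$ all even when $q\equiv0\pmod4$; $p_2,\dots,p_n$ all odd when $q\equiv2\pmod4$. For $0<c\ll1$ and $k\ge k_0$, let $\mathcal{A}_k$ be the collection of closed axis-parallel boxes (''slabs'') of dimensions $cR_k^{-1/2}\times cR_k^{-1}\times\cdots\times cR_k^{-1}$ (the long side in the $x_1$ direction) centered at $\big(2p_1R_k/(qD_k^2),\,p_2/(D_kq),\dots,p_n/(D_kq)\big)$, where $(p_1/q,\dots,p_n/q)$ is an admissible fraction with $1\le q\le Q_k$.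 Let $F_k=\bigcup_{s\in\mathcal{A}_k}s$ and $F=\limsup_{k\to\infty}F_k=\bigcap_{N}\bigcup_{k\ge N}F_k$; this is the $(a,b)$-set of divergence. $\mathcal{H}^\gamma$ is the $\gamma$-dimensional Hausdorff measure. *)

(* Defs.v *)
From HB Require Import structures.
From mathcomp Require Import all_boot all_order all_algebra.
From mathcomp Require Import all_classical all_reals all_analysis.
From mathcomp Require Import complex.
Set Implicit Arguments. Unset Strict Implicit. Unset Printing Implicit Defensive.
Import Order.TTheory GRing.Theory Num.Theory.
Import numFieldNormedType.Exports.
Local Open Scope ring_scope.
Local Open Scope classical_set_scope.

Section Defs.
Variable R : realType.
Local Notation C := R[i].

Definition expi (th : R) : C := Complex (cos th) (sin th).

Definition rc (r : R) : C := Complex r 0.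

Definition cabs (z : C) : R := Num.sqrt (complex.Re z ^+ 2 + complex.Im z ^+ 2).

Definition cint (D : set R) (h : R -> C) : C :=
  Complex (Rintegral (@lebesgue_measure R) D (fun t => complex.Re (h t)))
          (Rintegral (@lebesgue_measure R) D (fun t => complex.Im (h t))).

Fixpoint iter_cint (m : nat) (D : nat -> set R) (G : (nat -> R) -> C)
    (y : nat -> R) : C :=
  match m with
  | 0 => G y
  | m'.+1 => cint (D m')
      (fun t => iter_cint m' D G (fun j => if j == m' then t else y j))
  end.

Definition cd n (x : 'rV[R]_n) (j : nat) : R :=
  match @insub nat (fun k => (k < n)%N) 'I_n j with
  | Some i => x ord0 i
  | None => 0
  end.

Definition rn_int n (D : nat -> set R) (f : 'rV[R]_n -> C) : C :=
  iter_cint n D (fun y => f (\row_(i < n) y i)) (fun _ => 0).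

Definition dotv n (x y : 'rV[R]_n) : R := \sum_(i < n) x ord0 i * y ord0 i.
Definition enorm n (x : 'rV[R]_n) : R := Num.sqrt (dotv x x).

Definition fourier n (f : 'rV[R]_n -> C) (xi : 'rV[R]_n) : C :=
  rn_int (fun _ => setT) (fun x => f x * expi (- (2 * pi * dotv x xi))).

Definition l2norm n (f : 'rV[R]_n -> C) : R :=
  Num.sqrt (complex.Re (rn_int (fun _ => setT) (fun x => rc (cabs (f x) ^+ 2)))).

Definition schr_trunc n (ghat : 'rV[R]_n -> C) (t : R) (x : 'rV[R]_n) (N : R) : C :=
  rn_int (fun _ => `[- (N / 2), N / 2])
    (fun xi => ghat xi * expi (- (pi * t * dotv xi xi) + 2 * pi * dotv x xi)).

(** e^{i t hbar Delta/2} g (x) exists and equals v  (g given through \hat g) *)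
Definition schr_at n (ghat : 'rV[R]_n -> C) (t : R) (x : 'rV[R]_n) (v : C) : Prop :=
  ((fun N => complex.Re (schr_trunc ghat t x N)) @ pinfty_nbhs R --> complex.Re v) /\
  ((fun N => complex.Im (schr_trunc ghat t x N)) @ pinfty_nbhs R --> complex.Im v).

Definition schr_blowup n (ghat : 'rV[R]_n -> C) (x : 'rV[R]_n) : Prop :=
  forall (M d : R), 0 < d ->
    exists t : R, 0 < t < d /\ exists v : C, schr_at ghat t x v /\ M < cabs v.

(** the function f_D (x_1 is coordinate 0, x_j is coordinate j-1) *)
Definition fD n (phi : R -> R) (Rr Dd : R) (x : 'rV[R]_n) : C :=
  expi (2 * pi * Rr * cd x 0) * rc (phi (Num.sqrt Rr * cd x 0)) *
  \prod_(1 <= j < n)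
     (rc (phi (cd x j)) *
      \sum_(0 <= l < (Num.truncn (Rr / Dd)).+1 |
               (Rr / (2 * Dd) < l%:R) && (l%:R < Rr / Dd))
          expi (2 * pi * Dd * l%:R * cd x j)).

Definition Rk (k : nat) : R := 2 ^+ k.
Definition Dk (n : nat) (a b : R) (k : nat) : R :=
  Rk k `^ ((n%:R - (n%:R - 1) * a + n%:R * b) / (n%:R + 1)).
Definition Qk (n : nat) (a b : R) (k : nat) : R :=
  Rk k `^ ((n%:R - 1) / (n%:R + 1) * (2 * a - b - 1)).
Definition sexp (n : nat) (a b : R) : R :=
  1 / 4 + (n%:R - 1) / (2 * (n%:R + 1)) * (n%:R - (n%:R - 1) * a - b).

Definition fk n (phi : R -> R) (a b : R) (k : nat) : 'rV[R]_n -> C :=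
  @fD n phi (Rk k) (Dk n a b k).

Definition gterm_hat n (phi : R -> R) (a b : R) (k : nat) (xi : 'rV[R]_n) : C :=
  rc (Rk k `^ (- sexp n a b) * k%:R / l2norm (@fk n phi a b k)) *
  fourier (@fk n phi a b k) xi.

Definition ghat n (phi : R -> R) (a b : R) (k0 : nat) (xi : 'rV[R]_n) : C :=
  Complex (limn (fun N => \sum_(k0 <= k < N) complex.Re (@gterm_hat n phi a b k xi)))
          (limn (fun N => \sum_(k0 <= k < N) complex.Im (@gterm_hat n phi a b k xi))).

(** admissible fraction (p_1/q, ..., p_n/q); p j for j = 1..n *)
Definition admissible (n : nat) (p : nat -> int) (q : int) : Prop :=
  [/\ gcdz (p 1%N) q = 1,
      (4 %| q)%Z -> forall j, (2 <= j <= n)%N -> (2 %| p j)%Z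
    & (q %% 4)%Z = 2 -> forall j, (2 <= j <= n)%N -> ~~ (2 %| p j)%Z].

Definition in_slab n (a b c : R) (k : nat) (p : nat -> int) (q : int)
    (x : 'rV[R]_n) : Prop :=
  `|cd x 0 - 2 * (p 1%N)%:~R * Rk k / (q%:~R * Dk n a b k ^+ 2)|
      <= c * Rk k `^ (- (1 / 2)) / 2 /\
  forall j, (1 <= j < n)%N ->
    `|cd x j - (p j.+1)%:~R / (Dk n a b k * q%:~R)| <= c * (Rk k)^-1 / 2.

Definition Fk n (a b c : R) (k : nat) : set 'rV[R]_n :=
  [set x | exists (p : nat -> int) (q : int),
     [/\ 1 <= q, q%:~R <= Qk n a b k, admissible n p q & @in_slab n a b c k p q x]].

Definition divset n (a b c : R) : set 'rV[R]_n :=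
  [set x | forall N : nat, exists k : nat, (N <= k)%N /\ @Fk n a b c k x].

Definition region n (c0 c1 : R) : set 'rV[R]_n :=
  [set x | c0 <= cd x 0 <= c1 /\ forall j, (1 <= j < n)%N -> 0 <= cd x j <= c1].

Definition diam n (U : set 'rV[R]_n) : \bar R :=
  ereal_sup ([set 0%E] `|` [set (enorm (z.1 - z.2))%:E | z in U `*` U]).

(** Hausdorff content H^gamma_delta and Hausdorff measure H^gamma
    (the normalising constant is omitted; irrelevant for null sets) *)
Definition hausdorff_content n (gam delta : R) (E : set 'rV[R]_n) : \bar R :=
  ereal_inf [set (\sum_(0 <= i <oo) ((fine (diam (U i))) `^ gam)%:E)%E |
     U in [set U : nat -> set 'rV[R]_n |
             E `<=` \bigcup_i U i /\ forall i, (diam (U i) <= delta%:E)%E]].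

Definition hausdorff n (gam : R) (E : set 'rV[R]_n) : \bar R :=
  ereal_sup [set hausdorff_content gam delta E | delta in [set d : R | 0 < d]].

Definition smooth (phi : R -> R) : Prop :=
  forall (m : nat) (x : R), derivable (iter m (fun g => g^`()) phi) x 1.

Definition ft_supp_in_unit (phi : R -> R) : Prop :=
  exists r : R, r < 1 /\ forall xi : R, r < `|xi| ->
    cint setT (fun x => rc (phi x) * expi (- (2 * pi * x * xi))) = 0.

End Defs.

Arguments fk {R}.
Arguments gterm_hat {R}.
Arguments ghat {R}.
Arguments in_slab {R}.
Arguments Fk {R}.
Arguments divset {R}.
Arguments region {R}.
Arguments sexp {R}.
Arguments Dk {R}.
Arguments Qk {R}.
Arguments Rk {R}.

(* Main.v *)
Require Import Defs.
From HB Require Import structures.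
From mathcomp Require Import all_boot all_order all_algebra.
From mathcomp Require Import all_classical all_reals all_analysis.
From mathcomp Require Import measurable_realfun lebesgue_integral_under.
From mathcomp Require Import complex.
From mathcomp Require Import ring lra zify.
Import Order.TTheory GRing.Theory Num.Theory.
Import numFieldNormedType.Exports.
Local Open Scope ring_scope.
Local Open Scope classical_set_scope.
Set Implicit Arguments.
Unset Strict Implicit.
Unset Printing Implicit Defensive.

(** Only the k-th summand u_k of the solution is large on the k-th slabs: at time
    t = 2 p_1/(q D_k^2) the lattice sums are incomplete quadratic Gauss sums, which for
    admissible fractions have size (number of terms)/sqrt q, so that |u_k(x,t)| >= c' k.  Since phi
    is merely integrable and band-limited, the other summands have no pointwise decay to rely on;
    they are removed in frequency.  The summands occupy separated bands of |xi|^2, so convolution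
    in t with a kernel K_k, |K_k(s)| <= C R_k^2 min(1, (R_k^2 s)^-2), reproduces u_k and
    annihilates all the others.  Hence, if |u| <= M on a time interval (0,d), then
    |u_k(x,t)| is at most M ||K_k||_1 plus a constant times the integral of
    sum_j |u_j(x,.)| against 1/(1+s^2), which is bounded in k as soon as that integral converges.
    This convergence, which also gives the existence of the limit for almost every t, holds off a
    set Omega: a Rademacher-Menshov maximal inequality bounds, in L^2 and uniformly in the
    truncation N, the supremum of u_j over each cube of side 1/(2 R_j), so Omega is covered for
    every J by j^O(1) R_j^(n-2s) such cubes for each j >= J. *)

(** * Unimodular exponentials *)

(** The same normalisation turns the sum over cubes of the squared majorants of u_k into k^O(1)
    R_k^(n-2s). The maximal inequality is needed in one dimension only, because truncation to a cube
    keeps every summand a product. The filter argument has to cope with |u| <= M being available on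
    (0,d) alone. Off (0,d) the kernel must be bounded by a constant independent of k times
    1/(1+s^2). This is what x_1 >= c_0 provides: on a slab R_k t is close to x_1, so R_k t >=
    c_1/20, and a point off (0,d) is at distance at least t from t. Inside (0,d) a partial sum of
    the series differs from u by a tail; there the kernel is compared with 1/(1+s^2) with a constant
    depending on k, and this is harmless because the number of summands is chosen after k. *)

Section ComplexBasics.
Variable R : realType.
Local Notation C := R[i].
Implicit Types (z w : C) (r : R).

Lemma complex_ext z w :
  complex.Re z = complex.Re w -> complex.Im z = complex.Im w -> z = w.
Proof. by case: z w => [a b] [c d] /= -> ->. Qed.

Lemma cReD z w : complex.Re (z + w) = complex.Re z + complex.Re w.
Proof. by case: z w => [a b] [c d]. Qed.
Lemma cImD z w : complex.Im (z + w) = complex.Im z + complex.Im w.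
Proof. by case: z w => [a b] [c d]. Qed.
Lemma cReN z : complex.Re (- z) = - complex.Re z.
Proof. by case: z. Qed.
Lemma cImN z : complex.Im (- z) = - complex.Im z.
Proof. by case: z. Qed.
Lemma cReM z w : complex.Re (z * w) =
  complex.Re z * complex.Re w - complex.Im z * complex.Im w.
Proof. by case: z w => [a b] [c d]. Qed.
Lemma cImM z w : complex.Im (z * w) =
  complex.Re z * complex.Im w + complex.Im z * complex.Re w.
Proof. by case: z w => [a b] [c d]. Qed.
Lemma cRe0 : complex.Re (0 : C) = 0. Proof. by []. Qed.
Lemma cIm0 : complex.Im (0 : C) = 0. Proof. by []. Qed.
Lemma cRe1 : complex.Re (1 : C) = 1. Proof. by []. Qed.
Lemma cIm1 : complex.Im (1 : C) = 0. Proof. by []. Qed.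
Lemma cReconj z : complex.Re (conjc z) = complex.Re z.
Proof. by case: z. Qed.
Lemma cImconj z : complex.Im (conjc z) = - complex.Im z.
Proof. by case: z. Qed.
Lemma cRerc r : complex.Re (rc r) = r. Proof. by []. Qed.
Lemma cImrc r : complex.Im (rc r) = 0. Proof. by []. Qed.
Lemma cReexpi r : complex.Re (expi r) = cos r. Proof. by []. Qed.
Lemma cImexpi r : complex.Im (expi r) = sin r. Proof. by []. Qed.

Definition cE := (cReD, cImD, cReN, cImN, cReM, cImM, cRe0, cIm0, cRe1, cIm1,
  cReconj, cImconj, cRerc, cImrc, cReexpi, cImexpi).

Lemma cRe_sum (I : Type) (s : seq I) (P : pred I) (F : I -> C) :
  complex.Re (\sum_(i <- s | P i) F i) = \sum_(i <- s | P i) complex.Re (F i).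
Proof. by apply: (big_morph _ cReD cRe0). Qed.
Lemma cIm_sum (I : Type) (s : seq I) (P : pred I) (F : I -> C) :
  complex.Im (\sum_(i <- s | P i) F i) = \sum_(i <- s | P i) complex.Im (F i).
Proof. by apply: (big_morph _ cImD cIm0). Qed.

Lemma rcD (a b : R) : rc (a + b) = rc a + rc b :> C.
Proof. by apply: complex_ext; rewrite !cE ?addr0. Qed.
Lemma rcM (a b : R) : rc (a * b) = rc a * rc b :> C.
Proof. by apply: complex_ext; rewrite !cE ?(mulr0, mul0r, subr0, addr0). Qed.
Lemma rcN (a : R) : rc (- a) = - rc a :> C.
Proof. by apply: complex_ext; rewrite ?cReN ?cImN ?cRerc ?cImrc ?oppr0. Qed.
Lemma rc0 : rc 0 = 0 :> C. Proof. by []. Qed.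
Lemma rc1 : rc 1 = 1 :> C. Proof. by []. Qed.
Lemma rc_sum (I : Type) (s : seq I) (P : pred I) (F : I -> R) :
  rc (\sum_(i <- s | P i) F i) = \sum_(i <- s | P i) rc (F i).
Proof. by apply: (big_morph _ rcD rc0). Qed.
Lemma rc_prod (I : Type) (s : seq I) (P : pred I) (F : I -> R) :
  rc (\prod_(i <- s | P i) F i) = \prod_(i <- s | P i) rc (F i).
Proof. by apply: (big_morph _ rcM rc1). Qed.
Lemma rcX (a : R) m : rc (a ^+ m) = rc a ^+ m.
Proof. by elim: m => [|m IH]; rewrite ?expr0 ?rc1// !exprS rcM IH. Qed.

Lemma rc_neq0 (a : R) : a != 0 -> rc a != 0.
Proof. by move=> a0; apply/eqP => /(congr1 (@complex.Re _))/= aE; move: a0; rewrite aE eqxx. Qed.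

Lemma rc_nat m : rc m%:R = m%:R :> C.
Proof. by elim: m => [|m IH]; rewrite ?rc0// -!natr1 rcD IH. Qed.

Lemma cabs_normc z : cabs z = ComplexField.Normc.normc z.
Proof. by case: z. Qed.

Lemma cabs_ge0 z : 0 <= cabs z. Proof. exact: sqrtr_ge0. Qed.
Lemma cabsM z w : cabs (z * w) = cabs z * cabs w.
Proof. by rewrite !cabs_normc ComplexField.Normc.normcM. Qed.
Lemma cabsD z w : cabs (z + w) <= cabs z + cabs w.
Proof. by rewrite !cabs_normc; exact: le_normcD. Qed.
Lemma cabsN z : cabs (- z) = cabs z.
Proof. by rewrite /cabs !cE !sqrrN. Qed.
Lemma cabs0 : cabs (0 : C) = 0.
Proof. by rewrite /cabs !cE expr0n addr0 sqrtr0. Qed.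
Lemma cabs_rc r : cabs (rc r) = `|r|.
Proof. by rewrite /cabs !cE expr0n addr0 sqrtr_sqr. Qed.
Lemma cabs1 : cabs (1 : C) = 1. Proof. by rewrite -rc1 cabs_rc normr1. Qed.
Lemma cabs_expi r : cabs (expi r) = 1.
Proof. by rewrite /cabs !cE cos2Dsin2 sqrtr1. Qed.
Lemma cabs_conj z : cabs (conjc z) = cabs z.
Proof. by rewrite /cabs !cE sqrrN. Qed.
Lemma cabs_sqr z : cabs z ^+ 2 = complex.Re z ^+ 2 + complex.Im z ^+ 2.
Proof. by rewrite /cabs sqr_sqrtr// addr_ge0// sqr_ge0. Qed.
Lemma rc_cabs_sqr z : rc (cabs z ^+ 2) = z * conjc z.
Proof. by rewrite cabs_sqr; apply: complex_ext; rewrite !cE; ring. Qed.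
Lemma cabsB z w : cabs (z - w) = cabs (w - z).
Proof. by rewrite -cabsN opprB. Qed.
Lemma cabs_le_sub z w : cabs z <= cabs w + cabs (z - w).
Proof. by rewrite -{1}[z](subrK w) addrC cabsD. Qed.
Lemma cabs_distD v z w : cabs (z - w) <= cabs (z - v) + cabs (v - w).
Proof. by rewrite -(subrKA v) cabsD. Qed.
Lemma cabs_sum (I : Type) (s : seq I) (P : pred I) (F : I -> C) :
  cabs (\sum_(i <- s | P i) F i) <= \sum_(i <- s | P i) cabs (F i).
Proof.
elim/big_ind2: _ => [|x1 x2 y1 y2 H1 H2|//]; first by rewrite cabs0.
by apply: (le_trans (cabsD _ _)); exact: lerD.
Qed.
Lemma cabs_prod (I : Type) (s : seq I) (P : pred I) (F : I -> C) :
  cabs (\prod_(i <- s | P i) F i) = \prod_(i <- s | P i) cabs (F i).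
Proof. by apply: (big_morph _ cabsM cabs1). Qed.
Lemma Re_le_cabs z : `|complex.Re z| <= cabs z.
Proof. by rewrite -sqrtr_sqr ler_wsqrtr// lerDl sqr_ge0. Qed.
Lemma Im_le_cabs z : `|complex.Im z| <= cabs z.
Proof. by rewrite -sqrtr_sqr ler_wsqrtr// lerDr sqr_ge0. Qed.
Lemma cabs_le_ReIm z : cabs z <= `|complex.Re z| + `|complex.Im z|.
Proof.
rewrite -[leRHS]ger0_norm ?addr_ge0// -sqrtr_sqr ler_wsqrtr//.
rewrite sqrrD !real_normK ?num_real//.
have : 0 <= `|complex.Re z| * `|complex.Im z| by rewrite mulr_ge0.
lra.
Qed.
Lemma cabs_eq0 z : (cabs z == 0) = (z == 0).
Proof.
apply/eqP/eqP => [|->]; last exact: cabs0.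
by rewrite cabs_normc => /ComplexField.Normc.eq0_normc.
Qed.
Lemma cabs_rot z : exists2 w, cabs w = 1 & w * z = rc (cabs z).
Proof.
have [->|z0] := eqVneq z 0; first by exists 1; rewrite ?cabs1// mul1r cabs0.
have cz : cabs z != 0 by rewrite cabs_eq0.
exists (rc (cabs z)^-1 * conjc z).
  by rewrite cabsM cabs_conj cabs_rc ger0_norm ?invr_ge0 ?cabs_ge0// mulVf.
by rewrite -mulrA [conjc z * z]mulrC -rc_cabs_sqr -rcM expr2 mulrA mulVf// mul1r.
Qed.

Lemma expi0 : expi 0 = 1 :> C.
Proof. by apply: complex_ext; rewrite !cE ?cos0 ?sin0. Qed.
Lemma expiD (a b : R) : expi (a + b) = expi a * expi b.
Proof. by apply: complex_ext; rewrite !cE ?cosD// sinD; ring. Qed.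
Lemma expiN (a : R) : expi (- a) = conjc (expi a).
Proof. by apply: complex_ext; rewrite !cE ?cosN ?sinN. Qed.
Lemma expi2pi : expi (2 * pi) = 1 :> C.
Proof.
by apply: complex_ext; rewrite !cE mulr_natl ?cos2pi ?sin2pi.
Qed.
Lemma expi2pin (m : nat) : expi (2 * pi * m%:R) = 1 :> C.
Proof.
elim: m => [|m IH]; first by rewrite mulr0 expi0.
by rewrite -[m.+1%:R]natr1 mulrDr mulr1 expiD IH expi2pi mulr1.
Qed.
Lemma expi2piz (m : int) : expi (2 * pi * m%:~R) = 1 :> C.
Proof.
case: m => m; first exact: expi2pin.
rewrite NegzE mulrNz mulrN expiN expi2pin.
by apply: complex_ext; rewrite !cE ?oppr0.
Qed.
Lemma expi_sum (I : Type) (s : seq I) (P : pred I) (F : I -> R) :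
  expi (\sum_(i <- s | P i) F i) = \prod_(i <- s | P i) expi (F i).
Proof. by apply: (big_morph _ expiD expi0). Qed.
Lemma sin_le (x : R) : 0 <= x -> sin x <= x.
Proof.
move=> x0.
have [->|xn0] := eqVneq x 0; first by rewrite sin0.
have x1 : 0 < x by rewrite lt_neqAle eq_sym xn0.
have [c _] := @MVT R sin cos 0 x x1 (fun y _ => is_derive_sin y)
  (continuous_subspaceT (@continuous_sin R)).
rewrite sin0 !subr0 => ->.
by rewrite -[leRHS]mul1r ler_wpM2r// cos_le1.
Qed.

Lemma norm_sin_le (x : R) : `|sin x| <= `|x|.
Proof.
wlog x0 : x / 0 <= x => [hw|].
  have [x0|/ltW x0] := leP 0 x; first exact: hw.
  by rewrite -normrN -sinN -[leRHS]normrN; apply: hw; rewrite oppr_ge0.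
rewrite [leRHS]ger0_norm// ler_norml sin_le// andbT.
have [x1|x1] := leP x 1.
  apply: (@le_trans _ _ 0); first by rewrite oppr_le0.
  by apply: sin_ge0_pi; rewrite x0/= (le_trans x1)// (le_trans _ (pi_ge2 R))// ler1n.
by rewrite (le_trans _ (sin_geN1 x))// lerN2 ltW.
Qed.

Lemma oneBcos_half (x : R) : 1 - cos x = 2 * sin (x / 2) ^+ 2.
Proof.
rewrite [in cos x](splitr x) -mulr2n cos_mulr2n sin2cos2; ring.
Qed.

Lemma oneBcos_le (x : R) : 1 - cos x <= x ^+ 2 / 2.
Proof.
rewrite oneBcos_half.
have : sin (x / 2) ^+ 2 <= (x / 2) ^+ 2.
  by rewrite -real_normK ?num_real// -[leRHS]real_normK ?num_real//
    lerXn2r ?nnegrE// norm_sin_le.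
lra.
Qed.

Lemma sin_ge_sub (x : R) : 0 <= x -> x - x ^+ 3 / 2 <= sin x.
Proof.
move=> x0.
have [->|xn0] := eqVneq x 0; first by rewrite sin0 expr0n mul0r subrr.
have x1 : 0 < x by rewrite lt_neqAle eq_sym xn0.
have [c] := @MVT R sin cos 0 x x1 (fun y _ => is_derive_sin y)
  (continuous_subspaceT (@continuous_sin R)).
rewrite sin0 !subr0 in_itv/= => /andP[c0 cx] ->.
have h : cos c >= 1 - x ^+ 2 / 2.
  have := oneBcos_le c.
  have : c ^+ 2 <= x ^+ 2 by rewrite lerXn2r ?nnegrE ?ltW.
  lra.
have -> : x - x ^+ 3 / 2 = (1 - x ^+ 2 / 2) * x by field.
by rewrite ler_wpM2r.
Qed.

(** A crude Jordan inequality: the cubic lower bound gives sin u >= u/2 on [0,1]; beyond 1,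
    monotonicity gives sin v >= sin 1 >= 1/2, while v < 2. *)
Lemma sin_ge_quarter (v : R) : 0 <= v <= pi / 2 -> v / 4 <= sin v.
Proof.
move=> /andP[v0 v1].
have h1 : forall u : R, 0 <= u <= 1 -> u / 2 <= sin u.
  move=> u /andP[u0 u1]; apply: le_trans (sin_ge_sub u0).
  have : u ^+ 3 <= u by rewrite exprS ler_piMr// exprn_ile1.
  lra.
have [v2|v2] := leP v 1.
  have := h1 v; rewrite v0 v2 => /(_ isT); lra.
have h2 : sin 1 <= sin v.
  have [/eqP->//|v21] := boolP (1 == v).
  have p1 := @pihalf_ge1 R.
  rewrite ltW// ltr_sin//; rewrite in_itv/=; apply/andP; split; lra.
have := h1 1; rewrite ler01 lexx => /(_ isT).
have := @pihalf_lt2 R; lra.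
Qed.

Lemma expiB_sqr (a b : R) : cabs (expi a - expi b) ^+ 2 = 2 * (1 - cos (a - b)).
Proof.
rewrite cabs_sqr !cE cosB.
have := cos2Dsin2 a; have := cos2Dsin2 b; nra.
Qed.

Lemma expi_lip (a b : R) : cabs (expi a - expi b) <= `|a - b|.
Proof.
rewrite -(@ler_pXn2r _ 2)// ?nnegrE ?cabs_ge0// expiB_sqr real_normK ?num_real//.
have := oneBcos_le (a - b); lra.
Qed.

End ComplexBasics.

(** * Affine changes of variables *)

Section Affine.
Variable R : realType.
Local Notation mu := (@lebesgue_measure R).

Lemma measurable_affine (a b : R) : measurable_fun setT (fun x : R => a * x + b).
Proof. by apply: measurable_funD => //; exact: measurable_funM. Qed.

Section aff.
Variables (a b : R) (a0 : a != 0).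
Let phi : R -> R := fun x => a * x + b.
Let mphi : measurable_fun setT phi. Proof. exact: measurable_affine. Qed.
Let pm : {measure set (measurableTypeR R) -> \bar R} :=
  @measure_function_pushforward__canonical__measure_function_Measure
    _ _ (measurableTypeR R) (measurableTypeR R) _ mu phi mphi.

Let na : {nonneg R} := NngNum (normr_ge0 a).

(** Lebesgue measure is determined by its values on half-open intervals, so only the preimage of
    []u, v]] has to be measured. *)
Lemma lebesgue_measure_affine (A : set R) : measurable A ->
  mscale na pm A = mu A.
Proof.
move=> mA; apply/esym/lebesgue_measure_unique => //= _ [[u v]] /= uv <-.
rewrite /mscale/= /pushforward.
have [a1|a1] := ltP 0 a.
  have -> : phi @^-1` `]u, v] = `](u - b) / a, (v - b) / a].
    apply/seteqP; split => x /=; rewrite !in_itv/= ltr_pdivrMr// ler_pdivlMr//;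
    rewrite /phi ltrBlDr lerBrDr mulrC//.
  rewrite !lebesgue_measure_itv/= !lte_fin ltr_pM2r ?invr_gt0// ltrD2r.
  case: ifPn => _; last by rewrite mule0.
  by rewrite -!EFinB -EFinM gtr0_norm//; congr EFin; field.
(* A negative slope exchanges the open and the closed end. *)
have a2 : a < 0 by rewrite lt_neqAle a0.
have -> : phi @^-1` `]u, v] = `[(v - b) / a, (u - b) / a[.
  apply/seteqP; split => x /=; rewrite !in_itv/= ltr_ndivlMr// ler_ndivrMr//;
  by rewrite /phi ltrBlDr lerBrDr mulrC andbC.
rewrite !lebesgue_measure_itv/= !lte_fin ltr_nM2r ?invr_lt0// ltrD2r.
case: ifPn => _; last by rewrite mule0.
by rewrite -!EFinB -EFinM ltr0_norm//; congr EFin; field.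
Qed.

Lemma ge0_integral_affine (f : R -> \bar R) : measurable_fun setT f ->
  (forall x, 0 <= f x)%E ->
  (`|a|%:E * \int[mu]_x f (a * x + b)%R = \int[mu]_x f x)%E.
Proof.
move=> mf f0.
rewrite -[RHS](@eq_measure_integral _ _ _ _ _
  (mscale na pm)).
  rewrite ge0_integral_mscale//.
  congr (_ * _)%E.
  by rewrite [RHS]ge0_integral_pushforward.
move=> A mA _; exact: lebesgue_measure_affine.
Qed.
End aff.

Lemma integrable_affine (a b : R) (f : R -> R) : a != 0 ->
  mu.-integrable setT (EFin \o f) ->
  mu.-integrable setT (EFin \o (fun x => f (a * x + b))).
Proof.
move=> a0 /integrableP[mf foo]; have mf' := measurable_affine a b.
apply/integrableP; split.
  apply: (measurableT_comp mf mf').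
have h := @ge0_integral_affine a b a0 (fun x => `|(f x)%:E|%E).
have E : (\int[mu]_x `|(EFin \o (fun x => f (a * x + b)%R)) x| =
   `|a|^-1%:E * \int[mu]_x `|(EFin \o f) x|)%E.
  rewrite /= -h//; last exact: measurableT_comp.
  by rewrite muleA -EFinM mulVf ?normr_eq0// mul1e.
by rewrite E lte_mul_pinfty// lee_fin invr_ge0.
Qed.

Lemma Rintegral_affine (a b : R) (f : R -> R) : a != 0 ->
  mu.-integrable setT (EFin \o f) ->
  \int[mu]_x f (a * x + b) = `|a|^-1 * \int[mu]_x f x.
Proof.
move=> a0 fi.
have fi' := integrable_affine b a0 fi.
have mf : measurable_fun setT (EFin \o f) by case/integrableP: fi.
suff -> : \int[mu]_x f x = `|a| * \int[mu]_x f (a * x + b).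
  by rewrite mulrA mulVf ?normr_eq0// mul1r.
pose g := EFin \o (fun x => f (a * x + b)%R).
have EP : (\int[mu]_x (EFin \o f)^\+ x = `|a|%:E * \int[mu]_x g^\+ x)%E.
  rewrite -(ge0_integral_affine b a0)//; last exact: measurable_funepos.
  by congr (_ * _)%E; apply: eq_integral => x _; rewrite funepos.unlock.
have EN : (\int[mu]_x (EFin \o f)^\- x = `|a|%:E * \int[mu]_x g^\- x)%E.
  rewrite -(ge0_integral_affine b a0)//; last exact: measurable_funeneg.
  by congr (_ * _)%E; apply: eq_integral => x _; rewrite funeneg.unlock.
have h1 : (\int[mu]_x g^\+ x)%E \is a fin_num.
  rewrite ge0_fin_numE; last exact: integral_ge0.
  exact: (integral_funepos_lt_pinfty measurableT fi').
have h2 : (\int[mu]_x g^\- x)%E \is a fin_num.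
  rewrite ge0_fin_numE; last exact: integral_ge0.
  exact: (integral_funeneg_lt_pinfty measurableT fi').
rewrite /Rintegral integralE [X in _ = _ * fine X]integralE EP EN.
rewrite -muleBr; [|by []|exact: fin_num_adde_defr].
by apply: (@fineM _ `|a|%:E) => //; rewrite fin_numB h1 h2.
Qed.
End Affine.

(** * Complex-valued integrals *)

Section CInt.
Variable R : realType.
Local Notation C := R[i].
Local Notation mu := (@lebesgue_measure R).
Implicit Types (D : set R) (h g : R -> C).

Lemma measurable_cos : measurable_fun setT (@cos R).
Proof. exact: continuous_measurable_fun (@continuous_cos R). Qed.
Lemma measurable_sin : measurable_fun setT (@sin R).
Proof. exact: continuous_measurable_fun (@continuous_sin R). Qed.

Section cmeas.
Context d (T : measurableType d).
Implicit Types (f k : T -> C) (E : set T).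

Definition cmeas E f := measurable_fun E (fun t => complex.Re (f t)) /\
  measurable_fun E (fun t => complex.Im (f t)).

Lemma cmeasD E f k : cmeas E f -> cmeas E k -> cmeas E (fun x => f x + k x).
Proof.
move=> [a b] [a' b']; split.
  under eq_fun do rewrite cReD; exact: measurable_funD.
under eq_fun do rewrite cImD; exact: measurable_funD.
Qed.

Lemma cmeasM E f k : cmeas E f -> cmeas E k -> cmeas E (fun x => f x * k x).
Proof.
move=> [a b] [a' b']; split.
  by under eq_fun do rewrite cReM; apply: measurable_funB; apply: measurable_funM.
by under eq_fun do rewrite cImM; apply: measurable_funD; apply: measurable_funM.
Qed.

Lemma cmeas_cst E (z : C) : cmeas E (fun _ => z).
Proof. by split; exact: measurable_cst. Qed.

Lemma cmeas_rc E (r : T -> R) : measurable_fun E r -> cmeas E (fun x => rc (r x)).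
Proof. by move=> mr; split => //=; exact: measurable_cst. Qed.

Lemma cmeas_expi E (r : T -> R) : measurable_fun E r -> cmeas E (fun x => expi (r x)).
Proof.
by move=> mr; split => /=; apply: measurableT_comp => //;
  [exact: measurable_cos|exact: measurable_sin].
Qed.

Lemma cmeas_sum E (I : Type) (s : seq I) (P : pred I) (F : I -> T -> C) :
  (forall i, P i -> cmeas E (F i)) -> cmeas E (fun x => \sum_(i <- s | P i) F i x).
Proof.
move=> HF; elim: s => [|i s IH].
  by under eq_fun do rewrite big_nil; exact: cmeas_cst.
under eq_fun do rewrite big_cons.
by case Pi: (P i) => //; apply: cmeasD => //; exact: HF.
Qed.

Lemma cmeas_prod E (I : Type) (s : seq I) (P : pred I) (F : I -> T -> C) :
  (forall i, P i -> cmeas E (F i)) -> cmeas E (fun x => \prod_(i <- s | P i) F i x).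
Proof.
move=> HF; elim: s => [|i s IH].
  by under eq_fun do rewrite big_nil; exact: cmeas_cst.
under eq_fun do rewrite big_cons.
by case Pi: (P i) => //; apply: cmeasM => //; exact: HF.
Qed.

Lemma cmeas_cabs E f : cmeas E f -> measurable_fun E (fun x => cabs (f x)).
Proof.
move=> [a b]; rewrite /cabs.
apply: (@measurableT_comp _ _ _ _ _ _ (@Num.sqrt R)).
  exact: continuous_measurable_fun (@sqrt_continuous R).
by apply: measurable_funD; exact: measurable_funX.
Qed.
End cmeas.

Lemma cmeas_comp d (T : measurableType d) (f : R -> C) (k : T -> R) (E : set T) :
  cmeas setT f -> measurable_fun E k -> cmeas E (fun x => f (k x)).
Proof.
move=> [a b] mk; split.
  exact: (@measurableT_comp _ _ _ _ _ _ (fun x => complex.Re (f x)) _ k a mk).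
exact: (@measurableT_comp _ _ _ _ _ _ (fun x => complex.Im (f x)) _ k b mk).
Qed.

Lemma cmeas_S (E : set R) h : cmeas setT h -> cmeas E h.
Proof. by move=> [a b]; split; exact: measurable_funTS. Qed.

Definition cintegrable D h :=
  mu.-integrable D (EFin \o (fun t => complex.Re (h t))) /\
  mu.-integrable D (EFin \o (fun t => complex.Im (h t))).

Lemma cintegrable_meas D h : cintegrable D h -> cmeas D h.
Proof.
by move=> [/integrableP[/measurable_EFinP a _] /integrableP[/measurable_EFinP b _]].
Qed.

Lemma rint_add D (f g : R -> R) : measurable D ->
  mu.-integrable D (EFin \o f) -> mu.-integrable D (EFin \o g) ->
  mu.-integrable D (EFin \o (fun x => f x + g x)).
Proof.
move=> mD a b; rewrite (_ : _ \o _ = ((EFin \o f) \+ (EFin \o g))%E)//.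
exact: integrableD.
Qed.

Lemma rint_mul D (f : R -> R) (r : R) : measurable D ->
  mu.-integrable D (EFin \o f) -> mu.-integrable D (EFin \o (fun x => r * f x)).
Proof.
move=> mD a; rewrite (_ : _ \o _ = (fun x => r%:E * (EFin \o f) x)%E)//.
exact: integrableZl.
Qed.

Lemma rint_norm D (f : R -> R) : measurable D ->
  mu.-integrable D (EFin \o f) -> mu.-integrable D (EFin \o (fun x => `|f x|)).
Proof. by move=> mD a; exact: (integrable_norm a). Qed.

Lemma rint_cst D (r : R) : measurable D -> (mu D < +oo)%E ->
  mu.-integrable D (EFin \o (fun=> r)).
Proof.
move=> mD fD; apply: measurable_bounded_integrable => //.
exists `|r|; split; first exact: num_real.
by move=> x Mx y _ /=; exact: ltW.
Qed.

Lemma eq_cintegrable D h g : measurable D ->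
  (forall x, D x -> h x = g x) -> cintegrable D h -> cintegrable D g.
Proof.
move=> mD hg [a b]; split; [apply: eq_integrable a|apply: eq_integrable b] => //;
by move=> x /set_mem Dx /=; rewrite hg.
Qed.

Lemma cintegrable_dom D h (k : R -> R) : measurable D -> cmeas D h ->
  mu.-integrable D (EFin \o k) -> (forall x, D x -> cabs (h x) <= k x) ->
  cintegrable D h.
Proof.
move=> mD [a b] ik hk; split; apply: le_integrable ik => //;
  try exact/measurable_EFinP; move=> x Dx /=; rewrite lee_fin.
- by rewrite (le_trans (Re_le_cabs _))// (le_trans (hk _ Dx))// ler_norm.
- by rewrite (le_trans (Im_le_cabs _))// (le_trans (hk _ Dx))// ler_norm.
Qed.

Lemma integrable_cabs D h : measurable D -> cintegrable D h ->
  mu.-integrable D (EFin \o (fun x => cabs (h x))).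
Proof.
move=> mD ih; have mh := cintegrable_meas ih; case: ih => a b.
have : mu.-integrable D (EFin \o (fun x => `|complex.Re (h x)| + `|complex.Im (h x)|)).
  by apply: rint_add => //; apply: rint_norm.
apply: le_integrable => //; first exact/measurable_EFinP/cmeas_cabs.
move=> x Dx /=; rewrite lee_fin ger0_norm ?cabs_ge0// (le_trans (cabs_le_ReIm _))//.
exact: ler_norm.
Qed.

Lemma cintegrableD D h g : measurable D -> cintegrable D h -> cintegrable D g ->
  cintegrable D (fun x => h x + g x).
Proof.
move=> mD ih ig; apply: (@cintegrable_dom _ _ (fun x => cabs (h x) + cabs (g x))) => //.
- by apply: cmeasD; exact: cintegrable_meas.
- by apply: rint_add => //; apply: integrable_cabs.
- by move=> x _; exact: cabsD.
Qed.

Lemma cintegrableM_bnd D h g (M : R) : measurable D -> cintegrable D h ->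
  cmeas D g -> (forall x, D x -> cabs (g x) <= M) -> cintegrable D (fun x => h x * g x).
Proof.
move=> mD ih mg gM; apply: (@cintegrable_dom _ _ (fun x => M * cabs (h x))) => //.
- by apply: cmeasM => //; exact: cintegrable_meas.
- by apply: rint_mul => //; apply: integrable_cabs.
- by move=> x Dx; rewrite cabsM mulrC ler_wpM2r ?cabs_ge0// gM.
Qed.

Lemma cintegrableZ D h (z : C) : measurable D -> cintegrable D h ->
  cintegrable D (fun x => z * h x).
Proof.
move=> mD ih; have := @cintegrableM_bnd D h (fun=> z) (cabs z) mD ih.
move=> /(_ (cmeas_cst _ _) (fun _ _ => lexx _)).
by apply: eq_cintegrable => // x _; rewrite mulrC.
Qed.

Lemma cintegrable0 D : cintegrable D (fun=> 0).
Proof. by split; exact: integrable0. Qed.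

Lemma cintegrable_sum D (I : Type) (s : seq I) (P : pred I) (F : I -> R -> C) :
  measurable D ->
  (forall i, P i -> cintegrable D (F i)) -> cintegrable D (fun x => \sum_(i <- s | P i) F i x).
Proof.
move=> mD HF; elim: s => [|i s IH].
  by under eq_fun do rewrite big_nil; exact: cintegrable0.
under eq_fun do rewrite big_cons.
by case Pi: (P i) => //; apply: cintegrableD => //; exact: HF.
Qed.

Lemma cintegrable_bnd D h (M : R) : measurable D -> (mu D < +oo)%E -> cmeas D h ->
  (forall x, D x -> cabs (h x) <= M) -> cintegrable D h.
Proof.
move=> mD fD mh hM; apply: (@cintegrable_dom _ _ (fun=> M)) => //.
exact: rint_cst.
Qed.

Lemma cintegrableS (D E : set R) h : measurable D -> measurable E -> E `<=` D ->
  cintegrable D h -> cintegrable E h.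
Proof. by move=> mD mE ED [a b]; split; [apply: integrableS a|apply: integrableS b]. Qed.

Lemma eq_cint D h g : (forall x, D x -> h x = g x) -> cint D h = cint D g.
Proof.
by move=> hg; apply: complex_ext => /=; apply: eq_Rintegral => x /set_mem Dx /=;
  rewrite hg.
Qed.

Lemma cint0 D : cint D (fun=> 0) = 0 :> C.
Proof.
by apply: complex_ext => /=; rewrite /Rintegral integral0.
Qed.

Lemma cintD D h g : measurable D -> cintegrable D h -> cintegrable D g ->
  cint D (fun x => h x + g x) = cint D h + cint D g.
Proof.
move=> mD [a b] [a' b']; apply: complex_ext; rewrite !cE /=.
  by rewrite -RintegralD//; apply: eq_Rintegral => x _; rewrite cReD.
by rewrite -RintegralD//; apply: eq_Rintegral => x _; rewrite cImD.
Qed.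

Lemma cintZ D h (z : C) : measurable D -> cintegrable D h ->
  cint D (fun x => z * h x) = z * cint D h.
Proof.
move=> mD [a b]; apply: complex_ext; rewrite !cE /=.
  rewrite -!RintegralZl// -RintegralB//; first by apply: eq_Rintegral => x _; rewrite cReM.
    exact: (rint_mul _ mD a).
  exact: (rint_mul _ mD b).
rewrite -!RintegralZl// -RintegralD//; first by apply: eq_Rintegral => x _; rewrite cImM.
  exact: (rint_mul _ mD b).
exact: (rint_mul _ mD a).
Qed.

Lemma cintB D h g : measurable D -> cintegrable D h -> cintegrable D g ->
  cint D (fun x => h x - g x) = cint D h - cint D g.
Proof.
move=> mD ih ig; rewrite -mulN1r -cintZ// -cintD//; last exact: cintegrableZ.
by apply: eq_cint => x _; rewrite mulN1r.
Qed.

Lemma cint_sum D (I : Type) (s : seq I) (P : pred I) (F : I -> R -> C) :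
  measurable D -> (forall i, P i -> cintegrable D (F i)) ->
  cint D (fun x => \sum_(i <- s | P i) F i x) = \sum_(i <- s | P i) cint D (F i).
Proof.
move=> mD HF; elim: s => [|i s IH].
  by rewrite big_nil -[RHS](cint0 D); apply: eq_cint => x _; rewrite big_nil.
rewrite big_cons; case: ifPn => Pi.
  rewrite -IH -cintD//; [|exact: HF|exact: cintegrable_sum].
  by apply: eq_cint => x _; rewrite big_cons Pi.
by rewrite -IH; apply: eq_cint => x _; rewrite big_cons (negbTE Pi).
Qed.

Lemma cint_rc D (f : R -> R) : cint D (fun x => rc (f x)) = rc (\int[mu]_(x in D) f x).
Proof.
apply: complex_ext => //=.
by rewrite /Rintegral integral0.
Qed.

(* Rotate the value of the integral onto the positive real axis. *)
Lemma cabs_cint_le D h : measurable D -> cintegrable D h ->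
  cabs (cint D h) <= \int[mu]_(x in D) cabs (h x).
Proof.
move=> mD ih; have [w w1 wh] := cabs_rot (cint D h).
have -> : cabs (cint D h) = complex.Re (cint D (fun x => w * h x)).
  by rewrite cintZ// wh.
have [iw _] := cintegrableZ w mD ih.
apply: le_Rintegral => //; first exact: integrable_cabs.
by move=> x _; rewrite (le_trans (ler_norm _))// (le_trans (Re_le_cabs _))// cabsM w1 mul1r.
Qed.

Lemma cabs_cint_dom D h (k : R -> R) : measurable D -> cmeas D h ->
  mu.-integrable D (EFin \o k) -> (forall x, D x -> cabs (h x) <= k x) ->
  cabs (cint D h) <= \int[mu]_(x in D) k x.
Proof.
move=> mD mh ik hk; have ih := cintegrable_dom mD mh ik hk.
apply: le_trans (cabs_cint_le mD ih) _.
by apply: le_Rintegral => //; exact: integrable_cabs.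
Qed.

Lemma cabs_cint_bnd D h (M : R) : measurable D -> (mu D < +oo)%E -> cmeas D h ->
  (forall x, D x -> cabs (h x) <= M) -> cabs (cint D h) <= M * fine (mu D).
Proof.
move=> mD fD mh hM; rewrite -Rintegral_cst//; apply: cabs_cint_dom => //.
exact: rint_cst.
Qed.

Lemma cint_mkcond D h :
  cint D h = cint setT (fun x => if x \in D then h x else 0).
Proof.
apply: complex_ext => /=; rewrite Rintegral_mkcond; apply: eq_Rintegral => x _;
by rewrite /patch; case: ifP.
Qed.

Lemma cint_sub (D E : set R) h : measurable D -> measurable E -> E `<=` D ->
  (forall x, D x -> ~ E x -> h x = 0) -> cint D h = cint E h.
Proof.
move=> mD mE ED h0; rewrite cint_mkcond [RHS]cint_mkcond.
apply: eq_cint => x _; case: ifPn; case: ifPn => //.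
- by move=> /negP xE /set_mem Dx; apply: h0 => // Ex; apply: xE; exact: mem_set.
- by move=> /set_mem /ED Dx /negP; rewrite -in_setE in Dx; rewrite Dx.
Qed.

Lemma cintegrable_affine h (a b : R) : a != 0 -> cintegrable setT h ->
  cintegrable setT (fun x => h (a * x + b)).
Proof.
by move=> a0 [i1 i2]; split; [have := integrable_affine b a0 i1|have := integrable_affine b a0 i2].
Qed.

Lemma cint_affine h (a b : R) : a != 0 -> cintegrable setT h ->
  cint setT (fun x => h (a * x + b)) = rc (`|a|^-1) * cint setT h.
Proof.
move=> a0 [i1 i2]; apply: complex_ext; rewrite !cE ?mul0r ?subr0 ?addr0 /=.
  exact: (@Rintegral_affine R a b (fun x => complex.Re (h x))).
exact: (@Rintegral_affine R a b (fun x => complex.Im (h x))).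
Qed.

Lemma cint_itv_fin (a b : R) : (mu `[a, b] < +oo)%E.
Proof. by rewrite lebesgue_measure_itv/=; case: ifP => _; rewrite -?EFinB ltry. Qed.

Lemma fine_mu_itv (a b : R) : a <= b -> fine (mu `[a, b]) = b - a.
Proof.
rewrite le_eqVlt => /predU1P[->|ab].
  by rewrite lebesgue_measure_itv/= lte_fin ltxx subrr.
by rewrite lebesgue_measure_itv/= lte_fin ab.
Qed.

End CInt.

(** * Fubini under a product majorant *)

Section Swap.
Variable R : realType.
Local Notation C := R[i].
Local Notation mu := (@lebesgue_measure R).

Section real_swap.
Variables (f : R * R -> R) (P Q : R -> R).
Hypotheses (mf : measurable_fun setT f).
Hypotheses (iP : mu.-integrable setT (EFin \o P)) (iQ : mu.-integrable setT (EFin \o Q)).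
Hypotheses (P0 : forall x, 0 <= P x) (Q0 : forall x, 0 <= Q x).
Hypothesis fPQ : forall x y, `|f (x, y)| <= P x * Q y.

Let integrable_section1 x : mu.-integrable setT (EFin \o (fun y => f (x, y))).
Proof.
apply: (@le_integrable _ _ _ mu setT measurableT _ (EFin \o (fun y => P x * Q y))).
- apply/measurable_EFinP; exact: (measurableT_comp mf).
- by move=> y _ /=; rewrite lee_fin (le_trans (fPQ _ _))// ler_norm.
- exact: rint_mul.
Qed.

Let integrable_section2 y : mu.-integrable setT (EFin \o (fun x => f (x, y))).
Proof.
apply: (@le_integrable _ _ _ mu setT measurableT _ (EFin \o (fun x => Q y * P x))).
- apply/measurable_EFinP; exact: (measurableT_comp mf).
- by move=> x _ /=; rewrite lee_fin (le_trans (fPQ _ _))// mulrC ler_norm.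
- exact: rint_mul.
Qed.

(** The majorant [P x * Q y] makes |f| integrable on the plane, which is what Fubini requires. *)
Lemma Rintegral_swap :
  \int[mu]_x (\int[mu]_y f (x, y)) = \int[mu]_y (\int[mu]_x f (x, y)).
Proof.
rewrite /Rintegral.
under eq_integral => x _.
  rewrite fineK; last by apply: integrable_fin_num => //; exact: integrable_section1.
  over.
under [X in _ = fine X]eq_integral => y _.
  rewrite fineK; last by apply: integrable_fin_num => //; exact: integrable_section2.
  over.
congr fine.
apply: (@Fubini _ _ _ _ R mu mu (EFin \o f)).
have mf' : measurable_fun setT (EFin \o f) by exact/measurable_EFinP.
apply/(integrable12ltyP mu mu mf').
have iQ' : (\int[mu]_y (Q y)%:E \is a fin_num)%E by exact: integrable_fin_num.
apply: (@le_lt_trans _ _ (\int[mu]_x ((P x)%:E * \int[mu]_y (Q y)%:E))%E).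
  apply: ge0_le_integral => //.
  - by move=> x _; exact: integral_ge0.
  - have maf : measurable_fun setT (abse \o (EFin \o f)) by exact: measurableT_comp.
    exact: (measurable_fun_fubini_tonelli_F (m2 := mu) (abse \o (EFin \o f)) maf (fun=> abse_ge0 _)).
  - rewrite -(fineK iQ'); under eq_fun do rewrite -EFinM.
    apply/measurable_EFinP/measurable_funM; last exact: measurable_cst.
    by case/integrableP: iP => /measurable_EFinP.
  - move=> x _; rewrite -(fineK iQ') -/(Rintegral mu setT Q) -EFinM.
    rewrite -RintegralZl// /Rintegral fineK; last first.
      by apply: integrable_fin_num => //; exact: rint_mul.
    apply: ge0_le_integral => //=.
    - by have /integrableP[] := rint_norm measurableT (integrable_section1 x).
    - apply/measurable_EFinP/measurable_funM; first exact: measurable_cst.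
      by case/integrableP: iQ => /measurable_EFinP.
    - by move=> y _; rewrite lee_fin.
rewrite -(fineK iQ'); under eq_integral do rewrite -EFinM mulrC.
apply: integrable_lty => //.
exact: rint_mul.
Qed.
End real_swap.

Lemma cint_swap (F : R * R -> C) (P Q : R -> R) :
  cmeas setT F ->
  mu.-integrable setT (EFin \o P) -> mu.-integrable setT (EFin \o Q) ->
  (forall x, 0 <= P x) -> (forall x, 0 <= Q x) ->
  (forall x y, cabs (F (x, y)) <= P x * Q y) ->
  cint setT (fun x => cint setT (fun y => F (x, y))) =
  cint setT (fun y => cint setT (fun x => F (x, y))).
Proof.
move=> [m1 m2] iP iQ P0 Q0 FPQ; apply: complex_ext => /=.
  apply: (@Rintegral_swap (fun z => complex.Re (F z)) P Q) => //.
  by move=> x y; exact: le_trans (Re_le_cabs _) (FPQ x y).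
apply: (@Rintegral_swap (fun z => complex.Im (F z)) P Q) => //.
by move=> x y; exact: le_trans (Im_le_cabs _) (FPQ x y).
Qed.

(** The multiplication formula for Fourier transforms with the phase [psi] left free: a linear phase
    serves the inversion formula, the quadratic one the filter in time. *)
Lemma cint_swap_expi (p q : R -> C) (psi : R -> R) :
  cintegrable setT p -> cintegrable setT q -> measurable_fun setT psi ->
  cint setT (fun y => p y * cint setT (fun eta => q eta * expi (y * psi eta))) =
  cint setT (fun eta => q eta * cint setT (fun y => p y * expi (y * psi eta))).
Proof.
move=> ip iq mpsi.
have mq y : cintegrable setT (fun eta => q eta * expi (y * psi eta)).
  apply: (@cintegrableM_bnd _ _ _ _ 1) => //.
    by apply: cmeas_expi; exact: measurable_funM.
  by move=> x _; rewrite cabs_expi.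
have mp eta : cintegrable setT (fun y => p y * expi (y * psi eta)).
  apply: (@cintegrableM_bnd _ _ _ _ 1) => //.
    by apply: cmeas_expi; exact: measurable_funM.
  by move=> x _; rewrite cabs_expi.
have := @cint_swap (fun z => p z.1 * (q z.2 * expi (z.1 * psi z.2)))
  (fun x => cabs (p x)) (fun x => cabs (q x)).
move=> /= H; transitivity (cint setT (fun x => cint setT (fun y => p x * (q y * expi (x * psi y))))).
  by apply: eq_cint => x _; rewrite (cintZ (p x) measurableT (mq x)).
rewrite H.
- apply: eq_cint => y _; rewrite -(cintZ (q y) measurableT (mp y)).
  by apply: eq_cint => x _; rewrite mulrCA.
- apply: cmeasM; last apply: cmeasM.
  + exact: (cmeas_comp (cintegrable_meas ip) measurable_fst).
  + exact: (cmeas_comp (cintegrable_meas iq) measurable_snd).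
  + apply: cmeas_expi; apply: measurable_funM; [exact: measurable_fst|exact: (measurableT_comp mpsi measurable_snd)].
- exact: integrable_cabs.
- exact: integrable_cabs.
- by move=> x; exact: cabs_ge0.
- by move=> x; exact: cabs_ge0.
- by move=> x y; rewrite !cabsM cabs_expi mulr1.
Qed.

End Swap.

(** * The kernel (1 - cos(as))/s^2 *)

Section SincSquare.
Variable R : realType.
Local Notation C := R[i].
Local Notation mu := (@lebesgue_measure R).

Definition wt (s : R) : R := (1 + s ^+ 2)^-1.

Lemma wt_gt0 s : 0 < wt s.
Proof. by rewrite invr_gt0 ltr_pwDl// sqr_ge0. Qed.

Lemma measurable_wt : measurable_fun setT wt.
Proof. apply: continuous_measurable_fun; exact: continuous_oneDsqrV. Qed.

Lemma integrable_wt : mu.-integrable setT (EFin \o wt).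
Proof.
apply/integrableP; split; first by apply/measurable_EFinP; exact: measurable_wt.
under eq_integral => x _ do rewrite /= ger0_norm ?(ltW (wt_gt0 x))//.
rewrite ge0_symfun_integralT.
- rewrite -set_itvcy (_ : (fun x => (wt x)%:E) = (fun x => (oneDsqr x)^-1%:E))//.
  by rewrite integral0y_oneDsqr -EFinM ltry.
- by move=> x; exact: ltW (wt_gt0 x).
- exact: continuous_oneDsqrV.
- by move=> x; rewrite /wt /= sqrrN.
Qed.

Lemma rint_mkcond (D : set R) (f : R -> R) : measurable D ->
  mu.-integrable D (EFin \o f) -> mu.-integrable setT (EFin \o (f \_ D)).
Proof.
move=> mD fi; have := (integrable_mkcond (mu := mu) (EFin \o f) mD).1 fi.
by rewrite restrict_EFin.
Qed.

Lemma Rintegral_gt0 (f : R -> R) (a b c : R) : mu.-integrable setT (EFin \o f) ->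
  (forall x, 0 <= f x) -> a < b -> 0 < c -> (forall x, a <= x <= b -> c <= f x) ->
  0 < \int[mu]_x f x.
Proof.
move=> fi f0 ab c0 cf.
have : \int[mu]_(x in `[a, b]) c <= \int[mu]_x f x.
  rewrite Rintegral_mkcond; apply: le_Rintegral => //.
    apply: rint_mkcond => //.
    by apply: rint_cst => //; exact: cint_itv_fin.
  move=> x _; rewrite /patch; case: ifPn => [/set_mem/=|_]; last exact: f0.
  by rewrite in_itv/= => /cf.
apply: lt_le_trans; rewrite Rintegral_cst// fine_mu_itv ?ltW//.
by rewrite mulr_gt0// subr_gt0.
Qed.

Lemma measurable_invsqr : measurable_fun setT (fun s : R => (s ^+ 2)^-1).
Proof.
have -> : (fun s : R => (s ^+ 2)^-1) = (fun s => (s ^+ 2) `^ (-1)).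
  by apply/funext => s; rewrite powR_inv1// sqr_ge0.
by apply: (@measurableT_comp _ _ _ _ _ _ (@powR R ^~ (-1))).
Qed.

(* The value at s = 0 is the limit. *)
Definition jker (a s : R) : R :=
  if s == 0 then a ^+ 2 / 2 else (1 - cos (a * s)) / s ^+ 2.

Lemma jker_scale a s : jker a s = a ^+ 2 * jker 1 (a * s).
Proof.
rewrite /jker mul1r expr1n.
have [->|s0] := eqVneq s 0; first by rewrite mulr0 eqxx mul1r.
have [->|a0] := eqVneq a 0; first by rewrite mul0r expr0n mul0r cos0 subrr mul0r.
rewrite mulf_eq0 (negbTE s0) (negbTE a0)/= exprMn; field.
by rewrite a0 s0.
Qed.

Lemma measurable_jker a : measurable_fun setT (jker a).
Proof.
have -> : jker a = (fun s => (1 - cos (a * s)) * (s ^+ 2)^-1 + a ^+ 2 / 2 * \1_[set (0 : R)] s).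
  apply/funext => s; rewrite /jker indicE; have [->|s0] := eqVneq s 0.
    by rewrite mem_set// mulr1 mulr0 cos0 subrr mul0r add0r.
  by rewrite memNset ?mulr0 ?addr0//= => /eqP; rewrite (negbTE s0).
apply: measurable_funD; last by apply: measurable_funM => //; exact: measurable_indic.
apply: measurable_funM; last exact: measurable_invsqr.
apply: measurable_funB => //; apply: (measurableT_comp (@measurable_cos R)).
exact: measurable_funM.
Qed.

Lemma jker_ge0 a s : 0 <= jker a s.
Proof.
rewrite /jker; case: ifP => _; first by rewrite divr_ge0// sqr_ge0.
by rewrite divr_ge0 ?sqr_ge0// subr_ge0 cos_le1.
Qed.

Lemma jker_le a s : jker a s <= a ^+ 2 / 2.
Proof.
rewrite /jker; case: eqVneq => // s0.
rewrite ler_pdivrMr ?exprn_even_gt0//.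
apply: le_trans (oneBcos_le _) _; rewrite exprMn; lra.
Qed.

Lemma jker_le_inv a s : jker a s * s ^+ 2 <= 2.
Proof.
rewrite /jker; case: eqVneq => [->|s0]; first by rewrite expr0n mulr0.
rewrite divfK ?expf_neq0//; have := cos_geN1 (a * s); lra.
Qed.

Lemma jker1_le s : jker 1 s <= 4 * wt s.
Proof.
rewrite /wt ler_pdivlMr; last by have := sqr_ge0 s; lra.
rewrite mulrDr mulr1; have := jker_le 1 s; have := jker_le_inv 1 s.
rewrite expr1n; lra.
Qed.

(** With s = 2v this reads sin^2 v >= v^2 - v^4, which follows by squaring sin v >= v - v^3/2 and
    dropping v^6/4. For v > 1 the left side is not positive. *)
Lemma jker1_ge s : 1 / 2 - s ^+ 2 / 8 <= jker 1 s.
Proof.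
rewrite /jker; case: eqVneq => [->|s0]; first by rewrite !expr0n expr1n/=; lra.
rewrite [1 * s]mul1r ler_pdivlMr ?exprn_even_gt0//= oneBcos_half.
wlog s1 : s s0 / 0 <= s => [hw|].
  have [s1|/ltW s1] := leP 0 s; first exact: hw.
  by have := hw (- s); rewrite oppr_eq0 oppr_ge0 mulNr sinN !sqrrN; apply.
set v := s / 2; have sv : s = 2 * v by rewrite /v; field.
have v0 : 0 <= v by rewrite /v divr_ge0.
have h := sin_ge_sub v0.
have [v1|v1] := leP v 1.
  have h0 : 0 <= v - v ^+ 3 / 2.
    have : v ^+ 3 <= v by rewrite exprS ler_piMr// exprn_ile1.
    lra.
  have h2 : (v - v ^+ 3 / 2) ^+ 2 <= sin v ^+ 2.
    by rewrite lerXn2r// nnegrE// (le_trans h0).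
  have : 0 <= v ^+ 6 by rewrite exprn_ge0.
  have -> : v ^+ 6 = 4 * ((v - v ^+ 3 / 2) ^+ 2 - v ^+ 2 + v ^+ 4) by field.
  have -> : (1 / 2 - s ^+ 2 / 8) * s ^+ 2 = 2 * (v ^+ 2 - v ^+ 4) by rewrite sv; field.
  lra.
apply: (@le_trans _ _ 0); last by rewrite mulr_ge0// sqr_ge0.
rewrite pmulr_lle0 ?exprn_even_gt0//.
have : 1 <= v ^+ 2 by rewrite exprn_ege1// ltW.
have -> : s ^+ 2 = 4 * v ^+ 2 by rewrite {1}sv; ring.
lra.
Qed.

Lemma integrable_jker a : mu.-integrable setT (EFin \o jker a).
Proof.
have i1 : mu.-integrable setT (EFin \o jker 1).
  apply: (@le_integrable _ _ _ mu setT measurableT _ (EFin \o (fun s => 4 * wt s))).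
  - by apply/measurable_EFinP; exact: measurable_jker.
  - move=> s _ /=; rewrite lee_fin ger0_norm ?jker_ge0//.
    by rewrite (le_trans (jker1_le s))// ler_norm.
  - by apply: rint_mul => //; exact: integrable_wt.
have [->|a0] := eqVneq a 0.
  rewrite (_ : jker 0 = fun=> 0); first exact: integrable0.
  by apply/funext => s; rewrite jker_scale expr0n mul0r.
have := integrable_affine 0 a0 i1 => i2.
have := rint_mul (a ^+ 2) measurableT i2.
by apply: eq_integrable => // s _ /=; rewrite [jker a s]jker_scale addr0.
Qed.

(** The value is pi; it is carried along as a positive constant. *)
Definition JC : R := \int[mu]_s jker 1 s.

Lemma JC_gt0 : 0 < JC.
Proof.
apply: (@Rintegral_gt0 _ 0 1 (3 / 8)) => //.
- exact: integrable_jker.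
- exact: jker_ge0.
- move=> x /andP[x0 x1]; apply: le_trans (jker1_ge x).
  have : x ^+ 2 <= 1 by rewrite exprn_ile1.
  lra.
Qed.

Lemma Rintegral_jker a : \int[mu]_s jker a s = JC * `|a|.
Proof.
have [->|a0] := eqVneq a 0.
  rewrite normr0 mulr0 (_ : jker 0 = fun=> 0); first by rewrite /Rintegral integral0.
  by apply/funext => s; rewrite jker_scale expr0n mul0r.
have := Rintegral_affine 0 a0 (integrable_jker 1).
under eq_Rintegral do rewrite addr0.
move=> h; under eq_Rintegral do rewrite jker_scale.
rewrite RintegralZl//.
  rewrite h -/JC -[a ^+ 2]real_normK ?num_real//; field; by rewrite normr_eq0.
have := integrable_affine 0 a0 (integrable_jker 1).
by apply: eq_integrable => // s _ /=; rewrite addr0.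
Qed.

(** For a > 0 this is the triangle max(0, a - |om|), written in the form in which it drops out of
    [jker_cos] once each [jker] is integrated. *)
Definition tri (a om : R) : R := (`|a + om| + `|a - om|) / 2 - `|om|.

Lemma jker_cos a om s : jker a s * cos (om * s) =
  (jker (a + om) s + jker (a - om) s) / 2 - jker om s.
Proof.
rewrite /jker; case: eqVneq => [->|s0]; first by rewrite mulr0 cos0; field.
rewrite [(a + om) * s]mulrDl [(a - om) * s]mulrBl cosB cosD; field; exact: s0.
Qed.

Lemma cintegrable_rc (f : R -> R) : mu.-integrable setT (EFin \o f) ->
  cintegrable setT (fun x => rc (f x)).
Proof. by move=> i; split => //; exact: integrable0. Qed.

Lemma cintegrable_jker_expi a om :
  cintegrable setT (fun s => rc (jker a s) * expi (om * s)).
Proof.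
apply: (@cintegrableM_bnd _ _ _ _ 1) => //.
- exact: cintegrable_rc (integrable_jker a).
- by apply: cmeas_expi; exact: measurable_funM.
- by move=> x _; rewrite cabs_expi.
Qed.

(** The real part follows from the product formula and scaling; the imaginary part equals its own
    negative under s -> -s. *)
Lemma cint_jker_expi a om :
  cint setT (fun s => rc (jker a s) * expi (om * s)) = rc (JC * tri a om).
Proof.
apply: complex_ext => /=.
  transitivity (\int[mu]_s ((1 / 2 * jker (a + om) s + 1 / 2 * jker (a - om) s)
     + (-1) * jker om s)).
    by apply: eq_Rintegral => s _; rewrite mul0r subr0 jker_cos; field.
  have i1 := rint_mul (1 / 2) measurableT (integrable_jker (a + om)).
  have i2 := rint_mul (1 / 2) measurableT (integrable_jker (a - om)).
  have i3 := rint_mul (-1) measurableT (integrable_jker om).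
  rewrite RintegralD//; last exact: rint_add.
  rewrite RintegralD// !RintegralZl//; try exact: integrable_jker.
  by rewrite !Rintegral_jker /tri; field.
have hi : mu.-integrable setT (EFin \o (fun s => jker a s * sin (om * s))).
  have [_] := cintegrable_jker_expi a om.
  by apply: eq_integrable => // s _ /=; rewrite mul0r addr0.
have n1 : -1 != 0 :> R by rewrite oppr_eq0 oner_eq0.
have := Rintegral_affine 0 n1 hi; rewrite normrN1 invr1 mul1r.
set I := (X in _ = X) => e.
have eI : I = - I.
  transitivity (\int[mu]_x (-1 * (jker a x * sin (om * x)))).
    rewrite -e; apply: eq_Rintegral => s _.
    have jN : jker a (- s) = jker a s by rewrite /jker oppr_eq0 sqrrN mulrN cosN.
    by rewrite !mulN1r addr0 jN !mulrN sinN mulrN.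
  by rewrite RintegralZl// mulN1r.
transitivity I; last lra.
by apply: eq_Rintegral => s _; rewrite mul0r addr0.
Qed.

Lemma tri_scale a om : 0 < a -> tri a (a * om) = a * tri 1 om.
Proof.
move=> a0; rewrite /tri -{1 3}[a]mulr1 -mulrBr -mulrDr !normrM (gtr0_norm a0); ring.
Qed.

Lemma tri1_supp om : 1 <= `|om| -> tri 1 om = 0.
Proof.
rewrite /tri; case: (ler0P om) => ho h.
  rewrite [`|1 + om|]ler0_norm; last lra.
  by rewrite [`|1 - om|]ger0_norm; lra.
rewrite [`|1 + om|]ger0_norm; last lra.
by rewrite [`|1 - om|]ler0_norm; lra.
Qed.

Lemma tri1E om : `|om| <= 1 -> tri 1 om = 1 - `|om|.
Proof.
rewrite ler_norml => /andP[h1 h2]; rewrite /tri ger0_norm; last lra.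
by rewrite ger0_norm; lra.
Qed.

Lemma tri1_ge0 om : 0 <= tri 1 om.
Proof.
have [h|h] := leP 1 `|om|; first by rewrite tri1_supp.
by have h' := ltW h; rewrite tri1E// subr_ge0.
Qed.

Lemma tri1_le1 om : tri 1 om <= 1.
Proof.
have [h|h] := leP 1 `|om|; first by rewrite tri1_supp.
by have h' := ltW h; rewrite tri1E// lerBlDr lerDl.
Qed.

Lemma continuous_tri a : continuous (tri a).
Proof.
move=> x; rewrite /tri; apply: cvgB; last exact: norm_continuous.
apply: cvgMl; apply: cvgD.
  apply: (@continuous_comp _ _ _ (fun y : R => a + y) Num.norm); last exact: norm_continuous.
  by apply: cvgD; [exact: cvg_cst|exact: cvg_id].
apply: (@continuous_comp _ _ _ (fun y : R => a - y) Num.norm); last exact: norm_continuous.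
by apply: cvgB; [exact: cvg_cst|exact: cvg_id].
Qed.

Definition tri2pi (z : R) := tri 1 (2 * pi * z).

Lemma twopi_gt0 : 0 < 2 * pi :> R.
Proof. by rewrite mulr_gt0// pi_gt0. Qed.

Lemma tri2pi_supp z : 1 <= `|z| -> tri2pi z = 0.
Proof.
move=> z1; apply: tri1_supp; rewrite normrM (gtr0_norm twopi_gt0).
have := @pi_ge2 R; nra.
Qed.

Lemma cintegrable_supp (D : set R) (h : R -> C) : measurable D -> cintegrable D h ->
  (forall x, ~ D x -> h x = 0) -> cintegrable setT h.
Proof.
move=> mD [a b] h0; split.
  have := rint_mkcond mD a; apply: eq_integrable => // x _ /=.
  by rewrite /patch; case: ifPn => // /negP xD; rewrite h0//= => /mem_set.
have := rint_mkcond mD b; apply: eq_integrable => // x _ /=.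
by rewrite /patch; case: ifPn => // /negP xD; rewrite h0//= => /mem_set.
Qed.

Lemma integrable_tri2pi : mu.-integrable setT (EFin \o tri2pi).
Proof.
have mt : measurable_fun setT tri2pi.
  apply: (@measurableT_comp _ _ _ _ _ _ (tri 1)).
    by apply: continuous_measurable_fun; exact: continuous_tri.
  exact: measurable_funM.
suff [] : cintegrable setT (fun z => rc (tri2pi z)) by [].
apply: (@cintegrable_supp `[-1, 1]) => //.
  apply: (@cintegrable_bnd _ _ _ 1) => //.
  - exact: cint_itv_fin.
  - by apply: cmeas_rc; exact: measurable_funTS.
  - by move=> x _; rewrite cabs_rc ger0_norm ?tri1_le1// tri1_ge0.
move=> x /= /negP; rewrite in_itv/= -ler_norml -ltNge => /ltW/tri2pi_supp ->.
exact: rc0.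
Qed.

Definition m0 : R := \int[mu]_z tri2pi z.

Lemma m0_gt0 : 0 < m0.
Proof.
have p0 := @pi_gt0 R.
have p4 : 0 < 4 * pi :> R by rewrite mulr_gt0.
apply: (@Rintegral_gt0 _ 0 (4 * pi)^-1 (1 / 2)) => //.
- exact: integrable_tri2pi.
- by move=> x; exact: tri1_ge0.
- by rewrite invr_gt0.
move=> x /andP[x0 x1].
have h : 2 * pi * x <= 1 / 2.
  have : x * (4 * pi) <= 1 by rewrite -ler_pdivlMr// div1r.
  lra.
have h0 : 0 <= 2 * pi * x by rewrite mulr_ge0// ltW// twopi_gt0.
rewrite /tri2pi tri1E ger0_norm//; lra.
Qed.

Lemma Rintegral_tri a x : 0 < a -> \int[mu]_y tri a (2 * pi * (x - y)) = a ^+ 2 * m0.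
Proof.
move=> a0.
have an0 : - a^-1 != 0 by rewrite oppr_eq0 invr_eq0 gt_eqF.
have i1 := integrable_affine (x / a) an0 integrable_tri2pi.
have e : (fun y => tri a (2 * pi * (x - y))) = (fun y => a * tri2pi (- a^-1 * y + x / a)).
  apply/funext => y; rewrite /tri2pi -tri_scale//; congr tri; field; exact: lt0r_neq0.
rewrite e RintegralZl// (Rintegral_affine _ an0 integrable_tri2pi) -/m0.
rewrite normrN normfV gtr0_norm// invrK; ring.
Qed.

Lemma integrable_tri a x : 0 < a ->
  mu.-integrable setT (EFin \o (fun y => tri a (2 * pi * (x - y)))).
Proof.
move=> a0.
have an0 : - a^-1 != 0 by rewrite oppr_eq0 invr_eq0 gt_eqF.
have i1 := integrable_affine (x / a) an0 integrable_tri2pi.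
have -> : (fun y => tri a (2 * pi * (x - y))) = (fun y => a * tri2pi (- a^-1 * y + x / a)).
  apply/funext => y; rewrite /tri2pi -tri_scale//; congr tri; field; exact: lt0r_neq0.
exact: rint_mul.
Qed.

End SincSquare.

(** * Fourier inversion for a band-limited integrable function *)

Section Inversion.
Variable R : realType.
Local Notation C := R[i].
Local Notation mu := (@lebesgue_measure R).

Definition ft1 (phi : R -> R) (eta : R) : C :=
  cint setT (fun x => rc (phi x) * expi (- (2 * pi * x * eta))).

Lemma jker_half_dist (a s : R) : `|s| <= 1 -> `|jker a s - a ^+ 2 / 2| <= a ^+ 4 / 8.
Proof.
move=> s1; have h1 := jker_le a s.
have h2 : a ^+ 2 * (1 / 2 - (a * s) ^+ 2 / 8) <= jker a s.
  by rewrite jker_scale ler_wpM2l ?sqr_ge0// jker1_ge.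
have h3 : s ^+ 2 <= 1 by rewrite -[s ^+ 2]real_normK ?num_real// exprn_ile1.
have h4 : a ^+ 4 * s ^+ 2 <= a ^+ 4 by rewrite ler_piMr// exprn_even_ge0.
rewrite ler0_norm ?subr_le0//.
have : a ^+ 2 * (1 / 2 - (a * s) ^+ 2 / 8) = a ^+ 2 / 2 - a ^+ 4 * s ^+ 2 / 8 by field.
lra.
Qed.

Lemma cabs_small (z : C) : (forall e : R, 0 < e -> cabs z <= e) -> z = 0.
Proof.
move=> h; apply/eqP; rewrite -cabs_eq0 eq_le cabs_ge0 andbT.
by apply/ler_addgt0Pr => e e0; rewrite add0r h.
Qed.

Variable phi : R -> R.
Hypothesis iphi : mu.-integrable setT (EFin \o phi).
Hypothesis cphi : continuous phi.

Let Phi := ft1 phi.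
Definition l1norm : R := \int[mu]_x `|phi x|.

Lemma l1norm_ge0 : 0 <= l1norm.
Proof. exact: Rintegral_ge0. Qed.

Lemma integrable_phi_expi eta :
  cintegrable setT (fun x => rc (phi x) * expi (- (2 * pi * x * eta))).
Proof.
apply: (@cintegrableM_bnd _ _ _ _ 1) => //; first exact: cintegrable_rc.
  by apply: cmeas_expi; apply: measurable_funN; apply: measurable_funM => //.
by move=> x _; rewrite cabs_expi.
Qed.

Lemma ft1_le eta : cabs (Phi eta) <= l1norm.
Proof.
apply: le_trans (cabs_cint_le measurableT (integrable_phi_expi eta)) _.
rewrite le_eqVlt; apply/orP; left; apply/eqP.
by apply: eq_Rintegral => x _; rewrite cabsM cabs_expi mulr1 cabs_rc.
Qed.

Let cont_of (k : R -> R) : continuous k -> (forall x, `|k x| <= 1) ->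
  continuous (fun eta : R => \int[mu]_x (phi x * k (2 * pi * x * eta))).
Proof.
move=> ck k1 eta.
have mphi : measurable_fun setT phi by exact: continuous_measurable_fun.
have mk : measurable_fun setT k by exact: continuous_measurable_fun.
apply: (@continuity_under_integral R _ _ mu (fun eta x => phi x * k (2 * pi * x * eta))
  setT measurableT (eta - 1) (eta + 1) _ _ (fun x => `|phi x|)).
- move=> e _; apply: (@le_integrable _ _ _ mu setT measurableT _ (EFin \o phi)) => //.
    apply/measurable_EFinP; apply: measurable_funM => //.
    apply: (measurableT_comp mk); apply: measurable_funM => //; exact: measurable_funM.
  by move=> x _ /=; rewrite lee_fin normrM ler_piMr.
- apply: aeW => x _ y _; apply: cvgMl_tmp.
  apply: (@continuous_comp _ _ _ (fun e : R => 2 * pi * x * e) k); last exact: ck.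
  by apply: cvgMl_tmp; exact: cvg_id.
- exact: rint_norm.
- by move=> e _; apply: aeW => x _; rewrite normrM ler_piMr.
- by apply/mem_set => /=; rewrite in_itv/=; apply/andP; split; lra.
Qed.

Lemma cmeas_ft1 : cmeas setT Phi.
Proof.
split; apply: continuous_measurable_fun.
  rewrite (_ : (fun t : R => _) = (fun eta : R => \int[mu]_x (phi x * cos (2 * pi * x * eta)))).
    by apply: cont_of; [exact: continuous_cos|exact: cos_max].
  by apply/funext => eta; apply: eq_Rintegral => x _; rewrite !cE mul0r subr0 cosN.
rewrite (_ : (fun t : R => _) = (fun eta : R => \int[mu]_x (phi x * - sin (2 * pi * x * eta)))).
  apply: (@cont_of (fun x => - sin x)); last by move=> x; rewrite normrN sin_max.
  by move=> x; apply: cvgN; exact: continuous_sin.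
by apply/funext => eta; apply: eq_Rintegral => x _; rewrite !cE mul0r addr0 sinN.
Qed.

Hypothesis supp : forall eta, 1 <= `|eta| -> Phi eta = 0.

Lemma cintegrable_ft1 : cintegrable setT Phi.
Proof.
apply: (@cintegrable_supp _ `[-1, 1]) => //.
  apply: (@cintegrable_bnd _ _ _ l1norm) => //.
  - exact: cint_itv_fin.
  - exact: cmeas_S cmeas_ft1.
  - by move=> x _; exact: ft1_le.
by move=> x /= /negP; rewrite in_itv/= -ler_norml -ltNge => /ltW/supp.
Qed.

(** JC is pi and m0 is 1/(2 pi), so this number is 1; carrying it as a positive factor replaces the
    evaluation of the two integrals. *)
Definition kap : R := 2 * @JC R * @m0 R.

Lemma kap_gt0 : 0 < kap.
Proof. by rewrite !mulr_gt0 ?JC_gt0 ?m0_gt0. Qed.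

Lemma cintegrable_ft1_expi (th : R -> R) : measurable_fun setT th ->
  cintegrable setT (fun eta => Phi eta * expi (th eta)).
Proof.
move=> mth; apply: (@cintegrableM_bnd _ _ _ _ 1) => //; first exact: cintegrable_ft1.
  exact: cmeas_expi.
by move=> x _; rewrite cabs_expi.
Qed.

Lemma tri_le (a z : R) : 0 < a -> 0 <= tri a (2 * pi * z) <= a.
Proof.
move=> a0; have -> : 2 * pi * z = a * (2 * pi * z / a) by field; exact: lt0r_neq0.
rewrite tri_scale//; apply/andP; split; first by rewrite mulr_ge0 ?tri1_ge0 ?ltW.
by rewrite ger_pMr// tri1_le1.
Qed.

Lemma tri_supp (a z : R) : 0 < a -> a <= `|z| -> tri a (2 * pi * z) = 0.
Proof.
move=> a0 az; have -> : 2 * pi * z = a * (2 * pi * z / a) by field; exact: lt0r_neq0.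
rewrite tri_scale// tri1_supp ?mulr0// normrM normfV (gtr0_norm a0).
rewrite ler_pdivlMr// mul1r normrM (gtr0_norm (@twopi_gt0 R)).
by rewrite (le_trans az)// ler_peMl//; have := @pi_ge2 R; lra.
Qed.

Lemma integrable_phi_tri (a x : R) : 0 < a ->
  mu.-integrable setT (EFin \o (fun y => phi y * tri a (2 * pi * (x - y)))).
Proof.
move=> a0.
have ft : mu.-integrable setT (EFin \o (fun y => a * phi y)) by exact: rint_mul.
apply: le_integrable ft => //.
  apply/measurable_EFinP; apply: measurable_funM; first exact: continuous_measurable_fun.
  by have /integrableP[/measurable_EFinP] := integrable_tri x a0.
move=> y _ /=; rewrite lee_fin !normrM mulrC ler_wpM2r//.
have /andP[h1 h2] := tri_le (x - y) a0.
by rewrite !ger0_norm// ltW.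
Qed.

(** Fejer summation of the inversion integral: the transform of [jker] is a triangle, so the damped
    integral is a local average of phi around x. *)
Lemma fejer_identity (a x : R) : 0 < a ->
  cint setT (fun eta => Phi eta * expi (2 * pi * x * eta) * rc (jker a eta)) =
  rc (@JC R * \int[mu]_y (phi y * tri a (2 * pi * (x - y)))).
Proof.
move=> a0.
have mpsi : measurable_fun setT (fun eta : R => - (2 * pi) * eta) by exact: measurable_funM.
have ip : cintegrable setT (fun y => rc (phi y)) by exact: cintegrable_rc.
have iq := cintegrable_jker_expi a (2 * pi * x).
have := cint_swap_expi ip iq mpsi.
have -> : cint setT (fun eta => rc (jker a eta) * expi (2 * pi * x * eta) *
    cint setT (fun y => rc (phi y) * expi (y * (- (2 * pi) * eta)))) =
    cint setT (fun eta => Phi eta * expi (2 * pi * x * eta) * rc (jker a eta)).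
  apply: eq_cint => eta _; rewrite [RHS]mulrC [Phi _ * _]mulrC mulrA; congr (_ * _).
  by apply: eq_cint => y _; congr (_ * expi _); ring.
move=> <-.
transitivity (cint setT (fun y => rc (phi y * (@JC R * tri a (2 * pi * (x - y)))))).
  apply: eq_cint => y _; rewrite rcM -cint_jker_expi; congr (_ * _).
  apply: eq_cint => eta _; rewrite -mulrA -expiD; congr (_ * expi _); ring.
rewrite cint_rc; congr rc; rewrite -RintegralZl//.
  by apply: eq_Rintegral => y _; rewrite mulrCA.
exact: integrable_phi_tri.
Qed.

(** As a -> 0, 2/a^2 times the damped integral tends to the left side, because [jker a] is close to
    a^2/2 on the support of Phi, and to the right side, because the triangles have mass a^2 m0 and
    concentrate at x. *)
Lemma fourier_inversion x :
  cint setT (fun eta => Phi eta * expi (2 * pi * x * eta)) = rc (kap * phi x).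
Proof.
apply/eqP; rewrite -subr_eq0; apply/eqP; apply: cabs_small => e e0.
pose B := \int[mu]_eta cabs (Phi eta).
have B0 : 0 <= B by apply: Rintegral_ge0 => y _; exact: cabs_ge0.
have JC0 := @JC_gt0 R; have m00 := @m0_gt0 R.
(* Chosen so that (2/a^2) JC e1 (a^2 m0) = e/2. *)
pose e1 := e / (4 * @JC R * @m0 R).
have e10 : 0 < e1 by rewrite divr_gt0// !mulr_gt0.
have /cvgrPdist_le /(_ e1 e10) /nbhs_ballP[d /= d0 hd] := (@cphi x).
(* a has to lie below the continuity scale d of phi at x and to keep the damping error a^2 B/4 below
   e/2. *)
have [a [a0 [ad aB]]] : exists a : R, 0 < a /\ (a < d /\ a ^+ 2 / 4 * B <= e / 2).
  pose b := Num.min 1 (2 * e / (B + 1)).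
  have b0 : 0 < b by rewrite lt_min ltr01 divr_gt0 ?mulr_gt0//; lra.
  exists (Num.min (d / 2) b); split; first by rewrite lt_min b0 divr_gt0.
  split; first by rewrite gt_min; apply/orP; left; lra.
  set m := Num.min _ _.
  have mb : m <= b by rewrite /m ge_min lexx orbT.
  have m0' : 0 <= m by rewrite /m le_min ltW ?divr_gt0// ltW.
  have b1 : b <= 1 by rewrite /b ge_min lexx.
  have h1 : m ^+ 2 <= b by rewrite expr2; nra.
  have h2 : b * (B + 1) <= 2 * e.
    rewrite -ler_pdivlMr; last lra.
    by rewrite /b ge_min lexx orbT.
  have : m ^+ 2 * B <= b * (B + 1) by rewrite ler_pM ?sqr_ge0//; lra.
  lra.
have an0 : a != 0 by rewrite gt_eqF.
have iA : cintegrable setT (fun eta => Phi eta * expi (2 * pi * x * eta)).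
  by apply: cintegrable_ft1_expi; exact: measurable_funM.
have iAj : cintegrable setT (fun eta => Phi eta * expi (2 * pi * x * eta) * rc (jker a eta)).
  apply: (@cintegrableM_bnd _ _ _ _ (a ^+ 2 / 2)) => //.
    by apply: cmeas_rc; exact: measurable_jker.
  by move=> y _; rewrite cabs_rc ger0_norm ?jker_ge0// jker_le.
have d1 : cabs (cint setT (fun eta => Phi eta * expi (2 * pi * x * eta)) -
    rc (2 / a ^+ 2) * cint setT (fun eta => Phi eta * expi (2 * pi * x * eta) * rc (jker a eta)))
    <= a ^+ 2 / 4 * B.
  rewrite -cintZ// -cintB//; last exact: cintegrableZ.
  rewrite /B -RintegralZl//; last by apply: integrable_cabs => //; exact: cintegrable_ft1.
  apply: cabs_cint_dom => //.
  - apply: cintegrable_meas; under eq_fun do rewrite -mulN1r.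
    by apply: cintegrableD => //; do 2 apply: cintegrableZ => //.
  - by apply: rint_mul => //; apply: integrable_cabs => //; exact: cintegrable_ft1.
  move=> eta _.
  have [h|h] := leP `|eta| 1; last first.
    by rewrite (supp (ltW h)) !mul0r mulr0 subr0 cabs0 mulr0.
  set z := Phi eta * _.
  have -> : z - rc (2 / a ^+ 2) * (z * rc (jker a eta)) = rc (1 - 2 / a ^+ 2 * jker a eta) * z.
    by rewrite [rc (1 - _)]rcD rcN (rcM (2 / a ^+ 2) (jker a eta)) rc1; ring.
  rewrite cabsM /z cabsM cabs_expi mulr1 ler_wpM2r ?cabs_ge0// cabs_rc.
  have -> : 1 - 2 / a ^+ 2 * jker a eta = - (2 / a ^+ 2) * (jker a eta - a ^+ 2 / 2).
    by field; exact: an0.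
  have p20 : 0 <= 2 / a ^+ 2 by rewrite divr_ge0 ?sqr_ge0.
  rewrite normrM normrN (ger0_norm p20).
  apply: (@le_trans _ _ (2 / a ^+ 2 * (a ^+ 4 / 8))).
    by rewrite ler_wpM2l// jker_half_dist.
  by rewrite le_eqVlt; apply/orP; left; apply/eqP; field; exact: an0.
rewrite fejer_identity// -rcM in d1.
have d2 : `|2 / a ^+ 2 * (@JC R * \int[mu]_y (phi y * tri a (2 * pi * (x - y)))) - kap * phi x| <= e / 2.
  have itri := integrable_tri x a0.
  have -> : kap * phi x = 2 / a ^+ 2 * (@JC R * (phi x * \int[mu]_y tri a (2 * pi * (x - y)))).
    by rewrite Rintegral_tri// /kap; field; exact: an0.
  have iphitri : mu.-integrable setT (EFin \o (fun y => phi y * tri a (2 * pi * (x - y)))).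
    exact: integrable_phi_tri.
  rewrite -mulrBr -mulrBr -RintegralZl// -RintegralB//; last exact: rint_mul.
  have p20 : 0 <= 2 / a ^+ 2 by rewrite divr_ge0 ?sqr_ge0.
  rewrite !normrM (ger0_norm (ltW JC0)) -normrM (ger0_norm p20).
  apply: (@le_trans _ _ (2 / a ^+ 2 * (@JC R * (e1 * (a ^+ 2 * @m0 R))))); last first.
    by rewrite /e1 le_eqVlt; apply/orP; left; apply/eqP; field; rewrite an0 !gt_eqF.
  rewrite ler_wpM2l// ler_wpM2l ?(ltW JC0)//.
  rewrite -(Rintegral_tri x a0) -RintegralZl//.
  have idiff : mu.-integrable setT (EFin \o (fun y => phi y * tri a (2 * pi * (x - y)) -
      phi x * tri a (2 * pi * (x - y)))).
    have := rint_add measurableT iphitri (rint_mul (- phi x) measurableT itri).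
    by apply: eq_integrable => // y _ /=; rewrite mulNr.
  apply: le_trans (le_normr_Rintegral measurableT idiff) _.
  apply: le_Rintegral => //; [exact: rint_norm|exact: rint_mul|].
  move=> y _; rewrite -mulrBl normrM.
  have /andP[t1 t2] := tri_le (x - y) a0.
  rewrite (ger0_norm t1).
  have [h|h] := ltP `|x - y| d; last by rewrite tri_supp ?mulr0// (le_trans (ltW ad)).
  rewrite ler_wpM2r// distrC; exact: hd.
apply: le_trans (cabs_distD (rc (2 / a ^+ 2 * (@JC R * \int[mu]_y (phi y * tri a (2 * pi * (x - y)))))) _ _) _.
rewrite [e]splitr lerD//; first exact: le_trans d1 _.
by rewrite -rcN -rcD cabs_rc.
Qed.

End Inversion.

(** * Iterated integrals of sums of products, and the integers of the comb *)

Section Tensor.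
Variable R : realType.
Local Notation C := R[i].
Local Notation mu := (@lebesgue_measure R).

Section iter.
Variables (K : eqType) (s : seq K) (c : K -> C) (h : K -> nat -> R -> C).
Variables (D : nat -> set R) (M : nat).
Hypothesis mD : forall j, (j < M)%N -> measurable (D j).
Hypothesis ih : forall k j, k \in s -> (j < M)%N -> cintegrable (D j) (h k j).

(** [iter_cint] integrates its last coordinate outermost, so the induction on m keeps the
    coordinates from m on as parameters. *)
Lemma iter_cint_tensor (G : (nat -> R) -> C) :
  (forall y, (forall j, (j < M)%N -> D j (y j)) ->
     G y = \sum_(k <- s) c k * \prod_(0 <= j < M) h k j (y j)) ->
  forall m y, (m <= M)%N -> (forall j, (m <= j < M)%N -> D j (y j)) ->
  iter_cint m D G y =
  \sum_(k <- s) c k * (\prod_(0 <= j < m) cint (D j) (h k j) *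
                       \prod_(m <= j < M) h k j (y j)).
Proof.
move=> HG; elim => [|m IH] y mM yD /=.
  by rewrite HG //; apply: eq_bigr => k _; rewrite [in RHS](@big_geq _ _ _ 0 0)// mul1r.
pose z t := fun j => if j == m then t else y j.
transitivity (cint (D m) (fun t => \sum_(k <- s | k \in s)
   (c k * (\prod_(0 <= j < m) cint (D j) (h k j) *
           \prod_(m.+1 <= j < M) h k j (y j))) * h k m t)).
  apply: eq_cint => t Dt; rewrite -/(z t) IH ?(ltnW mM)//; last first.
    move=> j /andP[mj jM]; rewrite /z; case: eqVneq => [->//|jm].
    by apply: yD; rewrite jM andbT ltn_neqAle eq_sym jm.
  rewrite [LHS]big_seq; apply: eq_bigr => k _.
  rewrite (big_ltn (m := m))// {1}/z eqxx.
  have -> : \prod_(m.+1 <= j < M) h k j (z t j) = \prod_(m.+1 <= j < M) h k j (y j).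
    by apply: eq_big_nat => j /andP[mj _]; rewrite /z gtn_eqF.
  by rewrite -!mulrA; congr (_ * (_ * _)); rewrite mulrC.
rewrite cint_sum; last 2 first.
- exact: mD.
- by move=> k ks; apply: cintegrableZ; [exact: mD|exact: ih].
rewrite [RHS]big_seq; apply: eq_bigr => k ks.
rewrite cintZ; [|exact: mD|exact: ih].
rewrite (big_nat_recr m)//= -!mulrA; congr (_ * (_ * _)); exact: mulrC.
Qed.
End iter.

Lemma cd_row n (y : nat -> R) j : (j < n)%N -> cd (\row_(i < n) y i) j = y j.
Proof. by move=> jn; rewrite /cd insubT /= mxE. Qed.

Lemma rn_int_tensor n (K : eqType) (s : seq K) (c : K -> C) (h : K -> nat -> R -> C)
    (D : nat -> set R) (f : 'rV[R]_n -> C) :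
  (forall j, (j < n)%N -> measurable (D j)) ->
  (forall k j, k \in s -> (j < n)%N -> cintegrable (D j) (h k j)) ->
  (forall y : nat -> R, (forall j, (j < n)%N -> D j (y j)) ->
     f (\row_(i < n) y i) = \sum_(k <- s) c k * \prod_(0 <= j < n) h k j (y j)) ->
  rn_int D f = \sum_(k <- s) c k * \prod_(0 <= j < n) cint (D j) (h k j).
Proof.
move=> mD ih hf; rewrite /rn_int (iter_cint_tensor mD ih hf)//; last first.
  by move=> j; case: ltnP => //; rewrite andbF.
by apply: eq_bigr => k _; rewrite [X in _ * (_ * X)]big_geq// mulr1.
Qed.

Lemma rn_int_tensor1 n (h : nat -> R -> C) (D : nat -> set R) (f : 'rV[R]_n -> C) :
  (forall j, (j < n)%N -> measurable (D j)) ->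
  (forall j, (j < n)%N -> cintegrable (D j) (h j)) ->
  (forall y : nat -> R, (forall j, (j < n)%N -> D j (y j)) ->
     f (\row_(i < n) y i) = \prod_(0 <= j < n) h j (y j)) ->
  rn_int D f = \prod_(0 <= j < n) cint (D j) (h j).
Proof.
move=> mD ih hf.
rewrite (@rn_int_tensor n unit [:: tt] (fun=> 1) (fun=> h) D f)//.
- by rewrite big_seq1 mul1r.
- by move=> k j _; exact: ih.
- by move=> y yD; rewrite hf// big_seq1 mul1r.
Qed.

Lemma dotv_row n (x : 'rV[R]_n) (y : nat -> R) :
  dotv x (\row_(i < n) y i) = \sum_(0 <= j < n) cd x j * y j.
Proof.
rewrite /dotv big_mkord; apply: eq_bigr => i _; rewrite mxE; congr (_ * _).
by rewrite /cd insubT//= => p; congr (x _ _); exact: val_inj.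
Qed.

(* The integers of the open interval (X/2, X) are those l with comb_lo X <= l < comb_hi X. *)
Definition comb_lo (X : R) : nat := (Num.truncn (X / 2)).+1.
Definition comb_hi (X : R) : nat := (Num.truncn X + ((Num.truncn X)%:R < X)%R)%N.

Lemma comb_loP (X : R) l : 0 <= X -> (X / 2 < l%:R) = (comb_lo X <= l)%N.
Proof.
move=> X0; rewrite /comb_lo; have X2 : 0 <= X / 2 by rewrite divr_ge0.
by rewrite truncn_lt_nat.
Qed.

Lemma comb_hiP (X : R) l : 0 <= X -> (l%:R < X) = (l < comb_hi X)%N.
Proof.
move=> X0; rewrite /comb_hi.
have /andP[h1 h2] := truncn_itv X0.
have [h|h] /= := ltP (Num.truncn X)%:R X.
  rewrite addn1 ltnS; apply/idP/idP => [lX|lX].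
    by rewrite -ltnS -(ltr_nat R); exact: lt_trans h2.
  by apply: le_lt_trans h; rewrite ler_nat.
by rewrite addn0 -(ltr_nat R); congr (_ < _); apply/eqP; rewrite eq_le h h1.
Qed.

Lemma comb_size (X : R) : 4 <= X ->
  (comb_lo X <= comb_hi X)%N /\ X / 4 <= (comb_hi X - comb_lo X)%:R <= X.
Proof.
move=> X4; have X0 : 0 <= X by lra.
have X2 : 0 <= X / 2 by lra.
have /andP[a1 a2] := truncn_itv X0.
have /andP[b1 b2] := truncn_itv X2.
have h1 : X <= (comb_hi X)%:R by rewrite leNgt comb_hiP// ltnn.
have h2 : (comb_hi X)%:R <= X + 1.
  rewrite /comb_hi natrD; case: ltP => /= _; rewrite ?mulr1n ?mulr0n; lra.
have h3 : (comb_lo X)%:R <= X / 2 + 1 by rewrite /comb_lo -natr1 lerD2r.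
have h4 : X / 2 <= (comb_lo X)%:R by rewrite ltW// comb_loP.
have lohi : (comb_lo X <= comb_hi X)%N by rewrite -(ler_nat R); lra.
split=> //; rewrite natrB//; apply/andP; split; lra.
Qed.

Lemma comb_bigE (X : R) (F : nat -> C) : 0 <= X ->
  \sum_(0 <= l < (Num.truncn X).+1 | (X / 2 < l%:R) && (l%:R < X)) F l =
  \sum_(comb_lo X <= l < comb_hi X) F l.
Proof.
move=> X0; under eq_bigl do rewrite comb_loP// comb_hiP//.
have hT : (comb_hi X <= (Num.truncn X).+1)%N.
  by rewrite /comb_hi; case: (_ < _) => /=; rewrite ?addn1 ?addn0.
rewrite [RHS](big_nat_widen _ _ (Num.truncn X).+1)//.
rewrite [RHS](big_nat_widenl _ 0)//.
by apply: eq_bigl => l; rewrite andbC.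
Qed.

End Tensor.

(** * Transforms and norms of the one-dimensional factors of f_D *)

Section Pieces.
Variable R : realType.
Local Notation C := R[i].
Local Notation mu := (@lebesgue_measure R).
Variable phi : R -> R.
Hypothesis iphi : mu.-integrable setT (EFin \o phi).
Hypothesis cphi : continuous phi.
Local Notation Phi := (ft1 phi).
Hypothesis supp : forall eta, 1 <= `|eta| -> Phi eta = 0.

Definition ft1_l1 : R := \int[mu]_eta cabs (Phi eta).

Lemma ft1_l1_ge0 : 0 <= ft1_l1.
Proof. by apply: Rintegral_ge0 => x _; exact: cabs_ge0. Qed.

(** phi is integrable and not assumed bounded; the bound comes from recovering it from its compactly
    supported transform. *)
Lemma phi_bounded x : `|phi x| <= ft1_l1 / kap R.
Proof.
have k0 := @kap_gt0 R.
rewrite ler_pdivlMr// mulrC -{1}(gtr0_norm k0) -normrM -cabs_rc -(fourier_inversion iphi cphi supp).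
have ic := cintegrable_ft1_expi iphi cphi supp (th := fun eta => 2 * pi * x * eta).
apply: le_trans (cabs_cint_le measurableT (ic _)) _; first exact: measurable_funM.
rewrite le_eqVlt; apply/orP; left; apply/eqP; apply: eq_Rintegral => eta _.
by rewrite cabsM cabs_expi mulr1.
Qed.

Lemma measurable_phi : measurable_fun setT phi.
Proof. exact: continuous_measurable_fun. Qed.

Lemma integrable_phi2 : mu.-integrable setT (EFin \o (fun x => phi x ^+ 2)).
Proof.
have i1 := rint_mul (ft1_l1 / kap R) measurableT iphi.
apply: le_integrable i1 => //.
  by apply/measurable_EFinP; apply: measurable_funX; exact: measurable_phi.
move=> x _ /=; rewrite lee_fin normrX expr2 normrM ler_wpM2r//.
by rewrite (le_trans (phi_bounded x))// ler_norm.
Qed.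

Definition phi_m2 : R := \int[mu]_x (phi x ^+ 2).

Lemma phi_m2_gt0 : phi 0 = 1 -> 0 < phi_m2.
Proof.
move=> phi0.
have h : 0 < (1 / 2 : R) by lra.
have /cvgrPdist_le /(_ _ h) /nbhs_ballP[d /= d0 hd] := (@cphi 0).
apply: (@Rintegral_gt0 R _ 0 (d / 2) (1 / 4)) => //.
- exact: integrable_phi2.
- by move=> x; exact: sqr_ge0.
- by rewrite divr_gt0.
move=> x /andP[x0 xd].
have : `|phi 0 - phi x| <= 1 / 2.
  by apply: hd; rewrite /ball/= sub0r normrN ger0_norm//; lra.
rewrite phi0 ler_norml => /andP[_ h2]; have h3 : 1 / 2 <= phi x by lra.
by rewrite expr2; nra.
Qed.

(** The transform of phi^2 is Phi convolved with itself, hence lives in [-2,2]. Instead of forming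
    the convolution, one factor phi is written by the inversion formula; after the swap the other
    one gives Phi(-(om + eta)), where |om + eta| >= 1 for |eta| < 1. *)
Lemma ft_phi2 (om : R) : 2 <= `|om| ->
  cint setT (fun x => rc (phi x ^+ 2) * expi (2 * pi * om * x)) = 0.
Proof.
move=> om2; have k0 := @kap_gt0 R.
have ip : cintegrable setT (fun y => rc (phi y) * expi (2 * pi * om * y)).
  apply: (@cintegrableM_bnd _ _ _ _ 1) => //; first exact: cintegrable_rc.
    by apply: cmeas_expi; exact: measurable_funM.
  by move=> x _; rewrite cabs_expi.
have iq := cintegrable_ft1 iphi cphi supp.
have mpsi : measurable_fun setT (fun eta : R => 2 * pi * eta) by exact: measurable_funM.
have := cint_swap_expi ip iq mpsi.
have -> : cint setT (fun eta => Phi eta *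
   cint setT (fun y => rc (phi y) * expi (2 * pi * om * y) * expi (y * (2 * pi * eta)))) = 0.
  rewrite -[RHS](cint0 setT); apply: eq_cint => eta _.
  have [h|h] := leP 1 `|eta|; first by rewrite supp// mul0r.
  rewrite (_ : cint _ _ = Phi (- (om + eta))).
    rewrite [Phi (- _)]supp ?mulr0// normrN.
    have := ler_normB (om + eta) eta; rewrite addrK; lra.
  apply: eq_cint => y _; rewrite -mulrA -expiD; congr (_ * expi _); ring.
have -> : cint setT (fun y => rc (phi y) * expi (2 * pi * om * y) *
    cint setT (fun eta => Phi eta * expi (y * (2 * pi * eta)))) =
    rc (kap R) * cint setT (fun x => rc (phi x ^+ 2) * expi (2 * pi * om * x)).
  rewrite -cintZ//.
    apply: eq_cint => y _.
    rewrite (_ : cint _ _ = rc (kap R * phi y)).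
      rewrite rcM expr2 rcM; ring.
    rewrite -(fourier_inversion iphi cphi supp); apply: eq_cint => eta _.
    congr (_ * expi _); ring.
  apply: (@cintegrableM_bnd _ _ _ _ 1) => //; first exact: cintegrable_rc integrable_phi2.
    by apply: cmeas_expi; exact: measurable_funM.
  by move=> x _; rewrite cabs_expi.
move/eqP; rewrite mulf_eq0 => /orP[/eqP/(congr1 (@complex.Re _))/= k00|/eqP//].
by rewrite k00 ltxx in k0.
Qed.

Definition comb (D : R) (lo hi : nat) (y : R) : C :=
  \sum_(lo <= l < hi) expi (2 * pi * D * l%:R * y).

Lemma cintegrable_phi_comb D lo hi :
  cintegrable setT (fun y => rc (phi y) * comb D lo hi y).
Proof.
apply: (@cintegrableM_bnd _ _ _ _ (hi - lo)%:R) => //; first exact: cintegrable_rc.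
  by apply: cmeas_sum => l _; apply: cmeas_expi; exact: measurable_funM.
move=> x _; apply: le_trans (cabs_sum _ _ _) _.
by under eq_bigr do rewrite cabs_expi; rewrite sumr_const_nat.
Qed.

Lemma ft_comb D lo hi xi :
  cint setT (fun x => rc (phi x) * comb D lo hi x * expi (- (2 * pi * x * xi))) =
  \sum_(lo <= l < hi) Phi (xi - D * l%:R).
Proof.
rewrite -cint_sum//; last by move=> l _; exact: integrable_phi_expi.
apply: eq_cint => x _; rewrite /comb mulr_sumr mulr_suml; apply: eq_bigr => l _.
rewrite -mulrA -expiD; congr (_ * expi _); ring.
Qed.

(** Teeth at distance D >= 2 are orthogonal: a cross term is the transform of phi^2 at a frequency
    of size at least 2. *)
Lemma comb_l2 D lo hi : 2 <= D ->
  cint setT (fun y => rc (cabs (rc (phi y) * comb D lo hi y) ^+ 2)) =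
  rc ((hi - lo)%:R * phi_m2).
Proof.
move=> D2.
have ie om : cintegrable setT (fun x => rc (phi x ^+ 2) * expi (2 * pi * om * x)).
  apply: (@cintegrableM_bnd _ _ _ _ 1) => //; first exact: cintegrable_rc integrable_phi2.
    by apply: cmeas_expi; exact: measurable_funM.
  by move=> x _; rewrite cabs_expi.
transitivity (cint setT (fun y => \sum_(lo <= l < hi) \sum_(lo <= l' < hi)
    rc (phi y ^+ 2) * expi (2 * pi * (D * (l%:R - l'%:R)) * y))).
  apply: eq_cint => y _.
  rewrite cabsM exprMn rcM cabs_rc real_normK ?num_real// rc_cabs_sqr.
  rewrite /comb mulr_suml mulr_sumr; apply: eq_bigr => l _.
  rewrite rmorph_sum mulr_sumr mulr_sumr; apply: eq_bigr => l' _.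
  rewrite [X in _ * (_ * X)](_ : _ = expi (- (2 * pi * D * l'%:R * y))); last by rewrite expiN.
  rewrite -expiD; congr (_ * expi _); ring.
rewrite cint_sum//; last by move=> l _; apply: cintegrable_sum.
have E l l' : cint setT (fun y => rc (phi y ^+ 2) * expi (2 * pi * (D * (l%:R - l'%:R)) * y))
   = if l' == l then rc phi_m2 else 0.
  case: eqVneq => [->|ll'].
    rewrite -cint_rc; apply: eq_cint => y _.
    by rewrite subrr !mulr0 mul0r expi0 mulr1.
  apply: ft_phi2; rewrite normrM.
  have h1 : 1 <= `|l%:R - l'%:R : R|.
    rewrite -[l%:R]/(l%:~R) -[l'%:R]/(l'%:~R) -intrB -intr_norm -[1]/(1%:~R) ler_int.
    by rewrite -gtz0_ge1 normr_gt0 subr_eq0 eq_sym.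
  by rewrite (ger0_norm (x := D)); nra.
transitivity (\sum_(lo <= l < hi) rc phi_m2).
  apply: eq_big_nat => l lr; rewrite cint_sum//.
  rewrite (bigD1_seq l) ?mem_index_iota ?iota_uniq//= E eqxx big1 ?addr0// => l' /negbTE ll'.
  by rewrite E ll'.
by rewrite sumr_const_nat rcM rc_nat mulr_natl.
Qed.

Lemma sqrtr_neq0 (r : R) : 0 < r -> Num.sqrt r != 0.
Proof. by move=> r0; rewrite gt_eqF// sqrtr_gt0. Qed.

Lemma cintegrable_first (r : R) : 0 < r ->
  cintegrable setT (fun x => expi (2 * pi * r * x) * rc (phi (Num.sqrt r * x))).
Proof.
move=> r0; have := integrable_affine 0 (sqrtr_neq0 r0) iphi => i1.
have : cintegrable setT (fun x => rc (phi (Num.sqrt r * x)) * expi (2 * pi * r * x)).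
  apply: (@cintegrableM_bnd _ _ _ _ 1) => //.
    by apply: cintegrable_rc; apply: eq_integrable i1 => // x _ /=; rewrite addr0.
    by apply: cmeas_expi; exact: measurable_funM.
  by move=> x _; rewrite cabs_expi.
by apply: eq_cintegrable => // x _; rewrite mulrC.
Qed.

Lemma ft_first (r xi : R) : 0 < r ->
  cint setT (fun x => expi (2 * pi * r * x) * rc (phi (Num.sqrt r * x)) *
                      expi (- (2 * pi * x * xi))) =
  rc ((Num.sqrt r)^-1) * Phi ((xi - r) / Num.sqrt r).
Proof.
move=> r0; have s0 := sqrtr_neq0 r0.
have := cint_affine 0 s0 (integrable_phi_expi iphi ((xi - r) / Num.sqrt r)).
rewrite ger0_norm ?sqrtr_ge0// => <-; apply: eq_cint => x _.
rewrite addr0 mulrAC -expiD mulrC; congr (_ * expi _); field; exact: s0.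
Qed.

Lemma l2_first (r : R) : 0 < r ->
  cint setT (fun x => rc (cabs (expi (2 * pi * r * x) * rc (phi (Num.sqrt r * x))) ^+ 2)) =
  rc ((Num.sqrt r)^-1 * phi_m2).
Proof.
move=> r0; have s0 := sqrtr_neq0 r0.
have := cint_affine 0 s0 (cintegrable_rc integrable_phi2).
rewrite ger0_norm ?sqrtr_ge0// [cint _ (fun x => rc (phi x ^+ 2))]cint_rc -rcM => <-.
apply: eq_cint => x _.
by rewrite addr0 cabsM cabs_expi mul1r cabs_rc real_normK ?num_real.
Qed.

End Pieces.

(** * Maximal inequality for truncated oscillatory integrals *)

Section Abel.
Variable R : realType.
Local Notation C := R[i].

Lemma abel_identity (b f : nat -> C) m :
  \sum_(0 <= i < m.+1) b i * f i =
  b m * \sum_(0 <= i < m.+1) f i -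
  \sum_(0 <= i < m) (b i.+1 - b i) * \sum_(0 <= j < i.+1) f j.
Proof.
elim: m => [|m IH]; first by rewrite !big_nat1 big_geq// subr0.
rewrite big_nat_recr//= IH [in RHS]big_nat_recr//= [X in _ = _ - X]big_nat_recr//=.
ring.
Qed.

Lemma abel_le (b f : nat -> C) (X : R) m :
  (forall j, (j <= m.+1)%N -> cabs (\sum_(0 <= i < j) f i) <= X) ->
  cabs (\sum_(0 <= i < m.+1) b i * f i) <=
  X * (cabs (b m) + \sum_(0 <= i < m) cabs (b i.+1 - b i)).
Proof.
move=> hX; rewrite abel_identity mulrDr; apply: le_trans (cabsD _ _) _.
rewrite cabsN cabsM lerD//.
  by rewrite mulrC ler_wpM2r ?cabs_ge0// hX.
apply: le_trans (cabs_sum _ _ _) _; rewrite mulr_sumr; apply: ler_sum_nat => i /andP[_ im].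
by rewrite cabsM mulrC ler_wpM2r ?cabs_ge0// hX// ltnW.
Qed.

(** Cauchy-Schwarz. In the induction step the defect, multiplied by l, is a nonnegative multiple of
    the previous defect plus a square. *)
Lemma sqr_sum_le (a : nat -> R) L :
  (\sum_(0 <= l < L) a l) ^+ 2 <= L%:R * \sum_(0 <= l < L) a l ^+ 2.
Proof.
elim: L => [|[|L] IH]; first by rewrite !big_geq// expr0n mulr0.
  by rewrite !big_nat1 mul1r.
rewrite [X in X ^+ 2]big_nat_recr//= [X in _ <= _ * X]big_nat_recr//=; set s := \sum_(_ <= _ < _) _ in IH *.
set q := \sum_(_ <= _ < _) _ in IH *; set x := a L.+1.
set l : R := L.+1%:R in IH *.
have l1 : 1 <= l by rewrite ler1n.
have -> : L.+2%:R = l + 1 :> R by rewrite natr1.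
suff : 0 <= l * ((l + 1) * (q + x ^+ 2) - (s + x) ^+ 2).
  by rewrite pmulr_rge0 ?subr_ge0//; lra.
have -> : l * ((l + 1) * (q + x ^+ 2) - (s + x) ^+ 2) =
  (l + 1) * (l * q - s ^+ 2) + (s - l * x) ^+ 2 by ring.
by rewrite addr_ge0 ?sqr_ge0// mulr_ge0 ?subr_ge0//; lra.
Qed.

(* Dyadic chaining: m, its multiples-of-2^l truncations, and finally 0. *)
Lemma rademacher_menshov (F : nat -> C) L m : (m < 2 ^ L)%N ->
  cabs (F m - F 0%N) ^+ 2 <=
  L%:R * \sum_(0 <= l < L) \sum_(0 <= i < 2 ^ (L - l))
     cabs (F (i.+1 * 2 ^ l)%N - F (i * 2 ^ l)%N) ^+ 2.
Proof.
move=> mL; pose x l := (m %/ 2 ^ l * 2 ^ l)%N.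
have x0 : x 0%N = m by rewrite /x expn0 divn1 muln1.
have xL : x L = 0%N by rewrite /x divn_small.
have tele : F m - F 0%N = \sum_(0 <= l < L) (F (x l) - F (x l.+1)).
  have := telescope_sumr (F \o x) (leq0n L); rewrite /= x0 xL => e.
  by rewrite -opprB -e -sumrN; apply: eq_bigr => l _; rewrite opprB.
apply: (@le_trans _ _ ((\sum_(0 <= l < L) cabs (F (x l) - F (x l.+1))) ^+ 2)).
  rewrite lerXn2r ?nnegrE ?cabs_ge0//; first by apply: sumr_ge0 => l _; exact: cabs_ge0.
  by rewrite tele cabs_sum.
apply: le_trans (sqr_sum_le _ _) _.
rewrite ler_wpM2l//; apply: ler_sum_nat => l /andP[_ lL].
set S := \sum_(_ <= i < _) _.
have S0 : 0 <= S by apply: sumr_ge0 => i _; exact: sqr_ge0.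
(* Passing from level l to level l+1 clears bit l of m, so the difference is zero or a single
   increment of level l. *)
set q := (m %/ 2 ^ l.+1)%N.
have xl1 : x l.+1 = (q.*2 * 2 ^ l)%N by rewrite /x -/q expnS mulnA muln2.
have dl : (m %/ 2 ^ l = odd (m %/ 2 ^ l) + q.*2)%N.
  by rewrite /q expnS mulnC divnMA divn2 odd_double_half.
case ho : (odd (m %/ 2 ^ l)) dl => dl; last first.
  by rewrite xl1 /x dl add0n subrr cabs0 expr0n.
rewrite xl1 /x dl add1n /S.
have qlt : (q.*2 < 2 ^ (L - l))%N.
  have : (m %/ 2 ^ l < 2 ^ (L - l))%N.
    by rewrite ltn_divLR ?expn_gt0// -expnD subnK// ltnW.
  by rewrite dl add1n => /ltnW.
rewrite (bigD1_seq q.*2) ?mem_index_iota ?iota_uniq//= lerDl.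
by apply: sumr_ge0 => i _; exact: sqr_ge0.
Qed.

End Abel.

(** * Bessel's inequality on [0,N] *)

Section Bessel.
Variable R : realType.
Local Notation C := R[i].
Local Notation mu := (@lebesgue_measure R).

Lemma is_derive_sinM (al x : R) : is_derive x 1 (fun y => sin (al * y)) (al * cos (al * x)).
Proof.
have h : is_derive x 1 (fun y : R => al * y) al.
  have := @is_deriveZ R R^o R^o id al x 1 1 (is_derive_id _ _).
  by rewrite /GRing.scale/= mulr1.
have := @is_derive1_comp R sin (fun y => al * y) x (cos (al * x)) al (is_derive_sin _) h.
by rewrite /comp mulrC.
Qed.

Lemma is_derive_cosM (al x : R) : is_derive x 1 (fun y => cos (al * y)) (- (al * sin (al * x))).
Proof.
have h : is_derive x 1 (fun y : R => al * y) al.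
  have := @is_deriveZ R R^o R^o id al x 1 1 (is_derive_id _ _).
  by rewrite /GRing.scale/= mulr1.
have := @is_derive1_comp R cos (fun y => al * y) x (- sin (al * x)) al (is_derive_cos _) h.
by rewrite /comp mulNr mulrC.
Qed.

Lemma FTC_simple (f F : R -> R) (T : R) : 0 < T -> continuous f ->
  (forall x : R, is_derive x (1 : R) F (f x)) ->
  \int[mu]_(x in `[0, T]) f x = F T - F 0.
Proof.
move=> T0 cf dF; rewrite /Rintegral (@continuous_FTC2 R f F 0 T)//.
- exact: continuous_subspaceT.
- have cF x : {for x, continuous F}.
    by apply: differentiable_continuous; apply/derivable1_diffP; apply: ex_derive.
  split.
  + by move=> x _; apply: ex_derive.
  + by apply: cvg_at_right_filter; exact: cF.
  + by apply: cvg_at_left_filter; exact: cF.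
- by move=> x _; rewrite derive1E; apply: derive_val.
Qed.

Lemma cint_expi_period (N : nat) (m : int) : (0 < N)%N -> m != 0 ->
  cint `[0, N%:R] (fun x => expi (2 * pi * m%:~R / N%:R * x)) = 0 :> C.
Proof.
move=> N0 m0; set al := 2 * pi * _ / _.
have NR : 0 < N%:R :> R by rewrite ltr0n.
have al0 : al != 0.
  by rewrite !mulf_neq0 ?invr_eq0 ?intr_eq0 ?pnatr_eq0 -?lt0n// gt_eqF// pi_gt0.
have alN : al * N%:R = 2 * pi * m%:~R by rewrite divfK ?gt_eqF.
have eN := expi2piz R m.
have cN : cos (al * N%:R) = 1 by rewrite alN; exact: (congr1 (@complex.Re _) eN).
have sN : sin (al * N%:R) = 0 by rewrite alN; exact: (congr1 (@complex.Im _) eN).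
apply: complex_ext => /=.
  have dF (x : R) : is_derive x (1 : R) (fun x => al^-1 * sin (al * x)) (cos (al * x)).
    have := @is_deriveZ R R^o R^o (fun y => sin (al * y)) al^-1 x 1 _ (is_derive_sinM al x).
    by rewrite /GRing.scale/= mulrA mulVf// mul1r.
  have cf : continuous (fun x : R => cos (al * x)).
    move=> x; apply: (@continuous_comp _ _ _ (fun e : R => al * e) cos); last exact: continuous_cos.
    by apply: cvgMl_tmp; exact: cvg_id.
  by rewrite (FTC_simple NR cf dF) sN [al * 0]mulr0 sin0 subrr.
have dF (x : R) : is_derive x (1 : R) (fun x => - al^-1 * cos (al * x)) (sin (al * x)).
  have := @is_deriveZ R R^o R^o (fun y => cos (al * y)) (- al^-1) x 1 _ (is_derive_cosM al x).
  by rewrite /GRing.scale/= mulrN mulNr opprK mulrA mulVf// mul1r.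
have cf : continuous (fun x : R => sin (al * x)).
  move=> x; apply: (@continuous_comp _ _ _ (fun e : R => al * e) sin); last exact: continuous_sin.
  by apply: cvgMl_tmp; exact: cvg_id.
by rewrite (FTC_simple NR cf dF) cN mulr0 cos0 subrr.
Qed.

Lemma cint_cst_itv (T : R) (z : C) : 0 <= T -> cint `[0, T] (fun=> z) = rc T * z.
Proof.
move=> T0.
have e (r : R) : \int[mu]_(x in `[0, T]) r = T * r.
  by rewrite Rintegral_cst// fine_mu_itv// subr0 mulrC.
by apply: complex_ext; rewrite [LHS]/= e !cE; ring.
Qed.

Lemma expi_poly_l2 (N : nat) (c : nat -> C) : (0 < N)%N ->
  \int[mu]_(x in `[0, N%:R]) cabs (\sum_(0 <= g < N) c g * expi (2 * pi * g%:R / N%:R * x)) ^+ 2 =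
  N%:R * \sum_(0 <= g < N) cabs (c g) ^+ 2.
Proof.
move=> N0.
have mN : measurable (`[0, N%:R] : set R) by exact: measurable_itv.
have ie (z : C) al : cintegrable `[0, N%:R] (fun x => z * expi (al * x)).
  apply: (@cintegrable_bnd _ _ _ (cabs z)) => //; first exact: cint_itv_fin.
    by apply: cmeasM; [exact: cmeas_cst|apply: cmeas_expi; exact: measurable_funM].
  by move=> x _; rewrite cabsM cabs_expi mulr1.
suff : rc (\int[mu]_(x in `[0, N%:R]) cabs (\sum_(0 <= g < N) c g * expi (2 * pi * g%:R / N%:R * x)) ^+ 2) =
  rc (N%:R * \sum_(0 <= g < N) cabs (c g) ^+ 2) by move/(congr1 (@complex.Re _)).
rewrite -cint_rc.
transitivity (cint `[0, N%:R] (fun x => \sum_(0 <= g < N) \sum_(0 <= g' < N)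
   (c g * conjc (c g')) * expi (2 * pi * (g%:Z - g'%:Z)%:~R / N%:R * x))).
  apply: eq_cint => x _; rewrite rc_cabs_sqr mulr_suml; apply: eq_bigr => g _.
  rewrite rmorph_sum mulr_sumr; apply: eq_bigr => g' _.
  rewrite [X in _ * X](_ : _ = conjc (c g') * expi (- (2 * pi * g'%:R / N%:R * x))).
    rewrite mulrACA -expiD intrB; congr (_ * expi _); ring.
  by rewrite expiN -[LHS]/(conjc (c g' * _)) rmorphM.
rewrite cint_sum//; last by move=> g _; apply: cintegrable_sum.
rewrite rcM rc_sum mulr_sumr; apply: eq_big_nat => g gr.
rewrite cint_sum// (bigD1_seq g) ?mem_index_iota ?iota_uniq//= big1 ?addr0.
  rewrite rc_cabs_sqr rc_nat -rc_nat -cint_cst_itv//; apply: eq_cint => x _.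
  by rewrite subrr mulr0 !mul0r expi0 mulr1.
move=> g' gg'; rewrite cintZ//.
  by rewrite cint_expi_period ?mulr0// subr_eq0; apply: contra gg' => /eqP[->].
by have := ie 1 (2 * pi * (g%:Z - g'%:Z)%:~R / N%:R); apply: eq_cintegrable => // x _; rewrite mul1r.
Qed.

(** Duality: the left side S is the integral of u P for the trigonometric polynomial P with
    coefficients conj c_g, and the integral of |P|^2 is N S. From |u P| <= (N/2)|u|^2 + |P|^2/(2N)
    one gets S <= (N/2) ||u||^2 + S/2. *)
Lemma bessel (N : nat) (u : R -> C) (H : R) : (0 < N)%N -> cmeas setT u ->
  (forall x, cabs (u x) <= H) ->
  \sum_(0 <= g < N) cabs (cint `[0, N%:R] (fun x => u x * expi (2 * pi * g%:R / N%:R * x))) ^+ 2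
  <= N%:R * \int[mu]_(x in `[0, N%:R]) cabs (u x) ^+ 2.
Proof.
move=> N0 mu' uH.
have mN : measurable (`[0, N%:R] : set R) by exact: measurable_itv.
have fN := @cint_itv_fin R 0 N%:R.
have NR : 0 < N%:R :> R by rewrite ltr0n.
set c := fun g => cint `[0, N%:R] (fun x => u x * expi (2 * pi * g%:R / N%:R * x)).
rewrite -/(c _); set S := \sum_(0 <= g < N) _.
pose P x := \sum_(0 <= g < N) conjc (c g) * expi (2 * pi * g%:R / N%:R * x).
have mP : cmeas setT P.
  apply: cmeas_sum => g _; apply: cmeasM; first exact: cmeas_cst.
  by apply: cmeas_expi; exact: measurable_funM.
have PS : \int[mu]_(x in `[0, N%:R]) cabs (P x) ^+ 2 = N%:R * S.
  by rewrite expi_poly_l2//; congr (_ * _); apply: eq_bigr => g _; rewrite cabs_conj.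
pose B := \sum_(0 <= g < N) cabs (c g).
have PB x : cabs (P x) <= B.
  apply: le_trans (cabs_sum _ _ _) _; apply: ler_sum => g _.
  by rewrite cabsM cabs_expi mulr1 cabs_conj.
have iu g : cintegrable `[0, N%:R] (fun x => u x * expi (2 * pi * g%:R / N%:R * x)).
  apply: (@cintegrable_bnd _ _ _ H) => //.
    by apply: cmeasM; [exact: cmeas_S|apply: cmeas_expi; exact: measurable_funM].
  by move=> x _; rewrite cabsM cabs_expi mulr1.
have iuP : cintegrable `[0, N%:R] (fun x => u x * P x).
  apply: (@cintegrable_bnd _ _ _ (H * B)) => //.
    by apply: cmeasM; exact: cmeas_S.
  by move=> x _; rewrite cabsM ler_pM ?cabs_ge0.
have SE : rc S = cint `[0, N%:R] (fun x => u x * P x).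
  rewrite /S rc_sum.
  transitivity (cint `[0, N%:R] (fun x => \sum_(0 <= g < N) conjc (c g) *
     (u x * expi (2 * pi * g%:R / N%:R * x)))).
    rewrite cint_sum//; last by move=> g _; exact: cintegrableZ.
    by apply: eq_bigr => g _; rewrite cintZ// -/(c g) rc_cabs_sqr mulrC.
  apply: eq_cint => x _; rewrite /P mulr_sumr; apply: eq_bigr => g _; exact: mulrCA.
have S0 : 0 <= S by apply: sumr_ge0 => g _; exact: sqr_ge0.
have i1 : mu.-integrable `[0, N%:R] (EFin \o (fun x => cabs (u x) ^+ 2)).
  have [] : cintegrable `[0, N%:R] (fun x => rc (cabs (u x) ^+ 2)).
    apply: (@cintegrable_bnd _ _ _ (H ^+ 2)) => //.
      by apply: cmeas_rc; apply: measurable_funX; apply: cmeas_cabs; exact: cmeas_S.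
    by move=> x _; rewrite cabs_rc ger0_norm ?sqr_ge0// lerXn2r ?nnegrE ?cabs_ge0// (le_trans _ (uH x))// cabs_ge0.
  by [].
have i2 : mu.-integrable `[0, N%:R] (EFin \o (fun x => cabs (P x) ^+ 2)).
  have [] : cintegrable `[0, N%:R] (fun x => rc (cabs (P x) ^+ 2)).
    apply: (@cintegrable_bnd _ _ _ (B ^+ 2)) => //.
      by apply: cmeas_rc; apply: measurable_funX; apply: cmeas_cabs; exact: cmeas_S.
    by move=> x _; rewrite cabs_rc ger0_norm ?sqr_ge0// lerXn2r ?nnegrE ?cabs_ge0// (le_trans _ (PB x))// cabs_ge0.
  by [].
have : S <= \int[mu]_(x in `[0, N%:R]) (N%:R / 2 * cabs (u x) ^+ 2 + (2 * N%:R)^-1 * cabs (P x) ^+ 2).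
  rewrite -(ger0_norm S0) -cabs_rc SE; apply: cabs_cint_dom => //.
  - by apply: cmeasM; exact: cmeas_S.
  - by apply: rint_add => //; exact: rint_mul.
  move=> x _; rewrite cabsM.
  have k0 : 0 <= (2 * N%:R)^-1 :> R by rewrite invr_ge0 mulr_ge0.
  have := mulr_ge0 k0 (sqr_ge0 (N%:R * cabs (u x) - cabs (P x))).
  have -> : (2 * N%:R)^-1 * (N%:R * cabs (u x) - cabs (P x)) ^+ 2 =
    N%:R / 2 * cabs (u x) ^+ 2 - cabs (u x) * cabs (P x) + (2 * N%:R)^-1 * cabs (P x) ^+ 2.
    by field; rewrite gt_eqF.
  lra.
rewrite RintegralD//; [|exact: rint_mul|exact: rint_mul].
rewrite !RintegralZl// PS.
have -> : (2 * N%:R)^-1 * (N%:R * S) = S / 2 by field; rewrite gt_eqF.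
lra.
Qed.

End Bessel.

(** * The majorant of truncated chirp integrals *)

Section MaxFun.
Variable R : realType.
Local Notation C := R[i].
Local Notation mu := (@lebesgue_measure R).

Lemma cmeasB d (T : measurableType d) (E : set T) (f k : T -> C) :
  cmeas E f -> cmeas E k -> cmeas E (fun x => f x - k x).
Proof.
move=> [a b] [a' b']; split.
  under eq_fun do rewrite cReD cReN; exact: measurable_funB.
under eq_fun do rewrite cImD cImN; exact: measurable_funB.
Qed.

(** Half-open, so that consecutive cells add up exactly. *)
Definition indR (a b x : R) : R := if a <= x < b then 1 else 0.

Lemma indR_ge0 a b x : 0 <= indR a b x.
Proof. by rewrite /indR; case: ifP. Qed.
Lemma indR_le1 a b x : indR a b x <= 1.
Proof. by rewrite /indR; case: ifP. Qed.

Lemma indR_add a b c x : a <= b -> b <= c -> indR a b x + indR b c x = indR a c x.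
Proof.
rewrite /indR => ab bc; case: (leP a x) => ax; case: (ltP x b) => xb;
  case: (ltP x c) => xc /=; try lra.
Qed.

Lemma measurable_indR a b : measurable_fun setT (indR a b).
Proof.
have -> : indR a b = \1_(`[a, b[ : set R).
  apply/funext => x; rewrite /indR indicE.
  by case: ifPn => h; [rewrite mem_set//= in_itv|rewrite memNset//= in_itv/=; exact/negP].
exact: measurable_indic.
Qed.

Lemma indR_sum (et x : R) K : 0 <= et ->
  \sum_(0 <= i < K) indR (i%:R * et) (i.+1%:R * et) x = indR 0 (K%:R * et) x.
Proof.
move=> et0; elim: K => [|K IH].
  by rewrite big_geq// mul0r /indR; case: ifP => // /andP[h1 h2]; lra.
rewrite big_nat_recr//= IH indR_add//; first by rewrite mulr_ge0.
by rewrite ler_wpM2r// ler_nat.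
Qed.

Section osc.
Variables (N : nat) (N0 : (0 < N)%N).
Local Notation I := (`[0, N%:R] : set R).
Let mI : measurable I. Proof. exact: measurable_itv. Qed.
Let fI : (mu I < +oo)%E. Proof. exact: cint_itv_fin. Qed.
Let NR : 0 < N%:R :> R. Proof. by rewrite ltr0n. Qed.

Definition oscint (u : R -> C) (t : R) : C :=
  cint I (fun x => u x * expi (- (pi * t * x ^+ 2))).

Lemma measurable_chirp (t : R) : measurable_fun setT (fun x : R => - (pi * t * x ^+ 2)).
Proof.
by apply: measurable_funN; apply: measurable_funM => //; exact: measurable_funX.
Qed.

Lemma cintegrable_I (u : R -> C) (H : R) : cmeas setT u -> (forall x, cabs (u x) <= H) ->
  cintegrable I u.
Proof.
by move=> mu' uH; apply: (@cintegrable_bnd _ _ _ H) => //; exact: cmeas_S.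
Qed.

(** The bounded frequency range makes the integral Lipschitz in t; the measurability in t of the
    majorants and of the summands rests on this. *)
Lemma oscint_lip (u : R -> C) (H t t' : R) : cmeas setT u -> (forall x, cabs (u x) <= H) ->
  cabs (oscint u t - oscint u t') <= (H * pi * N%:R ^+ 2 * N%:R) * `|t - t'|.
Proof.
move=> mu' uH.
have H0 : 0 <= H by rewrite (le_trans _ (uH 0))// cabs_ge0.
have me s : cmeas setT (fun x => u x * expi (- (pi * s * x ^+ 2))).
  by apply: cmeasM => //; apply: cmeas_expi; exact: measurable_chirp.
have ie s : cintegrable I (fun x => u x * expi (- (pi * s * x ^+ 2))).
  by apply: (@cintegrable_I _ H) => // x; rewrite cabsM cabs_expi mulr1.
rewrite /oscint -cintB//.
apply: (@le_trans _ _ ((H * pi * N%:R ^+ 2 * `|t - t'|) * fine (mu I))).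
  apply: cabs_cint_bnd => //.
    apply: (@cmeas_S _ _ (fun x => u x * _ - u x * _)).
    exact: cmeasB.
  move=> x /=; rewrite in_itv/= => /andP[x0 xN].
  rewrite -mulrBr cabsM.
  have -> : H * pi * N%:R ^+ 2 * `|t - t'| = H * (pi * (N%:R ^+ 2 * `|t - t'|)) by ring.
  rewrite ler_pM ?cabs_ge0//.
  apply: le_trans (expi_lip _ _) _.
  have -> : - (pi * t * x ^+ 2) - - (pi * t' * x ^+ 2) = - (pi * (x ^+ 2 * (t - t'))) by ring.
  rewrite normrN 2!normrM (gtr0_norm (@pi_gt0 R)) ler_wpM2l ?pi_ge0// ler_wpM2r//.
  by rewrite ger0_norm ?sqr_ge0// lerXn2r// nnegrE.
rewrite fine_mu_itv ?ler0n// subr0; lra.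
Qed.

Lemma lipschitz_continuous (f : R -> R) (K : R) :
  (forall x y, `|f x - f y| <= K * `|x - y|) -> continuous f.
Proof.
move=> hf x; apply/cvgrPdist_le => e e0.
have K0 : 0 <= K by have := le_trans (normr_ge0 _) (hf 1 0); rewrite subr0 normr1 mulr1.
have K1 : 0 < K + 1 by lra.
apply/nbhs_ballP; exists (e / (K + 1)); first by rewrite /= divr_gt0.
move=> y /= xy; apply: le_trans (hf x y) _.
have : `|x - y| <= e / (K + 1) by exact: ltW.
rewrite ler_pdivlMr// mulrC mulrDl mul1r => h.
by have := normr_ge0 (x - y); lra.
Qed.

Lemma cmeas_oscint (u : R -> C) (H : R) : cmeas setT u -> (forall x, cabs (u x) <= H) ->
  cmeas setT (oscint u).
Proof.
move=> mu' uH; split; apply: continuous_measurable_fun;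
  apply: (@lipschitz_continuous _ (H * pi * N%:R ^+ 2 * N%:R)) => t t'.
- rewrite -cReN -cReD; apply: le_trans (Re_le_cabs _) _; exact: oscint_lip.
- rewrite -cImN -cImD; apply: le_trans (Im_le_cabs _) _; exact: oscint_lip.
Qed.

Variables (h : R -> C) (H : R) (M L : nat).
Hypotheses (M0 : (0 < M)%N) (ML : (M.+1 < 2 ^ L)%N).
Hypotheses (mh : cmeas setT h) (hH : forall x, cabs (h x) <= H).
Hypothesis h0 : forall x, ~~ (0 <= x <= N%:R) -> h x = 0.

Let H0 : 0 <= H. Proof. by rewrite (le_trans _ (hH 0))// cabs_ge0. Qed.
Let MR : 0 < M%:R :> R. Proof. by rewrite ltr0n. Qed.

Definition dstep : R := N%:R / M%:R.
Let d0 : 0 < dstep. Proof. by rewrite divr_gt0. Qed.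

Definition Fpart (g m : nat) (t : R) : C :=
  oscint (fun x => h x * rc (indR 0 (m%:R * dstep) x) * expi (2 * pi * g%:R / N%:R * x)) t.

Definition Wvar (g : nat) (t : R) : R :=
  \sum_(0 <= l < L) \sum_(0 <= i < 2 ^ (L - l))
     cabs (Fpart g (i.+1 * 2 ^ l)%N t - Fpart g (i * 2 ^ l)%N t) ^+ 2.

Definition cW : R := 2 * (1 + 2 * pi) ^+ 2.

(* Majorant of |int_{-T}^T h e^{i(-pi t x^2 + 2 pi y x)}|^2, uniformly in T >= 0 and in y in the
   g-th interval of length 1/N; on summing over g only the L^2 norm of h remains. *)
Definition Wmax (g : nat) (t : R) : R := cW * (L%:R * Wvar g t + (H * dstep) ^+ 2).

Lemma cW_ge0 : 0 <= cW. Proof. by rewrite mulr_ge0// sqr_ge0. Qed.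

Lemma Wvar_ge0 g t : 0 <= Wvar g t.
Proof. by apply: sumr_ge0 => l _; apply: sumr_ge0 => i _; exact: sqr_ge0. Qed.

Lemma Wmax_ge0 g t : 0 <= Wmax g t.
Proof. by rewrite mulr_ge0 ?cW_ge0// addr_ge0 ?sqr_ge0// mulr_ge0 ?Wvar_ge0. Qed.

Let cmeas_ind a b : cmeas setT (fun x => rc (indR a b x)).
Proof. by apply: cmeas_rc; exact: measurable_indR. Qed.

Let cabs_ind a b x : cabs (rc (indR a b x)) <= 1.
Proof. by rewrite cabs_rc ger0_norm ?indR_ge0// indR_le1. Qed.

Let cmeas_eg (al : R) : cmeas setT (fun x => expi (al * x)).
Proof. by apply: cmeas_expi; exact: measurable_funM. Qed.

Let cmeas_seg a b al : cmeas setT (fun x => h x * rc (indR a b x) * expi (al * x)).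
Proof. by apply: cmeasM => //; exact: cmeasM. Qed.

Let cabs_seg a b al x : cabs (h x * rc (indR a b x) * expi (al * x)) <= H.
Proof.
rewrite !cabsM cabs_expi mulr1; apply: le_trans (hH x).
by rewrite ler_piMr ?cabs_ge0.
Qed.

Lemma measurable_Wmax g : measurable_fun setT (Wmax g).
Proof.
apply: measurable_funM => //; apply: measurable_funD => //; apply: measurable_funM => //.
apply: measurable_sum => l; apply: measurable_sum => i; apply: measurable_funX.
apply: cmeas_cabs; apply: cmeasB.
  by apply: (@cmeas_oscint _ H) => //; exact: cabs_seg.
by apply: (@cmeas_oscint _ H) => //; exact: cabs_seg.
Qed.

Lemma Fpart_diff g m1 m2 t : (m1 <= m2)%N -> Fpart g m2 t - Fpart g m1 t =
  oscint (fun x => h x * rc (indR (m1%:R * dstep) (m2%:R * dstep) x) *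
                   expi (2 * pi * g%:R / N%:R * x)) t.
Proof.
move=> m12; rewrite /Fpart /oscint.
have ie a b : cintegrable I (fun x => h x * rc (indR a b x) * expi (2 * pi * g%:R / N%:R * x) *
    expi (- (pi * t * x ^+ 2))).
  apply: (@cintegrable_I _ H); first by apply: cmeasM => //; apply: cmeas_expi; exact: measurable_chirp.
  by move=> x; rewrite cabsM cabs_expi mulr1; exact: cabs_seg.
rewrite -cintB//; apply: eq_cint => x _.
rewrite -mulrBl -mulrBl -mulrBr -rcN -rcD; congr (_ * rc _ * _ * _).
apply/eqP; rewrite subr_eq addrC; apply/eqP/esym; apply: indR_add.
  by rewrite mulr_ge0 ?ler0n// ltW.
by rewrite ler_pM2r// ler_nat.
Qed.

Definition l2sq : R := \int[mu]_(x in I) cabs (h x) ^+ 2.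

Let rint_bnd (f : R -> R) (B : R) : measurable_fun setT f -> (forall x, `|f x| <= B) ->
  mu.-integrable I (EFin \o f).
Proof.
move=> mf fB.
have [] : cintegrable I (fun x => rc (f x)).
  apply: (@cintegrable_I _ B); first exact: cmeas_rc.
  by move=> x; rewrite cabs_rc.
by [].
Qed.

(** On one level the pieces are disjoint, so Bessel's inequality in g for each piece, summed over
    the pieces, gives at most N times the squared L^2 norm of h. There are L levels. *)
Lemma sum_Wvar t : \sum_(0 <= g < N) Wvar g t <= L%:R * (N%:R * l2sq).
Proof.
rewrite /Wvar exchange_big_nat/=.
apply: (@le_trans _ _ (\sum_(0 <= l < L) (N%:R * l2sq))); last first.
  by rewrite sumr_const_nat subn0 -[X in X <= _]mulr_natl.
apply: ler_sum_nat => l _; rewrite exchange_big_nat/=.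
pose et := (2 ^ l)%:R * dstep.
have et0 : 0 <= et by rewrite mulr_ge0// ltW.
pose ui (i : nat) (x : R) : C := h x * expi (- (pi * t * x ^+ 2)) * rc (indR (i%:R * et) (i.+1%:R * et) x).
have mui i : cmeas setT (ui i).
  by apply: cmeasM => //; apply: cmeasM => //; apply: cmeas_expi; exact: measurable_chirp.
have uiH i x : cabs (ui i x) <= H.
  rewrite /ui !cabsM cabs_expi mulr1; apply: le_trans (hH x).
  by rewrite ler_piMr ?cabs_ge0.
apply: (@le_trans _ _ (\sum_(0 <= i < 2 ^ (L - l)) N%:R * \int[mu]_(x in I) cabs (ui i x) ^+ 2)).
  apply: ler_sum_nat => i _; apply: le_trans (bessel N0 (mui i) (uiH i)).
  rewrite le_eqVlt; apply/orP; left; apply/eqP; apply: eq_bigr => g _; congr (cabs _ ^+ 2).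
  rewrite Fpart_diff; last by rewrite leq_mul2r leqnSn orbT.
  apply: eq_cint => x _; rewrite /ui /et !natrM !mulrA; ring.
rewrite -mulr_sumr ler_wpM2l//.
have isq (v : R -> C) : cmeas setT v -> (forall x, cabs (v x) <= H) ->
    mu.-integrable I (EFin \o (fun x => cabs (v x) ^+ 2)).
  move=> mv vH; apply: (@rint_bnd _ (H ^+ 2)).
    by apply: measurable_funX; exact: cmeas_cabs.
  by move=> x; rewrite ger0_norm ?sqr_ge0// lerXn2r ?nnegrE ?cabs_ge0.
have -> : \sum_(0 <= i < 2 ^ (L - l)) \int[mu]_(x in I) cabs (ui i x) ^+ 2 =
   \int[mu]_(x in I) \sum_(0 <= i < 2 ^ (L - l)) cabs (ui i x) ^+ 2.
  have := cint_sum (index_iota 0 (2 ^ (L - l))) (P := xpredT)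
    (F := fun i x => rc (cabs (ui i x) ^+ 2)) mI.
  move=> e; have {}e : cint I (fun x => \sum_(0 <= i < 2 ^ (L - l)) rc (cabs (ui i x) ^+ 2)) =
     \sum_(0 <= i < 2 ^ (L - l)) cint I (fun x => rc (cabs (ui i x) ^+ 2)).
    apply: e => i _; split; first by apply: isq.
    exact: integrable0.
  move/(congr1 (@complex.Re _)): e; rewrite cRe_sum => e.
  transitivity (\sum_(0 <= i < 2 ^ (L - l)) complex.Re (cint I (fun x => rc (cabs (ui i x) ^+ 2)))).
    by apply: eq_bigr => i _; rewrite cint_rc.
  rewrite -e; apply: eq_Rintegral => x _; rewrite cRe_sum; exact: eq_bigr.
apply: le_Rintegral => //; last 2 first.
- exact: isq.
- move=> x _; under eq_bigr => i _.
    rewrite /ui cabsM cabsM cabs_expi mulr1 exprMn.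
    rewrite cabs_rc (ger0_norm (indR_ge0 _ _ _)).
    rewrite (_ : indR _ _ x ^+ 2 = indR (i%:R * et) (i.+1%:R * et) x); last first.
      by rewrite /indR; case: ifP => _; rewrite ?expr1n// expr0n.
    over.
  by rewrite -mulr_sumr indR_sum// ler_piMr ?sqr_ge0// indR_le1.
apply: (@rint_bnd _ ((2 ^ (L - l))%:R * H ^+ 2)).
  by apply: measurable_sum => i; apply: measurable_funX; exact: cmeas_cabs.
move=> x; rewrite ger0_norm; last by apply: sumr_ge0 => i _; exact: sqr_ge0.
rewrite mulr_natl -[X in _ *+ X]subn0 -sumr_const_nat; apply: ler_sum => i _.
by rewrite lerXn2r ?nnegrE ?cabs_ge0.
Qed.

Lemma sum_Wmax t : \sum_(0 <= g < N) Wmax g t <=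
  cW * (L%:R ^+ 2 * N%:R * l2sq + N%:R * (H * dstep) ^+ 2).
Proof.
rewrite /Wmax -mulr_sumr ler_wpM2l ?cW_ge0// big_split/= -mulr_sumr lerD//.
  by rewrite expr2 -!mulrA ler_wpM2l// sum_Wvar.
by rewrite sumr_const_nat subn0 mulr_natl.
Qed.

(** For y = (g + th)/N the phase left over after the frequency g/N is e^(2 pi i th x/N); it is
    frozen at the left end of each cell of length [dstep]. *)
Lemma indR_step (th x : R) m : 0 <= th <= 1 ->
  cabs (expi (2 * pi * th / N%:R * x) * rc (indR 0 (m%:R * dstep) x) -
    \sum_(0 <= i < m) expi (2 * pi * th / N%:R * (i%:R * dstep)) *
      rc (indR (i%:R * dstep) (i.+1%:R * dstep) x)) <=
  2 * pi * dstep / N%:R * indR 0 (m%:R * dstep) x.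
Proof.
move=> /andP[th0 th1]; elim: m => [|m IH].
  rewrite big_geq// subr0 mul0r; have -> : indR 0 0 x = 0.
    by rewrite /indR; case: ifP => // /andP[h1 h2]; lra.
  by rewrite rc0 mulr0 cabs0 mulr0.
rewrite big_nat_recr//=; set S := \sum_(_ <= _ < _) _ in IH *.
set E := expi _ in IH *; set b := expi _.
have <- : indR 0 (m%:R * dstep) x + indR (m%:R * dstep) (m.+1%:R * dstep) x =
    indR 0 (m.+1%:R * dstep) x.
  by apply: indR_add; rewrite ?mulr_ge0 ?ler0n ?(ltW d0)// ler_pM2r// ler_nat.
set i1 := indR _ _ _; set i2 := indR (m%:R * dstep) _ _ in IH *.
have -> : E * rc (i1 + i2) - (S + b * rc i2) = (E * rc i1 - S) + (E - b) * rc i2.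
  by rewrite rcD; ring.
apply: le_trans (cabsD _ _) _; rewrite mulrDr lerD//.
rewrite cabsM cabs_rc /i2 /indR; case: ifP => [/andP[x1 x2]|_]; last by rewrite normr0 !mulr0.
rewrite normr1 !mulr1; apply: le_trans (expi_lip _ _) _.
rewrite -mulrBr normrM ger0_norm; last by rewrite !mulr_ge0 ?invr_ge0 ?pi_ge0// ltW.
rewrite ger0_norm ?subr_ge0//.
have x3 : x - m%:R * dstep <= dstep.
  by move: x2; rewrite -natr1 mulrDl mul1r; lra.
have -> : 2 * pi * dstep / N%:R = 2 * pi / N%:R * dstep by ring.
have -> : 2 * pi * th / N%:R * (x - m%:R * dstep) =
  2 * pi / N%:R * (th * (x - m%:R * dstep)) by ring.
have c0 : 0 <= 2 * pi / N%:R :> R by rewrite !mulr_ge0 ?invr_ge0 ?pi_ge0// ltW.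
rewrite ler_wpM2l//.
by apply: le_trans x3; rewrite ler_piMl// subr_ge0.
Qed.

(** The cut-off T is moved to a multiple of [dstep], the residual phase is replaced by a step
    function, and the sum over cells is treated by Abel summation: the step coefficients have total
    variation at most 2 pi, and the partial sums are controlled by [rademacher_menshov]. The bound
    does not see T, since any partial sum is allowed. *)
Lemma Wmax_ge (g : nat) (t y T : R) : 0 <= T ->
  g%:R / N%:R <= y <= g.+1%:R / N%:R ->
  cabs (cint `[- T, T] (fun x => h x * expi (- (pi * t * x ^+ 2) + 2 * pi * y * x))) ^+ 2
  <= Wmax g t.
Proof.
move=> T0 /andP[y1 y2].
pose th := N%:R * y - g%:R.
have th01 : 0 <= th <= 1.
  rewrite ler_pdivrMr// in y1; rewrite ler_pdivlMr// -natr1 in y2.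
  by rewrite /th; apply/andP; split; lra.
have [th0 th1] := andP th01.
have eb : 2 * pi * y = 2 * pi * g%:R / N%:R + 2 * pi * th / N%:R.
  by rewrite /th; field; rewrite gt_eqF.
pose v x := h x * expi (- (pi * t * x ^+ 2)) * expi (2 * pi * g%:R / N%:R * x).
pose E x : C := expi (2 * pi * th / N%:R * x).
have mv : cmeas setT v.
  by apply: cmeasM => //; apply: cmeasM => //; apply: cmeas_expi; exact: measurable_chirp.
have vH x : cabs (v x) <= H by rewrite !cabsM !cabs_expi !mulr1.
have v0 x : ~~ (0 <= x <= N%:R) -> v x = 0 by move=> hx; rewrite /v h0// !mul0r.
have mE : cmeas setT E by exact: cmeas_eg.
pose cT (x : R) : R := indR (- T) (T + 1) x * (if x <= T then 1 else 0).
have -> : cint `[- T, T] (fun x => h x * expi (- (pi * t * x ^+ 2) + 2 * pi * y * x)) =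
   cint setT (fun x => if x \in (`[- T, T] : set R) then v x * E x else 0).
  rewrite cint_mkcond; apply: eq_cint => x _; case: ifP => // _.
  transitivity (h x * (expi (- (pi * t * x ^+ 2)) * (expi (2 * pi * g%:R / N%:R * x) * E x))).
    rewrite /E -!expiD eb; congr (_ * expi _); ring.
  rewrite /v; ring.
pose k := Num.truncn (T / dstep).
(* The cap is M+1 rather than M: h may be nonzero at the endpoint N, which the first M half-open
   cells leave out. *)
pose m := minn k M.+1.
have Td0 : 0 <= T / dstep by rewrite divr_ge0// ltW.
have /andP[k1 k2] := truncn_itv Td0.
rewrite ler_pdivlMr// in k1; rewrite ltr_pdivrMr// in k2.
have NdE : N%:R = M%:R * dstep by rewrite /dstep mulrC divfK// gt_eqF.
have mvE : cmeas setT (fun x => v x * E x) by exact: cmeasM.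
have ivE (w : R -> C) : cmeas setT w -> (forall x, cabs (w x) <= 1) ->
    cintegrable setT (fun x => v x * w x).
  move=> mw w1; apply: (@cintegrable_supp _ I) => //.
    apply: (@cintegrable_I _ H); first exact: cmeasM.
    by move=> x; rewrite cabsM; apply: le_trans (vH x); rewrite ler_piMr ?cabs_ge0.
  by move=> x /= xI; rewrite v0 ?mul0r//; apply/negP; rewrite in_itv/= in xI.
have supI (w : R -> C) : cint setT (fun x => v x * w x) = cint I (fun x => v x * w x).
  apply: cint_sub => // x _ xI; rewrite v0 ?mul0r//; apply/negP.
  by rewrite /= in_itv/= in xI.
pose ET x := E x * (if x \in (`[- T, T] : set R) then 1 else 0).
have mET : cmeas setT ET.
  apply: cmeasM => //.
  have -> : (fun x => (if x \in (`[- T, T] : set R) then 1 else 0) : C) =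
     (fun x => rc (\1_(`[- T, T] : set R) x)).
    by apply/funext => x; rewrite indicE; case: (x \in _).
  by apply: cmeas_rc; exact: measurable_indic.
have ET1 x : cabs (ET x) <= 1.
  by rewrite cabsM cabs_expi mul1r; case: ifP => _; rewrite ?cabs1 ?cabs0.
pose Em x := E x * rc (indR 0 (m%:R * dstep) x).
have mEm : cmeas setT Em by exact: cmeasM.
have Em1 x : cabs (Em x) <= 1 by rewrite cabsM cabs_expi mul1r.
pose bb (i : nat) : C := expi (2 * pi * th / N%:R * (i%:R * dstep)).
pose Eb x := \sum_(0 <= i < m) bb i * rc (indR (i%:R * dstep) (i.+1%:R * dstep) x).
have mEb : cmeas setT Eb.
  by apply: cmeas_sum => i _; apply: cmeasM => //; exact: cmeas_cst.
have -> : cint setT (fun x => if x \in (`[- T, T] : set R) then v x * E x else 0) =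
   cint setT (fun x => v x * ET x).
  by apply: eq_cint => x _; rewrite /ET; case: ifP => _; rewrite ?mulr1// !mulr0.
(* The two integrands differ only within one cell of length [dstep]. *)
have step1 : cabs (cint setT (fun x => v x * ET x) - cint setT (fun x => v x * Em x)) <= H * dstep.
  rewrite -cintB//; [|exact: ivE|exact: ivE].
  rewrite (@cint_sub _ setT `[m%:R * dstep, m.+1%:R * dstep])//; last first.
    move=> x _; rewrite /= in_itv/= => xm; rewrite -mulrBr /ET /Em -mulrBr.
    have [xI|xI] := boolP (0 <= x <= N%:R); last by rewrite v0// mul0r.
    move/andP: xI => [x0 xN].
    suff -> : (if x \in (`[- T, T] : set R) then 1 else 0) = rc (indR 0 (m%:R * dstep) x).
      by rewrite subrr !mulr0.
    have [xlt|xge] := ltP x (m%:R * dstep).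
      rewrite /indR x0 xlt mem_set//= in_itv/=; apply/andP; split; first lra.
      apply: (@le_trans _ _ (k%:R * dstep)) => //; apply: (le_trans (ltW xlt)).
      by rewrite ler_pM2r// ler_nat geq_minl.
    have xgt : m.+1%:R * dstep < x.
      by rewrite ltNge; apply/negP => hx; apply: xm; rewrite xge hx.
    have km : m = k.
      have [kM|] := boolP (k <= M.+1)%N; first exact/minn_idPl.
      rewrite -ltnNge => kM.
      have e : m = M.+1 by apply/minn_idPr/ltnW.
      have hN : N%:R < m.+1%:R * dstep by rewrite NdE ltr_pM2r// ltr_nat e ltnW// ltnS leqnSn.
      by have := lt_le_trans (lt_trans hN xgt) xN; rewrite ltxx.
    rewrite /indR x0 ltNge xge/= memNset//= in_itv/= => /andP[_ xT].
    by rewrite km in xgt; lra.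
  apply: le_trans (cabs_cint_bnd (M := H) _ _ _ _) _ => //.
  - exact: cint_itv_fin.
  - apply: (@cmeas_S _ _ (fun x => v x * ET x - v x * Em x)).
    by apply: cmeasB; exact: cmeasM.
  - move=> x _; rewrite -mulrBr cabsM; apply: le_trans (vH x).
    rewrite ler_piMr ?cabs_ge0// /ET /Em -mulrBr cabsM cabs_expi mul1r.
    rewrite /indR; case: ifP => _; case: ifP => _;
      by rewrite ?(rc1, rc0, subrr, subr0, sub0r, cabsN, cabs0, cabs1).
  rewrite fine_mu_itv; last by rewrite ler_pM2r// ler_nat.
  by rewrite -mulrBl -natr1 addrAC subrr add0r mul1r.
have step2 : cabs (cint setT (fun x => v x * Em x) - cint I (fun x => v x * Eb x)) <= H * (2 * pi * dstep).
  rewrite supI -cintB//.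
  - apply: le_trans (cabs_cint_bnd (M := H * (2 * pi * dstep / N%:R)) _ _ _ _) _ => //.
    + apply: (@cmeas_S _ _ (fun x => v x * Em x - v x * Eb x)).
      by apply: cmeasB; exact: cmeasM.
    + move=> x _; rewrite -mulrBr cabsM ler_pM ?cabs_ge0//.
      apply: le_trans (indR_step x m th01) _.
      rewrite ler_piMr ?indR_le1// !mulr_ge0 ?invr_ge0 ?pi_ge0//; exact: ltW.
    rewrite fine_mu_itv ?ler0n// subr0 -mulrA divfK// gt_eqF//.
  - apply: (@cintegrable_I _ H); first exact: cmeasM.
    by move=> x; rewrite cabsM; apply: le_trans (vH x); rewrite ler_piMr ?cabs_ge0.
  - apply: (@cintegrable_I _ (H * \sum_(0 <= i < m) 1)); first exact: cmeasM.
    move=> x; rewrite cabsM ler_pM ?cabs_ge0//; apply: le_trans (cabs_sum _ _ _) _.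
    by apply: ler_sum => i _; rewrite cabsM cabs_expi mul1r.
pose X := Num.sqrt (L%:R * Wvar g t).
have X0 : 0 <= X by exact: sqrtr_ge0.
have X2 : X ^+ 2 = L%:R * Wvar g t by rewrite sqr_sqrtr// mulr_ge0// Wvar_ge0.
have EbE : cint I (fun x => v x * Eb x) = \sum_(0 <= i < m) bb i * (Fpart g i.+1 t - Fpart g i t).
  transitivity (cint I (fun x => \sum_(0 <= i < m) bb i *
      (v x * rc (indR (i%:R * dstep) (i.+1%:R * dstep) x)))).
    apply: eq_cint => x _; rewrite /Eb mulr_sumr; apply: eq_bigr => i _; exact: mulrCA.
  have ii i : cintegrable I (fun x => v x * rc (indR (i%:R * dstep) (i.+1%:R * dstep) x)).
    apply: (@cintegrable_I _ H); first exact: cmeasM.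
    by move=> x; rewrite cabsM; apply: le_trans (vH x); rewrite ler_piMr ?cabs_ge0.
  rewrite cint_sum//; last by move=> i _; exact: cintegrableZ.
  apply: eq_bigr => i _; rewrite cintZ//; congr (_ * _).
  rewrite Fpart_diff//; apply: eq_cint => x _; rewrite /v; ring.
have step3 : cabs (cint I (fun x => v x * Eb x)) <= (1 + 2 * pi) * X.
  have p0 := @pi_gt0 R.
  rewrite EbE; case: (posnP m) => [->|m0]; first by rewrite big_geq// cabs0 mulr_ge0//; lra.
  have mM : (m <= M.+1)%N by exact: geq_minr.
  rewrite -(prednK m0); apply: le_trans (abel_le (X := X) _ _) _.
    move=> j jm; rewrite telescope_sumr//.
    have jL : (j < 2 ^ L)%N by apply: leq_ltn_trans ML; apply: leq_trans mM; rewrite -(prednK m0).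
    have := rademacher_menshov (fun i => Fpart g i t) jL.
    by rewrite -/(Wvar g t) -X2 ler_sqr ?nnegrE ?cabs_ge0.
  rewrite mulrC ler_wpM2r// cabs_expi lerD2l.
  (* At most M increments of size 2 pi dstep/N, and M dstep = N: the total variation is at most 2
     pi. *)
  apply: (@le_trans _ _ (\sum_(0 <= i < m.-1) 2 * pi * dstep / N%:R)).
    apply: ler_sum => i _; apply: le_trans (expi_lip _ _) _.
    have -> : 2 * pi * th / N%:R * (i.+1%:R * dstep) - 2 * pi * th / N%:R * (i%:R * dstep) =
      th * (2 * pi * dstep / N%:R) by rewrite -[i.+1%:R]natr1; ring.
    have c0 : 0 <= 2 * pi * dstep / N%:R by rewrite !mulr_ge0 ?invr_ge0 ?pi_ge0// ltW.
    by rewrite (ger0_norm (mulr_ge0 th0 c0)) ler_piMl.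
  rewrite sumr_const_nat subn0 -[X in X <= _]mulr_natl.
  have -> : m.-1%:R * (2 * pi * dstep / N%:R) = 2 * pi * (m.-1%:R / M%:R).
    by rewrite /dstep; field; rewrite !gt_eqF.
  rewrite -[leRHS]mulr1 ler_wpM2l//; first lra.
  by rewrite ler_pdivrMr// mul1r ler_nat -ltnS prednK.
have tot : cabs (cint setT (fun x => v x * ET x)) <= (1 + 2 * pi) * (X + H * dstep).
  apply: le_trans (cabs_le_sub _ (cint setT (fun x => v x * Em x))) _.
  apply: le_trans (lerD (cabs_le_sub _ (cint I (fun x => v x * Eb x))) step1) _.
  apply: le_trans (lerD (lerD step3 step2) (lexx _)) _.
  by rewrite le_eqVlt; apply/orP; left; apply/eqP; ring.
apply: (@le_trans _ _ (((1 + 2 * pi) * (X + H * dstep)) ^+ 2)).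
  by rewrite lerXn2r ?nnegrE ?cabs_ge0// (le_trans _ tot)// cabs_ge0.
have -> : Wmax g t = (1 + 2 * pi) ^+ 2 * (2 * (X ^+ 2 + (H * dstep) ^+ 2)).
  by rewrite /Wmax -X2 /cW; ring.
rewrite exprMn ler_wpM2l ?sqr_ge0//.
have := sqr_ge0 (X - H * dstep); lra.
Qed.

End osc.
End MaxFun.

(** * Incomplete Gauss sums *)

Section Gauss.
Variable R : realType.
Local Notation C := R[i].

Section modq.
Variables (q : nat) (q0 : (0 < q)%N).
Let qR : 0 < q%:R :> R. Proof. by rewrite ltr0n. Qed.

Definition eqz (z : int) : C := expi (2 * pi * z%:~R / q%:R).

Lemma eqzD z w : eqz (z + w) = eqz z * eqz w.
Proof. by rewrite /eqz -expiD intrD mulrDr mulrDl. Qed.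

Lemma eqz0 : eqz 0 = 1.
Proof. by rewrite /eqz mulr0 mul0r expi0. Qed.

Lemma eqzN z : eqz (- z) = conjc (eqz z).
Proof. by rewrite /eqz -expiN intrN mulrN mulNr. Qed.

Lemma eqzq z : eqz (z * q%:Z) = 1.
Proof. by rewrite /eqz intrM mulrA mulfK ?gt_eqF// expi2piz. Qed.

Lemma cabs_eqz z : cabs (eqz z) = 1.
Proof. exact: cabs_expi. Qed.

Lemma eqz_dvd z : (q%:Z %| z)%Z -> eqz z = 1.
Proof. by case/dvdzP => w ->; exact: eqzq. Qed.

Lemma cabs_1BeqzN z : cabs (1 - eqz (- z)) = cabs (1 - eqz z).
Proof.
rewrite eqzN (_ : 1 - conjc (eqz z) = conjc (1 - eqz z)) ?cabs_conj//.
by rewrite rmorphB rmorph1.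
Qed.

(** The chord has length 2 |sin(pi r/q)|, and [sin_ge_quarter] compares it with the distance of r/q
    to the integers. *)
Lemma eqz_gap (r : nat) : (0 < r < q)%N ->
  (minn r (q - r))%:R / q%:R <= cabs (1 - eqz r%:Z).
Proof.
move=> /andP[r0 rq].
have key (s : nat) : (0 < s)%N -> (s.*2 <= q)%N -> s%:R / q%:R <= cabs (1 - eqz s%:Z).
  move=> s0 s2; rewrite -expi0 /eqz.
  rewrite -(@ler_pXn2r _ 2)// ?nnegrE ?cabs_ge0 ?divr_ge0// expiB_sqr sub0r cosN oneBcos_half.
  have p0 := @pi_gt0 R.
  set v := _ / 2; have ev : v = pi * (s%:R / q%:R) by rewrite /v -[s%:Z%:~R]/(s%:R); field; rewrite gt_eqF.
  have v0 : 0 <= v by rewrite ev mulr_ge0// ltW.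
  have sq : s%:R / q%:R <= 1 / 2 :> R.
    rewrite ler_pdivrMr//; have : s.*2%:R <= q%:R :> R by rewrite ler_nat.
    by rewrite -muln2 natrM; lra.
  have v1 : v / 4 <= sin v.
    apply: sin_ge_quarter; rewrite v0/= ev ler_wpM2l ?(ltW p0)//; lra.
  have v2 : (v / 4) ^+ 2 <= sin v ^+ 2 by rewrite lerXn2r ?nnegrE// ?(le_trans _ v1)//; rewrite divr_ge0.
  have h : (s%:R / q%:R) ^+ 2 <= 4 * (v / 4) ^+ 2.
    have -> : 4 * (v / 4) ^+ 2 = (v / 2) ^+ 2 by field.
    have sq0 : 0 <= s%:R / q%:R :> R by rewrite divr_ge0.
    rewrite lerXn2r ?nnegrE//; first by rewrite divr_ge0.
    by rewrite ev; have := @pi_ge2 R; nra.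
  lra.
have [h|h] := leqP r (q - r).
  by apply: key => //; lia.
have -> : cabs (1 - eqz r%:Z) = cabs (1 - eqz (q - r)%N%:Z).
  by rewrite -subzn 1?ltnW// eqzD -[X in eqz X * _]mul1r eqzq mul1r cabs_1BeqzN.
by apply: key; lia.
Qed.

Lemma eqz_neq1 (z : int) : ~~ (q%:Z %| z)%Z -> eqz z != 1.
Proof.
move=> zq; have qn0 : q%:Z != 0 by rewrite eqz_nat -lt0n.
have m0 := modz_ge0 z qn0; have m1 := ltz_pmod z (d := q%:Z); rewrite ltz_nat in m1.
have := divz_eq z q%:Z; case em : (z %% q%:Z)%Z m0 m1 => [r|//] _ /(_ q0) rq ez.
have r0 : (0 < r)%N.
  rewrite lt0n; apply: contra zq => /eqP r0; apply/dvdz_mod0P; by rewrite em r0.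
have ee : eqz z = eqz r%:Z by rewrite ez eqzD eqzq mul1r.
have := @eqz_gap r; rewrite r0 -ltz_nat rq => /(_ isT) h.
apply/eqP => e1; move: h; rewrite -ee e1 subrr cabs0.
apply/negP; rewrite -ltNge divr_gt0// ltr0n leq_min r0 subn_gt0.
by rewrite -ltz_nat.
Qed.

Lemma geom_sum (z : int) H :
  (1 - eqz z) * \sum_(0 <= l < H) eqz (z * l%:Z) = 1 - eqz (z * H%:Z).
Proof.
elim: H => [|H IH]; first by rewrite big_geq// mulr0 mulr0 eqz0 subrr.
by rewrite big_nat_recr//= mulrDr IH -addn1 PoszD mulrDr mulr1 eqzD; ring.
Qed.

Lemma complete_sum (z : int) :
  \sum_(0 <= l < q) eqz (z * l%:Z) = if (q%:Z %| z)%Z then q%:R else 0.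
Proof.
case: ifPn => zq.
  rewrite (eq_bigr (fun=> 1)); first by rewrite sumr_const_nat subn0.
  by move=> l _; apply: eqz_dvd; rewrite dvdz_mulr.
have := geom_sum z q; rewrite eqzq subrr => /eqP; rewrite mulf_eq0 subr_eq0 eq_sym.
by rewrite (negbTE (eqz_neq1 zq)) => /eqP.
Qed.

(** The reciprocal of min(m, q - m) is bounded by the sum of both reciprocals, a form that is easy
    to add up over m. *)
Lemma geom_le (m H : nat) : (0 < m < q)%N ->
  cabs (\sum_(0 <= l < H) eqz (- m%:Z * l%:Z)) <=
  2 * q%:R * (m%:R^-1 + (q - m)%:R^-1).
Proof.
move=> mq; have /andP[m0 m1] := mq.
have g := geom_sum (- m%:Z) H.
have gap := eqz_gap mq.
have gN : cabs (1 - eqz (- m%:Z)) = cabs (1 - eqz m%:Z).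
  exact: cabs_1BeqzN.
set S := \sum_(_ <= _ < _) _ in g *.
have h2 : cabs (1 - eqz m%:Z) * cabs S <= 2.
  rewrite -gN -cabsM g; apply: le_trans (cabsD _ _) _.
  by rewrite cabsN cabs1 cabs_eqz.
have mn0 : 0 < (minn m (q - m))%:R :> R by rewrite ltr0n leq_min m0 subn_gt0.
have h3 : (minn m (q - m))%:R / q%:R * cabs S <= 2.
  by apply: le_trans h2; rewrite ler_wpM2r ?cabs_ge0.
have h4 : cabs S <= 2 * q%:R / (minn m (q - m))%:R.
  have e : (minn m (q - m))%:R / q%:R * cabs S = (minn m (q - m))%:R * cabs S / q%:R by ring.
  by rewrite e ler_pdivrMr// in h3; rewrite ler_pdivlMr// mulrC.
apply: le_trans h4 _; rewrite ler_wpM2l ?mulr_ge0//.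
have a1 : 0 <= m%:R^-1 :> R by rewrite invr_ge0.
have a2 : 0 <= (q - m)%:R^-1 :> R by rewrite invr_ge0.
by case: (leqP m (q - m)) => _; lra.
Qed.

Lemma periodic_shift (f : nat -> C) a : (forall l, f (l + q)%N = f l) ->
  \sum_(0 <= l < q) f (l + a)%N = \sum_(0 <= l < q) f l.
Proof.
move=> fq; elim: a => [|a IH]; first by apply: eq_bigr => l _; rewrite addn0.
rewrite -IH; case: q q0 fq => // k _ fq.
rewrite big_nat_recr//= [RHS]big_nat_recl//= addrC; congr (_ + _).
  by rewrite add0n addnS -addSn addnC fq.
by apply: eq_bigr => l _; rewrite addSnnS.
Qed.

Variables (p1 : int) (cop : coprimez p1 q%:Z).

Definition gph (p : int) (l : nat) : C := eqz (p * l%:Z - p1 * (l%:Z * l%:Z)).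

Lemma cabs_gph p l : cabs (gph p l) = 1. Proof. exact: cabs_eqz. Qed.

Lemma gph_per p l : gph p (l + q)%N = gph p l.
Proof.
rewrite /gph PoszD.
have -> : p * (l%:Z + q%:Z) - p1 * ((l%:Z + q%:Z) * (l%:Z + q%:Z)) =
  (p * l%:Z - p1 * (l%:Z * l%:Z)) + (p - p1 * (2 * l%:Z + q%:Z)) * q%:Z by ring.
by rewrite eqzD eqzq mulr1.
Qed.

Definition gsum (p : int) : C := \sum_(0 <= l < q) gph p l.

(** Squaring and shifting one variable by the other makes the phase linear in l; the complete sum
    over l then forces q | 2h, because p1 is a unit modulo q. *)
Lemma gsum_sq p : rc (cabs (gsum p) ^+ 2) =
  q%:R * \sum_(0 <= h < q | (q%:Z %| 2 * h%:Z)%Z) gph p h.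
Proof.
rewrite rc_cabs_sqr {2}/gsum rmorph_sum mulr_sumr.
transitivity (\sum_(0 <= l < q) \sum_(0 <= h < q) gph p h * eqz (- (2 * p1 * h%:Z) * l%:Z)).
  apply: eq_bigr => l _; rewrite /gsum -(periodic_shift l (gph_per p)) mulr_suml.
  apply: eq_bigr => h _; rewrite -[X in _ * X]/(conjc (gph p l)) /gph -eqzN -!eqzD.
  by congr eqz; rewrite PoszD; ring.
rewrite exchange_big_nat/= mulr_sumr [RHS]big_mkcond/=.
apply: eq_bigr => h _; rewrite -mulr_sumr complete_sum.
have -> : (q%:Z %| - (2 * p1 * h%:Z))%Z = (q%:Z %| 2 * h%:Z)%Z.
  rewrite (_ : - (2 * p1 * h%:Z) = - p1 * (2 * h%:Z)); last by ring.
  have cop' : coprimez q%:Z (- p1) by rewrite coprimezE abszN -coprimezE coprimez_sym.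
  by rewrite (Gauss_dvdzr _ cop').
by case: ifP => _; rewrite ?mulr0// mulrC.
Qed.

Lemma dvd_half (h : nat) : (h < q)%N ->
  (q%:Z %| 2 * h%:Z)%Z = (h == 0)%N || (h.*2 == q)%N.
Proof.
move=> hq; rewrite -PoszM dvdzE/= mul2n.
apply/idP/orP => [/dvdnP[k e]|[/eqP->|/eqP->]] //.
have : (h.*2 < 2 * q)%N by rewrite -mul2n ltn_mul2l.
rewrite e ltn_mul2r q0/= => k2; move: e; case: k k2 => [|[|//]] _ e.
  by left; rewrite -double_eq0 e mul0n.
by right; rewrite mul1n.
Qed.

(** At most two residues h satisfy q | 2h, and each contributes a term of modulus 1. *)
Lemma gsum_le p : cabs (gsum p) <= Num.sqrt (2 * q%:R).
Proof.
suff h : cabs (gsum p) ^+ 2 <= 2 * q%:R.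
  by rewrite -(ger0_norm (cabs_ge0 _)) -sqrtr_sqr ler_wsqrtr.
have := congr1 (@cabs R) (gsum_sq p).
rewrite cabs_rc ger0_norm ?sqr_ge0// => ->.
rewrite cabsM -rc_nat cabs_rc ger0_norm// mulrC ler_wpM2r//.
apply: le_trans (cabs_sum _ _ _) _; under eq_bigr do rewrite cabs_gph.
rewrite big_mkcond/= (big_ltn q0) -[leRHS]/(1 + 1) lerD//; first by case: ifP.
have [u|qodd] := boolP (odd q).
  rewrite big_nat big1 ?ler01// => h /andP[h1 h2]; rewrite dvd_half//.
  case: eqVneq h1 => [->//|_ _] /=; case: eqP => // e; by rewrite -e odd_double in u.
have hq : (q./2 < q)%N by rewrite -divn2 ltn_Pdiv.
have q2 : q./2.*2 = q by rewrite -[RHS]odd_double_half (negbTE qodd).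
have q20 : (0 < q./2)%N by rewrite -double_gt0 q2.
rewrite (bigD1_seq q./2) ?mem_index_iota ?iota_uniq ?q20//= big1_seq ?addr0.
  by case: ifP.
move=> h /andP[hn]; rewrite mem_index_iota => /andP[h1 h2].
rewrite dvd_half//; case: eqVneq h1 => [->//|_ _] /=; case: eqP => // e.
by move: hn; rewrite -(doubleK h) e eqxx.
Qed.

(** Besides h = 0 only h = q/2 can occur, with phase e^(pi i (p - p1 h)). The parity condition makes
    it +1; with the value -1 the Gauss sum would vanish. *)
Lemma gsum_ge p : (forall u : nat, q = u.*2 -> (2 %| p - p1 * u%:Z)%Z) ->
  Num.sqrt q%:R <= cabs (gsum p).
Proof.
move=> adm.
rewrite -(@ler_pXn2r _ 2)// ?nnegrE ?cabs_ge0// sqr_sqrtr//.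
suff : rc (q%:R * \sum_(0 <= h < q | (q%:Z %| 2 * h%:Z)%Z) 1) = rc (cabs (gsum p) ^+ 2) :> C.
  move/(congr1 (@complex.Re _)) => /= <-.
  rewrite ler_pMr// big_mkcond/= (big_ltn q0) dvdz0 lerDl.
  by apply: sumr_ge0 => h _; case: ifP.
rewrite gsum_sq rcM rc_nat; congr (_ * _); rewrite rc_sum big_nat_cond [RHS]big_nat_cond.
apply: eq_bigr => h /andP[/andP[_ hq]]; rewrite dvd_half// => /orP[/eqP->|/eqP e].
  by rewrite /gph !mulr0 subrr eqz0.
have /dvdzP[w ew] := adm h (esym e).
rewrite /gph (_ : p * h%:Z - p1 * (h%:Z * h%:Z) = w * q%:Z) ?eqzq//.
have -> : p * h%:Z - p1 * (h%:Z * h%:Z) = (p - p1 * h%:Z) * h%:Z by ring.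
by rewrite ew -e -muln2 PoszM; ring.
Qed.

(** Each dyadic block contributes at most 1. *)
Lemma harmonic_le K : \sum_(1 <= m < 2 ^ K) (m%:R^-1 : R) <= K%:R.
Proof.
elim: K => [|K IH]; first by rewrite expn0 big_geq.
rewrite (big_cat_nat (n := 2 ^ K)) ?expn_gt0 ?leq_exp2l//=.
rewrite -[K.+1%:R]natr1 lerD//.
apply: (@le_trans _ _ (\sum_(2 ^ K <= m < 2 ^ K.+1) (2 ^ K)%:R^-1)).
  apply: ler_sum_nat => m /andP[m1 _].
  rewrite lef_pV2 ?posrE ?ltr0n ?expn_gt0// ?ler_nat//.
  by apply: leq_trans m1; rewrite expn_gt0.
rewrite sumr_const_nat expnS mul2n -addnn addnK -[X in X <= _]mulr_natl mulfV//.
Qed.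

Variables (K : nat) (qK : (q <= 2 ^ K)%N).

(** The size of a complete sum times the logarithmic loss of completion; K is a bound for log_2
    q. *)
Definition gerr : R := Num.sqrt (2 * q%:R) * (1 + 4 * K%:R).

Lemma gph_shift p (m : nat) l : gph p l * eqz (m%:Z * l%:Z) = gph (p + m%:Z) l.
Proof. by rewrite /gph -eqzD; congr eqz; ring. Qed.

(** Completion: the cut-off l < H is expanded in additive characters modulo q. Every coefficient
    multiplies a complete Gauss sum, and the coefficients are geometric sums whose moduli add up to
    O(q log q). *)
Lemma incomplete_le p H : (H <= q)%N -> cabs (\sum_(0 <= l < H) gph p l) <= gerr.
Proof.
move=> Hq.
have qn0 : (q%:R : C) != 0 by rewrite pnatr_eq0 -lt0n.
have E : q%:R * \sum_(0 <= l < H) gph p l =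
   \sum_(0 <= m < q) gsum (p + m%:Z) * \sum_(0 <= l < H) eqz (- m%:Z * l%:Z).
  transitivity (\sum_(0 <= m < q) \sum_(0 <= l' < q) \sum_(0 <= l < H)
      gph p l' * eqz ((l'%:Z - l%:Z) * m%:Z)); last first.
    apply: eq_bigr => m _; rewrite /gsum mulr_suml; apply: eq_bigr => l' _.
    rewrite mulr_sumr; apply: eq_bigr => l _.
    by rewrite -gph_shift -mulrA -eqzD; congr (_ * eqz _); ring.
  rewrite exchange_big_nat/=.
  transitivity (\sum_(0 <= l' < q) \sum_(0 <= l < H) gph p l' * (if l' == l then q%:R else 0)).
    rewrite exchange_big_nat/= mulr_sumr; apply: eq_big_nat => l /andP[_ lH].
    have lq := leq_trans lH Hq.
    rewrite (bigD1_seq l) ?mem_index_iota ?iota_uniq//= eqxx big1 ?addr0; first by rewrite mulrC.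
    by move=> l' /negbTE ->; rewrite mulr0.
  apply: eq_big_nat => l' /andP[_ l'q]; rewrite exchange_big_nat/=.
  apply: eq_big_nat => l /andP[_ lH]; rewrite -mulr_sumr complete_sum; congr (_ * _).
  have lq := leq_trans lH Hq.
  suff -> : (q%:Z %| l'%:Z - l%:Z)%Z = (l' == l) by [].
  by rewrite -eqz_mod_dvd !modz_nat eqz_nat !modn_small.
have q1 : q%:R * cabs (\sum_(0 <= l < H) gph p l) <= q%:R * gerr.
  have -> : q%:R * cabs (\sum_(0 <= l < H) gph p l) = cabs (q%:R * \sum_(0 <= l < H) gph p l).
    by rewrite cabsM -rc_nat cabs_rc ger0_norm.
  rewrite E; apply: le_trans (cabs_sum _ _ _) _.
  apply: (@le_trans _ _ (\sum_(0 <= m < q) Num.sqrt (2 * q%:R) * cabs (\sum_(0 <= l < H) eqz (- m%:Z * l%:Z)))).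
    by apply: ler_sum => m _; rewrite cabsM ler_wpM2r ?cabs_ge0// gsum_le.
  rewrite -mulr_sumr /gerr mulrCA ler_wpM2l ?sqrtr_ge0//.
  rewrite (big_ltn q0) mulrDr mulr1 lerD//.
    apply: le_trans (cabs_sum _ _ _) _; under eq_bigr do rewrite cabs_eqz.
    by rewrite sumr_const_nat subn0 ler_nat.
  apply: (@le_trans _ _ (\sum_(1 <= m < q) 2 * q%:R * (m%:R^-1 + (q - m)%:R^-1))).
    by apply: ler_sum_nat => m mq; apply: geom_le.
  rewrite -mulr_sumr big_split/=.
  have -> : \sum_(1 <= m < q) ((q - m)%:R^-1 : R) = \sum_(1 <= m < q) m%:R^-1.
    rewrite big_nat_rev/=; apply: eq_big_nat => m /andP[m1 mq]; congr (_%:R^-1).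
    by rewrite add1n subSS subKn// ltnW.
  have h : \sum_(1 <= m < q) (m%:R^-1 : R) <= K%:R.
    apply: le_trans (harmonic_le K); rewrite [leRHS](big_cat_nat q0 qK)/= lerDl.
    by apply: sumr_ge0 => m _; rewrite invr_ge0.
  have -> : q%:R * (4 * K%:R) = 2 * q%:R * (K%:R + K%:R) :> R by ring.
  by rewrite ler_wpM2l ?mulr_ge0// lerD.
by rewrite ler_pM2l in q1.
Qed.

Lemma gph_prefix p n : \sum_(0 <= l < n) gph p l =
  (n %/ q)%:R * gsum p + \sum_(0 <= l < n %% q) gph p l.
Proof.
have block b r : \sum_(0 <= l < b * q + r) gph p l = b%:R * gsum p + \sum_(0 <= l < r) gph p l.
  elim: b => [|b IH]; first by rewrite mul0r add0r mul0n add0n.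
  rewrite mulSn -addnA (big_cat_nat (n := q)) ?leq_addr//=.
  have := big_addn 0 (q + (b * q + r)) q xpredT (gph p) (op := +%R) (idx := 0 : C).
  rewrite add0n addKn => ->.
  under [X in _ + X]eq_bigr do rewrite gph_per.
  by rewrite IH -natr1 -/(gsum p); ring.
by rewrite {1}(divn_eq n q) block.
Qed.

(** The sum is a difference of two prefixes, each made of complete periods and one incomplete sum. b
    counts the complete periods, hence lies within 1 of H/q. *)
Lemma gauss_main p (a H : nat) : exists b : R, exists er : C,
  [/\ \sum_(a <= l < a + H) gph p l = rc b * gsum p + er,
      H%:R / q%:R - 1 <= b <= H%:R / q%:R + 1 & cabs er <= 2 * gerr].
Proof.
have aH : (a <= a + H)%N by exact: leq_addr.
have e1 := gph_prefix p (a + H); have e2 := gph_prefix p a.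
have := big_cat_nat (op := +%R) (idx := 0 : C) (F := gph p) (P := xpredT) (leq0n a) aH.
rewrite e1 e2 => e3.
exists (((a + H) %/ q)%:R - (a %/ q)%:R).
exists (\sum_(0 <= l < (a + H) %% q) gph p l - \sum_(0 <= l < a %% q) gph p l); split.
- rewrite rcD rcN !rc_nat.
  set S := \sum_(a <= l < _) _ in e3 *.
  have -> : S = ((a + H) %/ q)%:R * gsum p + \sum_(0 <= l < (a + H) %% q) gph p l -
     ((a %/ q)%:R * gsum p + \sum_(0 <= l < a %% q) gph p l).
    by rewrite e3 [X in X - _]addrC addrK.
  ring.
- have := divn_eq (a + H) q; have := divn_eq a q.
  have := ltn_pmod a q0; have := ltn_pmod (a + H) q0.
  set d1 := ((a + H) %/ q)%N; set r1 := ((a + H) %% q)%N; set d2 := (a %/ q)%N; set r2 := (a %% q)%N.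
  move=> h1 h2 h3 h4.
  have h5 : a%:R = d2%:R * q%:R + r2%:R :> R by rewrite h3 natrD natrM.
  have h6 : a%:R + H%:R = d1%:R * q%:R + r1%:R :> R by rewrite -natrD h4 natrD natrM.
  have h7 : r1%:R <= q%:R :> R by rewrite ler_nat ltnW.
  have h8 : r2%:R <= q%:R :> R by rewrite ler_nat ltnW.
  have h9 : 0 <= r1%:R :> R by [].
  have h10 : 0 <= r2%:R :> R by [].
  apply/andP; split.
    rewrite lerBlDr ler_pdivrMr//; nra.
  rewrite -lerBlDr ler_pdivlMr//; nra.
- apply: le_trans (cabsD _ _) _; rewrite cabsN.
  have -> : 2 * gerr = gerr + gerr by ring.
  by rewrite lerD// incomplete_le// ltnW// ltn_pmod.
Qed.

Lemma gerr_ge : Num.sqrt (2 * q%:R) <= gerr.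
Proof. by rewrite /gerr ler_peMr ?sqrtr_ge0// lerDl mulr_ge0. Qed.

Lemma gauss_upper p a H :
  cabs (\sum_(a <= l < a + H) gph p l) <= H%:R / q%:R * Num.sqrt (2 * q%:R) + 3 * gerr.
Proof.
have [b [er [-> /andP[b1 b2] her]]] := gauss_main p a H.
apply: le_trans (cabsD _ _) _; rewrite cabsM cabs_rc.
have s0 := sqrtr_ge0 (2 * q%:R : R).
have gle := gsum_le p; have gg := gerr_ge.
have HQ : 0 <= H%:R / q%:R :> R by rewrite divr_ge0.
have bb : `|b| <= H%:R / q%:R + 1 by rewrite ler_norml; apply/andP; split; lra.
have : `|b| * cabs (gsum p) <= (H%:R / q%:R + 1) * Num.sqrt (2 * q%:R).
  by rewrite ler_pM ?cabs_ge0.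
lra.
Qed.

Lemma gauss_lower p a H : (forall u : nat, q = u.*2 -> (2 %| p - p1 * u%:Z)%Z) ->
  H%:R / q%:R * Num.sqrt q%:R - 3 * gerr <= cabs (\sum_(a <= l < a + H) gph p l).
Proof.
move=> adm; have [b [er [-> /andP[b1 b2] her]]] := gauss_main p a H.
have := cabs_le_sub (rc b * gsum p) (rc b * gsum p + er).
rewrite opprD addrA subrr add0r cabsN cabsM cabs_rc => h.
have s0 := sqrtr_ge0 (2 * q%:R : R).
have gle := gsum_le p; have gge := gsum_ge adm; have gg := gerr_ge.
have HQ : 0 <= H%:R / q%:R :> R by rewrite divr_ge0.
have c0 := cabs_ge0 (gsum p).
have : (H%:R / q%:R - 1) * cabs (gsum p) <= `|b| * cabs (gsum p).
  by rewrite ler_wpM2r// (le_trans b1)// ler_norm.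
have : H%:R / q%:R * Num.sqrt q%:R <= H%:R / q%:R * cabs (gsum p) by rewrite ler_wpM2l.
lra.
Qed.

End modq.
End Gauss.

(** * Gauss sums with slowly varying coefficients *)

Section WeightedGauss.
Variable R : realType.
Local Notation C := R[i].
Variables (q : nat) (q0 : (0 < q)%N) (p1 : int) (cop : coprimez p1 q%:Z).
Variables (K : nat) (qK : (q <= 2 ^ K)%N).
Let qR : 0 < q%:R :> R. Proof. by rewrite ltr0n. Qed.

(** Put X = (L/q) sqrt q. The factor 45 keeps the incomplete sums below X/10, so the constant part
    ka of the coefficients contributes at least (9/10) ka X, while Abel summation bounds the part
    a_l - ka by (8/5) X (2 ka/10). *)
Lemma gauss_weighted (p : int) (lo L : nat) (a : nat -> C) (ka eps : R) :
  (forall u : nat, q = u.*2 -> (2 %| p - p1 * u%:Z)%Z) ->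
  0 < ka -> 0 <= eps <= ka / 10 ->
  45 * (1 + 4 * K%:R) <= L%:R / q%:R :> R ->
  (forall l, (lo <= l < lo + L)%N -> cabs (a l - rc ka) <= eps) ->
  \sum_(lo <= l < (lo + L).-1) cabs (a l.+1 - a l) <= eps ->
  ka / 2 * (L%:R / q%:R * Num.sqrt q%:R) <=
  cabs (\sum_(lo <= l < lo + L) a l * gph R q p1 p l).
Proof.
move=> adm ka0 /andP[e0 eka] hL ha hv.
have L0 : (0 < L)%N.
  rewrite lt0n; apply/eqP => L0; move: hL; rewrite L0 mul0r.
  by have : 0 <= K%:R :> R by []; lra.
set X := L%:R / q%:R * Num.sqrt q%:R.
have sq0 : 0 <= Num.sqrt q%:R :> R by exact: sqrtr_ge0.
have LQ0 : 0 <= L%:R / q%:R :> R by rewrite divr_ge0.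
have X0 : 0 <= X by rewrite mulr_ge0.
have s2 : Num.sqrt (2 * q%:R) <= 3 / 2 * Num.sqrt q%:R :> R.
  rewrite sqrtrM// ler_wpM2r//.
  have -> : 3 / 2 = Num.sqrt ((3 / 2) ^+ 2) :> R by rewrite sqrtr_sqr ger0_norm//; lra.
  by rewrite ler_wsqrtr//; lra.
have ge3 : 3 * gerr R q K <= X / 10.
  rewrite /gerr /X.
  have h1 : Num.sqrt (2 * q%:R) * (1 + 4 * K%:R) <= 3 / 2 * Num.sqrt q%:R * (1 + 4 * K%:R) :> R.
    by rewrite ler_wpM2r// addr_ge0// mulr_ge0.
  have h2 : 45 * (1 + 4 * K%:R) * Num.sqrt q%:R <= L%:R / q%:R * Num.sqrt q%:R :> R.
    by rewrite ler_wpM2r.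
  lra.
pose f l := gph R q p1 p (l + lo).
have shift (F : nat -> C) H : \sum_(lo <= l < lo + H) F l = \sum_(0 <= l < H) F (l + lo)%N.
  by have := big_addn 0 (lo + H) lo xpredT F (op := +%R) (idx := 0 : C); rewrite add0n addKn.
have hup j : (j <= L)%N -> cabs (\sum_(0 <= l < j) f l) <= 8 / 5 * X.
  move=> jL; rewrite -shift.
  apply: le_trans (gauss_upper R q0 cop qK p lo j) _.
  have h1 : j%:R / q%:R * Num.sqrt (2 * q%:R) <= L%:R / q%:R * (3 / 2 * Num.sqrt q%:R) :> R.
    by rewrite ler_pM// ?divr_ge0 ?sqrtr_ge0// ler_pM2r ?invr_gt0// ler_nat.
  have -> : 8 / 5 * X = L%:R / q%:R * (3 / 2 * Num.sqrt q%:R) + X / 10 by rewrite /X; field; rewrite gt_eqF.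
  exact: lerD.
have hlo := gauss_lower R q0 cop qK lo L adm.
rewrite -/X in hlo.
rewrite !shift in hlo *.
have -> : \sum_(0 <= l < L) a (l + lo)%N * gph R q p1 p (l + lo) =
   rc ka * \sum_(0 <= l < L) f l + \sum_(0 <= l < L) (a (l + lo)%N - rc ka) * f l.
  rewrite mulr_sumr -big_split/=; apply: eq_bigr => l _; rewrite /f; ring.
set A := rc ka * _; set B := \sum_(0 <= l < L) (_ - _) * _.
have hA : cabs A = ka * cabs (\sum_(0 <= l < L) f l) by rewrite cabsM cabs_rc gtr0_norm.
have hB : cabs B <= 8 / 5 * X * (2 * eps).
  rewrite /B -(prednK L0).
  apply: le_trans (abel_le (fun l => a (l + lo)%N - rc ka) (f := f) (X := 8 / 5 * X) _) _.
    by move=> j jL; apply: hup; rewrite -(prednK L0).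
  rewrite ler_wpM2l; last 2 first.
  - by rewrite mulr_ge0//; lra.
  - rewrite (_ : 2 * eps = eps + eps); last by ring.
    apply: lerD; first by apply: ha; rewrite leq_addl/= addnC ltn_add2l prednK.
    apply: le_trans hv; have -> : (lo + L).-1 = (lo + L.-1)%N by rewrite -{1}(prednK L0) addnS.
    have := big_addn 0 (lo + L.-1) lo xpredT (fun l => cabs (a l.+1 - a l)) (op := +%R) (idx := 0 : R).
    rewrite add0n addKn => ->; rewrite le_eqVlt; apply/orP; left; apply/eqP.
    by apply: eq_bigr => l _; congr cabs; rewrite addSn; ring.
  by [].
have := cabs_le_sub A (A + B); rewrite opprD addrA subrr add0r cabsN hA => hAB.
have : ka * (X - X / 10) <= ka * cabs (\sum_(0 <= l < L) f l).
  rewrite ler_wpM2l//; first exact: ltW.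
  by apply: le_trans hlo; lra.
have : 8 / 5 * X * (2 * eps) <= 8 / 5 * X * (2 * (ka / 10)).
  by rewrite ler_wpM2l//; lra.
nra.
Qed.
End WeightedGauss.

(** * Lower bounds for the one-dimensional factors of the evolution *)

Section Profiles.
Variable R : realType.
Local Notation C := R[i].
Local Notation mu := (@lebesgue_measure R).
Variable phi : R -> R.
Hypothesis iphi : mu.-integrable setT (EFin \o phi).
Hypothesis cphi : continuous phi.
Local Notation Phi := (ft1 phi).
Hypothesis supp : forall eta, 1 <= `|eta| -> Phi eta = 0.
Hypothesis phi0 : phi 0 = 1.
Local Notation B := (ft1_l1 phi).
Local Notation ka := (kap R).

Definition hfirst (r xi : R) : C := rc ((Num.sqrt r)^-1) * Phi ((xi - r) / Num.sqrt r).
Definition hcomb (D : R) (lo hi : nat) (xi : R) : C := \sum_(lo <= l < hi) Phi (xi - D * l%:R).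
Definition osc (t x xi : R) : C := expi (- (pi * t * xi ^+ 2) + 2 * pi * x * xi).

Lemma measurable_osc_phase (t x : R) :
  measurable_fun setT (fun xi : R => - (pi * t * xi ^+ 2) + 2 * pi * x * xi).
Proof.
apply: measurable_funD; first exact: measurable_chirp.
exact: measurable_funM.
Qed.

Lemma cmeas_osc t x : cmeas setT (osc t x).
Proof. by apply: cmeas_expi; exact: measurable_osc_phase. Qed.

Lemma cint_ft1 : cint setT Phi = rc ka.
Proof.
have := fourier_inversion iphi cphi supp 0; rewrite phi0 mulr1 => <-.
by apply: eq_cint => eta _; rewrite mulr0 mul0r expi0 mulr1.
Qed.

Lemma ft1_l1_ge_kap : ka <= B.
Proof.
have k0 := @kap_gt0 R.
rewrite -(gtr0_norm k0) -cabs_rc -cint_ft1.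
by apply: cabs_cint_le => //; exact: cintegrable_ft1.
Qed.

(** By inversion at 0 the integral of Phi is kap phi(0) = kap, and on the support of Phi a phase
    bounded by M changes the integrand by at most M |Phi|. *)
Lemma cint_ft1_phase (th : R -> R) (M : R) : measurable_fun setT th ->
  (forall eta, `|eta| <= 1 -> `|th eta| <= M) ->
  cabs (cint setT (fun eta => Phi eta * expi (th eta)) - rc ka) <= M * B.
Proof.
move=> mth hM; rewrite -cint_ft1 -cintB//; last 2 first.
- exact: cintegrable_ft1_expi.
- exact: cintegrable_ft1.
rewrite /ft1_l1 -RintegralZl//; last by apply: integrable_cabs => //; exact: cintegrable_ft1.
apply: cabs_cint_dom => //.
- by apply: cmeasB; [apply: cmeasM; [exact: cmeas_ft1|exact: cmeas_expi]|exact: cmeas_ft1].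
- by apply: rint_mul => //; apply: integrable_cabs => //; exact: cintegrable_ft1.
move=> eta _; have [h|h] := leP `|eta| 1; last first.
  by rewrite (supp (ltW h)) mul0r subr0 cabs0 mulr0.
rewrite -[X in _ - X]mulr1 -mulrBr cabsM mulrC ler_wpM2r ?cabs_ge0//.
by rewrite -expi0; apply: le_trans (expi_lip _ _) _; rewrite subr0 hM.
Qed.

(** The substitution xi = s^2 + s eta with s = sqrt r splits off a constant phase and leaves the
    curvature t r and the slope sqrt r (x - t r) in eta. *)
Lemma hfirst_phase (s t x xi : R) : s != 0 ->
  - (pi * t * (s ^+ 2) ^+ 2) + 2 * pi * x * s ^+ 2 +
  (- (pi * (t * s ^+ 2) * (s^-1 * xi + - s ^+ 2 / s) ^+ 2) +
   2 * pi * (s * (x - t * s ^+ 2)) * (s^-1 * xi + - s ^+ 2 / s)) =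
  - (pi * t * xi ^+ 2) + 2 * pi * x * xi.
Proof. by move=> s0; field. Qed.

Lemma cint_hfirst (r t x : R) : 0 < r ->
  cint setT (fun xi => hfirst r xi * osc t x xi) =
  expi (- (pi * t * r ^+ 2) + 2 * pi * x * r) *
  cint setT (fun eta => Phi eta * expi (- (pi * (t * r) * eta ^+ 2) +
                                        2 * pi * (Num.sqrt r * (x - t * r)) * eta)).
Proof.
move=> r0; have s0 := sqrtr_neq0 r0; have s1 := sqrtr_ge0 r.
have s2 : Num.sqrt r ^+ 2 = r by rewrite sqr_sqrtr// ltW.
have mph : measurable_fun setT (fun eta : R => - (pi * (t * r) * eta ^+ 2) +
    2 * pi * (Num.sqrt r * (x - t * r)) * eta).
  by apply: measurable_funD; [exact: measurable_chirp|exact: measurable_funM].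
have ig : cintegrable setT (fun eta => expi (- (pi * t * r ^+ 2) + 2 * pi * x * r) *
    (Phi eta * expi (- (pi * (t * r) * eta ^+ 2) + 2 * pi * (Num.sqrt r * (x - t * r)) * eta))).
  by apply: cintegrableZ => //; exact: cintegrable_ft1_expi.
have is0 : (Num.sqrt r)^-1 != 0 by rewrite invr_eq0.
have gE xi : expi (- (pi * t * r ^+ 2) + 2 * pi * x * r) *
    (Phi ((Num.sqrt r)^-1 * xi + - r / Num.sqrt r) *
     expi (- (pi * (t * r) * ((Num.sqrt r)^-1 * xi + - r / Num.sqrt r) ^+ 2) +
       2 * pi * (Num.sqrt r * (x - t * r)) * ((Num.sqrt r)^-1 * xi + - r / Num.sqrt r))) =
    Phi ((xi - r) / Num.sqrt r) * osc t x xi.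
  rewrite mulrCA; congr (Phi _ * _); first by field.
  rewrite /osc -expiD; congr expi; rewrite -(hfirst_phase t x xi s0).
  by rewrite !s2.
have := cint_affine (- r / Num.sqrt r) is0 ig.
rewrite normfV invrK (ger0_norm s1) => e.
rewrite -cintZ//; last exact: cintegrable_ft1_expi.
apply: (mulfI (rc_neq0 s0)); rewrite -e -cintZ//; last first.
  have := cintegrableZ (rc ((Num.sqrt r)^-1)) measurableT (cintegrable_affine (- r / Num.sqrt r) is0 ig).
  by apply: eq_cintegrable => // xi _; rewrite gE /hfirst -mulrA.
by apply: eq_cint => xi _; rewrite gE /hfirst mulrA mulrA -rcM divff// rc1 mul1r.
Qed.

(** The phase in eta is small when t r is small and x lies within a small multiple of r^(-1/2) of t
    r, which is the long side of the slabs. *)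
Lemma hfirst_lower (r t x : R) : 0 < r ->
  ka - pi * (`|t * r| + 2 * (Num.sqrt r * `|x - t * r|)) * B <=
  cabs (cint setT (fun xi => hfirst r xi * osc t x xi)).
Proof.
move=> r0; rewrite cint_hfirst// cabsM cabs_expi mul1r.
have k0 := @kap_gt0 R; have s0 := sqrtr_ge0 r.
set I := cint _ _.
have h : cabs (I - rc ka) <= pi * (`|t * r| + 2 * (Num.sqrt r * `|x - t * r|)) * B.
  apply: cint_ft1_phase.
    by apply: measurable_funD; [exact: measurable_chirp|exact: measurable_funM].
  move=> eta e1; apply: le_trans (ler_normD _ _) _.
  have p0 := @pi_gt0 R.
  have e2 : `|eta ^+ 2| <= 1 by rewrite normrX exprn_ile1.
  have h1 : `|pi * (t * r) * eta ^+ 2| <= pi * `|t * r|.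
    by rewrite 2!normrM (gtr0_norm p0) ler_piMr// mulr_ge0// ltW.
  have h2 : `|2 * pi * (Num.sqrt r * (x - t * r)) * eta| <= 2 * pi * (Num.sqrt r * `|x - t * r|).
    have b0 : 0 <= 2 * pi * (Num.sqrt r * `|x - t * r|) by rewrite !mulr_ge0// ltW.
    rewrite [X in X <= _]normrM [X in X * _ <= _]normrM (normrM (Num.sqrt r)) (ger0_norm s0).
    by rewrite (gtr0_norm (@twopi_gt0 R)) ler_piMr.
  rewrite normrN; lra.
have := cabs_le_sub (rc ka) I; rewrite cabs_rc (gtr0_norm k0) cabsB; lra.
Qed.

Lemma cintegrable_shift (c : R) (th : R -> R) : measurable_fun setT th ->
  cintegrable setT (fun xi => Phi (xi - c) * expi (th xi)).
Proof.
move=> mth.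
have n1 : (1 : R) != 0 by exact: oner_neq0.
apply: (@cintegrableM_bnd _ _ _ _ 1) => //.
- have := cintegrable_affine (- c) n1 (cintegrable_ft1 iphi cphi supp).
  by apply: eq_cintegrable => // x _; rewrite mul1r.
- exact: cmeas_expi.
- by move=> x _; rewrite cabs_expi.
Qed.

(** Galilean covariance: a frequency shift by w moves the position to x - t w. *)
Lemma cint_shift (t x w : R) :
  cint setT (fun xi => Phi (xi - w) * osc t x xi) =
  expi (- (pi * t * w ^+ 2) + 2 * pi * x * w) *
  cint setT (fun eta => Phi eta * expi (- (pi * t * eta ^+ 2) + 2 * pi * (x - t * w) * eta)).
Proof.
have n1 : (1 : R) != 0 by exact: oner_neq0.
have mph : measurable_fun setT (fun eta : R => - (pi * t * eta ^+ 2) + 2 * pi * (x - t * w) * eta).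
  exact: measurable_osc_phase.
have ig := cintegrable_ft1_expi iphi cphi supp mph.
have := cint_affine (- w) n1 (cintegrableZ (expi (- (pi * t * w ^+ 2) + 2 * pi * x * w)) measurableT ig).
have e2 := cintZ (expi (- (pi * t * w ^+ 2) + 2 * pi * x * w)) measurableT ig.
rewrite normr1 invr1 rc1 mul1r e2 => <-; apply: eq_cint => xi _.
rewrite mul1r mulrCA; congr (_ * _); rewrite /osc -expiD; congr expi; ring.
Qed.

Section second.
Variables (D r t x : R) (lo L : nat).
Hypotheses (D0 : 0 < D) (r1 : 1 <= r) (t0 : 0 <= t).
Hypothesis hiD : forall l, (lo <= l < lo + L)%N -> D * l%:R <= r.
Hypothesis LD : L%:R * D <= r.
Variables (q : nat) (q0 : (0 < q)%N) (p1 p : int) (cop : coprimez p1 q%:Z).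
Variables (K : nat) (qK : (q <= 2 ^ K)%N).
Hypothesis adm : forall u : nat, q = u.*2 -> (2 %| p - p1 * u%:Z)%Z.
Hypothesis tq : t * D ^+ 2 = 2 * p1%:~R / q%:R.
Variables (dl : R).
Hypothesis xdl : x = p%:~R / (D * q%:R) + dl.

Let A (l : nat) : C := cint setT (fun eta => Phi eta *
  expi (- (pi * t * eta ^+ 2) + 2 * pi * (x - t * (D * l%:R)) * eta)).
Let a (l : nat) : C := expi (2 * pi * (dl * (D * l%:R))) * A l.

(** At the frequency D l, the choice of t and the centre p/(D q) turn the phase into 2 pi (p l - p1
    l^2)/q. The deviation [dl] from the centre and the profile of one tooth go into the coefficient
    [a l]. *)
Lemma hcomb_gauss :
  cint setT (fun xi => hcomb D lo (lo + L) xi * osc t x xi) =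
  \sum_(lo <= l < lo + L) a l * gph R q p1 p l.
Proof.
transitivity (cint setT (fun xi => \sum_(lo <= l < lo + L) Phi (xi - D * l%:R) * osc t x xi)).
  by apply: eq_cint => xi _; rewrite /hcomb mulr_suml.
rewrite cint_sum//; last first.
  by move=> l _; apply: cintegrable_shift; exact: measurable_osc_phase.
apply: eq_bigr => l _; rewrite cint_shift /a -/(A l) [RHS]mulrAC; congr (_ * _).
rewrite /gph /eqz -expiD; congr expi.
have qn : q%:R != 0 :> R by rewrite pnatr_eq0 -lt0n.
have Dn : D != 0 by rewrite gt_eqF.
rewrite xdl.
have -> : pi * t * (D * l%:R) ^+ 2 = pi * (t * D ^+ 2) * l%:R ^+ 2 by ring.
rewrite tq intrB !intrM -[l%:Z%:~R]/(l%:R); field; by rewrite qn Dn.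
Qed.

Lemma A_le l : cabs (A l) <= B.
Proof.
have := @cabs_cint_le R setT _ measurableT (cintegrable_ft1_expi iphi cphi supp
  (measurable_osc_phase t (x - t * (D * l%:R)))).
move=> h; apply: le_trans h _; rewrite /ft1_l1 le_eqVlt; apply/orP; left; apply/eqP.
by apply: eq_Rintegral => eta _; rewrite cabsM cabs_expi mulr1.
Qed.

(** The coefficients stay within eps of kap because all frequencies D l are at most r, and their
    total variation is at most eps because each increment is proportional to D and L D <= r. *)
Lemma hcomb_lower (eps : R) :
  pi * (2 * (`|dl| * r) + 3 * (t * r) + 2 * `|x|) * B <= eps -> eps <= ka / 10 ->
  45 * (1 + 4 * K%:R) <= L%:R / q%:R :> R ->
  ka / 2 * (L%:R / q%:R * Num.sqrt q%:R) <=
  cabs (cint setT (fun xi => hcomb D lo (lo + L) xi * osc t x xi)).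
Proof.
move=> he eka hL; rewrite hcomb_gauss.
have p0 := @pi_gt0 R; have k0 := @kap_gt0 R.
have B0 : 0 <= B by exact: ft1_l1_ge0.
have r0 : 0 < r by exact: lt_le_trans ltr01 r1.
have tr0 : 0 <= t * r by rewrite mulr_ge0// ltW.
have ttr : t <= t * r by rewrite ler_peMr.
have dr0 : 0 <= `|dl| * r by rewrite mulr_ge0// ltW.
apply: (@gauss_weighted _ _ q0 _ cop _ qK p lo L a ka eps) => //.
- rewrite eka andbT; apply: le_trans he; rewrite !mulr_ge0 ?(ltW p0)//.
  by have := normr_ge0 x; lra.
- move=> l lr; have Dl := hiD lr.
  have Dl0 : 0 <= D * l%:R by rewrite mulr_ge0// ltW.
  apply: le_trans (cabs_distD (A l) _ _) _.
  have h1 : cabs (A l - rc ka) <= pi * (t + 2 * (`|x| + t * r)) * B.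
    apply: cint_ft1_phase; first exact: measurable_osc_phase.
    move=> eta e1; apply: le_trans (ler_normD _ _) _.
    have e2 : `|eta ^+ 2| <= 1 by rewrite normrX exprn_ile1.
    have e3 : `|x - t * (D * l%:R)| <= `|x| + t * r.
      apply: le_trans (ler_normB _ _) _; rewrite lerD2l (ger0_norm (mulr_ge0 t0 Dl0)).
      by rewrite ler_wpM2l.
    have pt0 : 0 <= pi * t by rewrite mulr_ge0// ltW.
    have pp0 : 0 <= 2 * pi :> R by rewrite mulr_ge0// ltW.
    rewrite normrN (normrM (pi * t)) (normrM (2 * pi * (x - t * (D * l%:R)))).
    rewrite (normrM (2 * pi) (x - t * (D * l%:R))) (ger0_norm pt0) (ger0_norm pp0).
    have h1 : pi * t * `|eta ^+ 2| <= pi * t by rewrite ler_piMr// mulr_ge0// ltW.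
    have h2 : 2 * pi * `|x - t * (D * l%:R)| * `|eta| <= 2 * pi * (`|x| + t * r).
      apply: (@le_trans _ _ (2 * pi * `|x - t * (D * l%:R)|)).
        by rewrite ler_piMr// !mulr_ge0// ltW.
      by rewrite ler_wpM2l// mulr_ge0// ltW.
    lra.
  have h2 : cabs (a l - A l) <= pi * (2 * (`|dl| * r)) * B.
    rewrite /a -{2}[A l]mul1r -mulrBl cabsM ler_pM ?cabs_ge0 ?A_le//.
    rewrite -expi0; apply: le_trans (expi_lip _ _) _.
    rewrite subr0 3!normrM (gtr0_norm p0) (ger0_norm (ler0n _ 2)) (ger0_norm Dl0).
    have : `|dl| * (D * l%:R) <= `|dl| * r by rewrite ler_wpM2l.
    nra.
  apply: le_trans (lerD h2 h1) _; apply: le_trans he.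
  rewrite -mulrDl -mulrDr ler_wpM2r// ler_wpM2l ?(ltW p0)//; lra.
have step l : cabs (a l.+1 - a l) <= pi * (2 * ((`|dl| + t) * D)) * B.
  apply: le_trans (cabs_distD (expi (2 * pi * (dl * (D * l.+1%:R))) * A l) _ _) _.
  have -> : pi * (2 * ((`|dl| + t) * D)) * B = pi * (2 * (t * D)) * B + pi * (2 * (`|dl| * D)) * B by ring.
  apply: lerD.
    rewrite /a -mulrBr cabsM cabs_expi mul1r /A -cintB//; last 2 first.
    - by apply: cintegrable_ft1_expi => //; exact: measurable_osc_phase.
    - by apply: cintegrable_ft1_expi => //; exact: measurable_osc_phase.
    rewrite /ft1_l1 -RintegralZl//; last by apply: integrable_cabs => //; exact: cintegrable_ft1.
    apply: cabs_cint_dom => //.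
    + by apply: cmeasB; apply: cmeasM; try exact: cmeas_ft1;
        apply: cmeas_expi; exact: measurable_osc_phase.
    + by apply: rint_mul => //; apply: integrable_cabs => //; exact: cintegrable_ft1.
    move=> eta _; have [h|h] := leP `|eta| 1; last first.
      by rewrite (supp (ltW h)) !mul0r subr0 cabs0 mulr0.
    rewrite -mulrBr cabsM mulrC ler_wpM2r ?cabs_ge0//.
    apply: le_trans (expi_lip _ _) _.
    have -> : - (pi * t * eta ^+ 2) + 2 * pi * (x - t * (D * l.+1%:R)) * eta -
      (- (pi * t * eta ^+ 2) + 2 * pi * (x - t * (D * l%:R)) * eta) =
      - (pi * (2 * (t * D)) * eta) by rewrite -[l.+1%:R]natr1; ring.
    rewrite normrN normrM ger0_norm; last by rewrite !mulr_ge0// ltW.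
    by rewrite ler_piMr// !mulr_ge0// ltW.
  rewrite /a -mulrBl cabsM ler_pM ?cabs_ge0 ?A_le//.
  apply: le_trans (expi_lip _ _) _.
  have -> : 2 * pi * (dl * (D * l.+1%:R)) - 2 * pi * (dl * (D * l%:R)) = pi * (2 * (dl * D)).
    by rewrite -[l.+1%:R]natr1; ring.
  by rewrite 3!normrM (gtr0_norm p0) (ger0_norm (ler0n _ 2)) (gtr0_norm D0).
apply: (@le_trans _ _ (\sum_(lo <= l < (lo + L).-1) pi * (2 * ((`|dl| + t) * D)) * B)).
  by apply: ler_sum => l _; exact: step.
rewrite sumr_const_nat -[X in X <= _]mulr_natl.
have s0 : 0 <= pi * (2 * ((`|dl| + t) * D)) * B.
  by rewrite (mulr_ge0 (mulr_ge0 (ltW p0) (mulr_ge0 (ler0n _ 2) (mulr_ge0 (addr_ge0 (normr_ge0 dl) t0) (ltW D0)))) B0).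
apply: (@le_trans _ _ (L%:R * (pi * (2 * ((`|dl| + t) * D)) * B))).
  by rewrite ler_wpM2r// ler_nat leq_subLR leq_pred.
have -> : L%:R * (pi * (2 * ((`|dl| + t) * D)) * B) = pi * (2 * ((`|dl| + t) * (L%:R * D))) * B by ring.
apply: le_trans he; rewrite ler_wpM2r// ler_wpM2l ?(ltW p0)//.
have : (`|dl| + t) * (L%:R * D) <= (`|dl| + t) * r by rewrite ler_wpM2l// addr_ge0.
have := normr_ge0 x; lra.
Qed.
End second.

End Profiles.

(** * A band-pass filter in time *)

Section TimeFilter.
Variable R : realType.
Local Notation C := R[i].
Local Notation mu := (@lebesgue_measure R).

(** Convolution in t with K acts on the frequencies y as multiplication by the transform of K at the
    sum of the pi y_i^2. Each induction step moves one oscillation into the kernel, which is why K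
    is quantified inside. *)
Lemma filter_tensor (t : R) (h : nat -> R -> C) (x : nat -> R) (M : nat -> R) (lam : C) m :
  (forall i, cintegrable setT (h i)) ->
  (forall i, cmeas setT (fun s => cint setT (fun xi => h i xi * osc s (x i) xi))) ->
  (forall i s, cabs (cint setT (fun xi => h i xi * osc s (x i) xi)) <= M i) ->
  forall K : R -> C, cintegrable setT K ->
  (forall y : nat -> R, (forall i, (i < m)%N -> h i (y i) != 0) ->
     cint setT (fun s => K s * expi (s * \sum_(0 <= i < m) pi * y i ^+ 2)) = lam) ->
  cint setT (fun s => K s *
     \prod_(0 <= i < m) cint setT (fun xi => h i xi * osc (t - s) (x i) xi)) =
  lam * \prod_(0 <= i < m) cint setT (fun xi => h i xi * osc t (x i) xi).
Proof.
move=> ih mv bv; elim: m => [|m IH] K iK hK.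
  rewrite !big_geq// mulr1 -(hK (fun=> 0))//; apply: eq_cint => s _.
  by rewrite !big_geq// mulr0 expi0.
pose v i s := cint setT (fun xi => h i xi * osc s (x i) xi).
have mvt i : cmeas setT (fun s : R => v i (t - s)).
  apply: (@cmeas_comp _ _ _ (v i) (fun s : R => t - s)); first exact: mv.
  have := measurable_affine (-1) t.
  by congr measurable_fun; apply/funext => s; ring.
pose P s := K s * \prod_(0 <= i < m) v i (t - s).
have iP : cintegrable setT P.
  apply: (@cintegrableM_bnd _ _ _ _ (\prod_(0 <= i < m) M i)) => //.
    by apply: cmeas_prod => i _; exact: mvt.
  move=> s _; rewrite cabs_prod; apply: ler_prod => i _.
  by rewrite cabs_ge0/=; exact: bv.
have iq : cintegrable setT (fun xi => h m xi * osc t (x m) xi).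
  apply: (@cintegrableM_bnd _ _ _ _ 1) => //; first exact: cmeas_osc.
  by move=> xi _; rewrite /osc cabs_expi.
transitivity (cint setT (fun s => P s * cint setT (fun xi =>
    h m xi * osc t (x m) xi * expi (s * (pi * xi ^+ 2))))).
  apply: eq_cint => s _; rewrite big_nat_recr//= /P -mulrA; congr (_ * (_ * _)).
  apply: eq_cint => xi _; rewrite -mulrA; congr (_ * _).
  by rewrite /osc -expiD; congr expi; ring.
rewrite cint_swap_expi//; last first.
  by apply: measurable_funM => //; exact: measurable_funX.
rewrite big_nat_recr//= -/(v _ _).
transitivity (cint setT (fun xi => lam * \prod_(0 <= i < m) v i t * (h m xi * osc t (x m) xi))).
  apply: eq_cint => xi _; have [->|hx] := eqVneq (h m xi) 0; first by rewrite !(mul0r, mulr0).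
  rewrite mulrC; congr (_ * _).
  rewrite -(IH (fun s => K s * expi (s * (pi * xi ^+ 2)))).
  - by apply: eq_cint => s _; rewrite /P; ring.
  - apply: (@cintegrableM_bnd _ _ _ _ 1) => //; last by move=> s _; rewrite cabs_expi.
    by apply: cmeas_expi; exact: measurable_funM.
  - move=> y hy; rewrite -(hK (fun i => if i == m then xi else y i)); last first.
      move=> i; rewrite ltnS leq_eqVlt; case: eqVneq => [-> //|_ /= im]; exact: hy.
    apply: eq_cint => s _; rewrite -mulrA -expiD big_nat_recr//= eqxx.
    congr (_ * expi _); rewrite -mulrDr addrC; congr (_ * (_ + _)).
    by apply: eq_big_nat => i /andP[_ im]; rewrite ltn_eqF.
by rewrite cintZ// mulrA.
Qed.

(** A de la Vallee Poussin kernel, that is, a normalised difference of two Fejer kernels, modulated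
    by c. Its transform is a trapezoid: 1 up to distance A from the centre and 0 from distance B
    on. *)
Definition filt (c A B s : R) : C :=
  rc ((jker B s - jker A s) / (@JC R * (B - A))) * expi (c * s).

Lemma filt_meas c A B : cmeas setT (filt c A B).
Proof.
apply: cmeasM; last by apply: cmeas_expi; exact: measurable_funM.
apply: cmeas_rc; apply: measurable_funM => //.
by apply: measurable_funB; exact: measurable_jker.
Qed.

Section filt.
Variables (c A B : R).
Hypothesis (A0 : 0 < A) (AB : A < B).

Let JB : 0 < @JC R * (B - A). Proof. by rewrite mulr_gt0 ?JC_gt0// subr_gt0. Qed.

Lemma cabs_filt s : cabs (filt c A B s) <= (jker B s + jker A s) / (@JC R * (B - A)).
Proof.
rewrite cabsM cabs_expi mulr1 cabs_rc normrM (gtr0_norm (x := _^-1)) ?invr_gt0//.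
rewrite ler_wpM2r ?invr_ge0 ?(ltW JB)//.
apply: le_trans (ler_normB _ _) _.
by rewrite !ger0_norm ?jker_ge0.
Qed.

Lemma integrable_filt_dom :
  mu.-integrable setT (EFin \o (fun s => (jker B s + jker A s) / (@JC R * (B - A)))).
Proof.
have := @rint_mul R setT _ (@JC R * (B - A))^-1 measurableT
  (rint_add measurableT (integrable_jker B) (integrable_jker A)).
by apply: eq_integrable => // s _ /=; rewrite mulrC.
Qed.

Lemma cintegrable_filt : cintegrable setT (filt c A B).
Proof.
apply: cintegrable_dom integrable_filt_dom _ => //; first exact: filt_meas.
by move=> s _; exact: cabs_filt.
Qed.

Lemma filt_l1 : \int[mu]_s ((jker B s + jker A s) / (@JC R * (B - A))) = (B + A) / (B - A).
Proof.
under eq_Rintegral => s _ do rewrite mulrC.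
rewrite RintegralZl//; last exact: rint_add (integrable_jker B) (integrable_jker A).
rewrite RintegralD//; try exact: integrable_jker.
rewrite !Rintegral_jker (gtr0_norm A0) (gtr0_norm (lt_trans A0 AB)) -mulrDr.
by field; rewrite gt_eqF ?subr_gt0//= gt_eqF// JC_gt0.
Qed.

Lemma filt_dom_decay s : s != 0 ->
  (jker B s + jker A s) / (@JC R * (B - A)) <= 4 / (@JC R * (B - A) * s ^+ 2).
Proof.
move=> s0; have s2 : 0 < s ^+ 2 by rewrite exprn_even_gt0.
rewrite [in X in _ <= X]invfM mulrA mulrAC ler_wpM2r ?invr_ge0 ?(ltW JB)//.
rewrite ler_pdivlMr// mulrDl; have := jker_le_inv A s; have := jker_le_inv B s; lra.
Qed.

Lemma cint_filt om :
  cint setT (fun s => filt c A B s * expi (s * om)) =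
  rc ((tri B (c + om) - tri A (c + om)) / (B - A)).
Proof.
transitivity (cint setT (fun s => rc (@JC R * (B - A))^-1 *
    (rc (jker B s) * expi ((c + om) * s) - rc (jker A s) * expi ((c + om) * s)))).
  apply: eq_cint => s _; rewrite /filt -mulrA -expiD mulrC -mulrBl rcM rcD rcN.
  rewrite (_ : c * s + s * om = (c + om) * s); last by ring.
  ring.
have i1 a := cintegrable_jker_expi a (c + om).
rewrite cintZ//; last first.
  have := cintegrableD measurableT (i1 B) (cintegrableZ (-1) measurableT (i1 A)).
  by apply: eq_cintegrable => // s _; rewrite mulN1r.
rewrite cintB// !cint_jker_expi -rcN -rcD -rcM; congr rc.
by field; rewrite gt_eqF ?subr_gt0//= gt_eqF// JC_gt0.
Qed.

Lemma tri_in (a w : R) : 0 < a -> `|w| <= a -> tri a w = a - `|w|.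
Proof.
move=> a0; rewrite ler_norml => /andP[h1 h2]; rewrite /tri ger0_norm; last lra.
by rewrite ger0_norm; lra.
Qed.

Lemma tri_out (a w : R) : 0 < a -> a <= `|w| -> tri a w = 0.
Proof.
move=> a0 h; have -> : w = a * (w / a) by field; rewrite gt_eqF.
by rewrite tri_scale// tri1_supp ?mulr0// normrM normfV (gtr0_norm a0) ler_pdivlMr// mul1r.
Qed.

Lemma cint_filt_in om : `|c + om| <= A -> cint setT (fun s => filt c A B s * expi (s * om)) = 1.
Proof.
move=> h; rewrite cint_filt !tri_in//; last 2 first.
- exact: lt_trans AB.
- exact: le_trans h (ltW AB).
by rewrite (_ : _ / _ = 1) ?rc1//; field; rewrite gt_eqF ?subr_gt0.
Qed.

Lemma cint_filt_out om : B <= `|c + om| -> cint setT (fun s => filt c A B s * expi (s * om)) = 0.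
Proof.
move=> h; rewrite cint_filt !tri_out//; last 2 first.
- exact: le_trans (ltW AB) h.
- exact: lt_trans AB.
by rewrite subrr mul0r rc0.
Qed.

End filt.

Section band.
Variables (n : nat) (n2 : (2 <= n)%N).
Let nR : 2 <= n%:R :> R. Proof. by rewrite ler_nat. Qed.

(* The k-th summand lives where |xi|^2 / r^2 lies in [(n+2)/4, n+1/4], r = 2^k.  These bands
   are separated, for distinct k, by the transition zones of this trapezoidal multiplier. *)
Definition bandf (r : R) : R -> C :=
  filt (- (pi * r ^+ 2 * ((5 * n%:R + 3) / 8))) (pi * r ^+ 2 * ((3 * n%:R - 1) / 8))
       (pi * r ^+ 2 * ((3 * n%:R + 1) / 8)).
Definition bandf_dom (r s : R) : R :=
  (jker (pi * r ^+ 2 * ((3 * n%:R + 1) / 8)) s + jker (pi * r ^+ 2 * ((3 * n%:R - 1) / 8)) s) /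
  (@JC R * (pi * r ^+ 2 * ((3 * n%:R + 1) / 8) - pi * r ^+ 2 * ((3 * n%:R - 1) / 8))).

Variable r : R.
Hypothesis r0 : 0 < r.
Let p0 : 0 < pi :> R. Proof. exact: pi_gt0. Qed.
Let pr0 : 0 < pi * r ^+ 2. Proof. by rewrite mulr_gt0// exprn_gt0. Qed.
Let A0 : 0 < pi * r ^+ 2 * ((3 * n%:R - 1) / 8). Proof. by rewrite (mulr_gt0 pr0)// divr_gt0//; move: nR; lra. Qed.
Let AB : pi * r ^+ 2 * ((3 * n%:R - 1) / 8) < pi * r ^+ 2 * ((3 * n%:R + 1) / 8).
Proof. by rewrite ltr_pM2l//; lra. Qed.

Lemma cintegrable_bandf : cintegrable setT (bandf r).
Proof. exact: cintegrable_filt. Qed.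

Lemma cabs_bandf s : cabs (bandf r s) <= bandf_dom r s.
Proof. exact: cabs_filt. Qed.

Lemma integrable_bandf_dom : mu.-integrable setT (EFin \o bandf_dom r).
Proof. exact: integrable_filt_dom. Qed.

(** The ratio (B + A)/(B - A) is invariant under scaling: the L^1 bound is the same for all k. *)
Lemma bandf_dom_l1 : \int[mu]_s bandf_dom r s = 3 * n%:R.
Proof. rewrite /bandf_dom filt_l1//.
move: (pi : R) p0 => P P0; field.
rewrite (_ : _ - _ = 2 * (P * r ^+ 2)); last by ring.
by rewrite !mulf_neq0// ?expf_neq0// gt_eqF. Qed.

Lemma bandf_dom_decay s : s != 0 -> bandf_dom r s <= 16 / (@JC R * pi) / (r * s) ^+ 2.
Proof.
move=> s0; apply: le_trans (filt_dom_decay AB s0) _.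
rewrite le_eqVlt; apply/orP; left; apply/eqP.
move: (pi : R) p0 => P P0; field.
have JC0 := @JC_gt0 R; rewrite (_ : _ - _ = 2 * (P * r ^+ 2)); last by ring.
by rewrite s0 !gt_eqF//= mulr_gt0// mulr_gt0// exprn_gt0.
Qed.

Lemma bandf_dom_ge0 s : 0 <= bandf_dom r s.
Proof.
rewrite divr_ge0 ?addr_ge0 ?jker_ge0//.
by rewrite mulr_ge0 ?subr_ge0 ?(ltW AB)// ltW// JC_gt0.
Qed.

(** The constant may depend on r and t; it will only multiply a tail of the series. *)
Lemma bandf_dom_wt t : exists2 c, 0 <= c & forall tau, bandf_dom r (t - tau) <= c * wt tau.
Proof.
pose A := pi * r ^+ 2 * ((3 * n%:R - 1) / 8); pose B := pi * r ^+ 2 * ((3 * n%:R + 1) / 8).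
have JB : 0 < @JC R * (B - A) by rewrite mulr_gt0 ?JC_gt0// subr_gt0 AB.
have h c tau : jker c (t - tau) * (1 + tau ^+ 2) <= (1 + 2 * t ^+ 2) * (c ^+ 2 / 2) + 4.
  have j0 := jker_ge0 c (t - tau); have j1 := jker_le c (t - tau).
  have j2 := jker_le_inv c (t - tau).
  have e : 1 + tau ^+ 2 <= 1 + 2 * t ^+ 2 + 2 * (t - tau) ^+ 2.
    have := sqr_ge0 (2 * t - tau); nra.
  apply: le_trans (ler_wpM2l j0 e) _; rewrite mulrDr lerD//.
    by rewrite mulrC ler_wpM2l// addr_ge0// mulr_ge0// sqr_ge0.
  by rewrite mulrCA; lra.
exists (((1 + 2 * t ^+ 2) * (B ^+ 2 / 2) + 4 + ((1 + 2 * t ^+ 2) * (A ^+ 2 / 2) + 4)) / (@JC R * (B - A))) => [|tau].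
  rewrite divr_ge0 ?(ltW JB)// !addr_ge0// mulr_ge0 ?divr_ge0 ?sqr_ge0//;
    by rewrite addr_ge0// mulr_ge0// sqr_ge0.
have w1 : 0 < 1 + tau ^+ 2 by rewrite ltr_pwDl// sqr_ge0.
rewrite /wt ler_pdivlMr// /bandf_dom -/A -/B mulrAC ler_wpM2r ?invr_ge0 ?(ltW JB)//.
by rewrite mulrDl lerD.
Qed.

(** Off (0,d) the distance from tau to t is at least t, with r t >= c0, and for tau >= d >= 2t it is
    at least tau/2. The resulting constant is independent of r, hence of k. *)
Lemma bandf_dom_out c0 t d tau : 0 < c0 <= 1 -> c0 <= r * t -> 0 < t -> 2 * t <= d -> 3 <= r ->
  3 <= r * d -> ~~ (0 < tau < d) ->
  bandf_dom r (t - tau) <= 16 / (@JC R * pi) / c0 ^+ 2 * wt tau.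
Proof.
move=> /andP[c00 c01] crt t0 td r3 rd ht.
have J0 : 0 <= 16 / (@JC R * pi) by rewrite divr_ge0// mulr_ge0// ltW// JC_gt0.
have w1 : 0 < 1 + tau ^+ 2 by rewrite ltr_pwDl// sqr_ge0.
have s0 : t - tau != 0.
  by apply: contra ht; rewrite subr_eq0 => /eqP <-; apply/andP; split; lra.
apply: le_trans (bandf_dom_decay s0) _.
rewrite /wt -[X in _ <= X]mulrA ler_wpM2l// -invfM lef_pV2 ?posrE; last 2 first.
- by rewrite exprn_even_gt0//= mulf_neq0// gt_eqF.
- by rewrite mulr_gt0// exprn_gt0.
have rt2 : c0 ^+ 2 <= (r * t) ^+ 2 by apply: lerXn2r; rewrite ?nnegrE//; lra.
have c2 : c0 ^+ 2 <= 1 by rewrite expr_le1// ltW.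
have t20 := sqr_ge0 tau.
have [h|h] := leP tau 0.
  apply: (@le_trans _ _ ((r * t) ^+ 2 + r ^+ 2 * tau ^+ 2)).
    by rewrite mulrDr mulr1 lerD// ler_wpM2r//; apply: le_trans c2 _; apply: exprn_ege1; lra.
  rewrite -exprMn (_ : _ + _ = r ^+ 2 * (t ^+ 2 + tau ^+ 2)); last by ring.
  by rewrite exprMn ler_wpM2l ?sqr_ge0//; nra.
have htau : d <= tau by rewrite leNgt; apply: contra ht => hd; rewrite h hd.
have h2 : tau ^+ 2 / 4 <= (t - tau) ^+ 2.
  rewrite (_ : _ / 4 = (tau / 2) ^+ 2); last by field.
  by rewrite -[X in _ <= X]sqrrN opprB; apply: lerXn2r; rewrite ?nnegrE; lra.
have h3 : 1 + tau ^+ 2 <= (r * (t - tau)) ^+ 2.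
  apply: (@le_trans _ _ (r ^+ 2 * (tau ^+ 2 / 4))); last by rewrite exprMn ler_wpM2l ?sqr_ge0.
  have g1 : 9 <= (r * tau) ^+ 2.
    rewrite (_ : 9 = 3 ^+ 2); last by ring.
    apply: lerXn2r; rewrite ?nnegrE//; first by rewrite mulr_ge0//; lra.
    by apply: le_trans rd _; rewrite ler_wpM2l//; lra.
  have g2 : 9 * tau ^+ 2 <= r ^+ 2 * tau ^+ 2.
    rewrite ler_wpM2r// (_ : 9 = 3 ^+ 2); last by ring.
    by apply: lerXn2r; rewrite ?nnegrE; lra.
  by move: g1 g2; rewrite exprMn; lra.
by apply: le_trans h3; rewrite ler_piMl// ltW.
Qed.

Lemma bandf_in om : (n%:R + 2) / 4 * r ^+ 2 <= om <= (n%:R + 1 / 4) * r ^+ 2 ->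
  cint setT (fun s => bandf r s * expi (s * (pi * om))) = 1.
Proof.
move=> /andP[h1 h2]; apply: cint_filt_in => //.
rewrite (_ : - (pi * r ^+ 2 * ((5 * n%:R + 3) / 8)) + pi * om = pi * (om - r ^+ 2 * ((5 * n%:R + 3) / 8))); last by ring.
rewrite normrM (gtr0_norm p0) -mulrA ler_pM2l// ler_norml; apply/andP; split; lra.
Qed.

Lemma bandf_out om : om <= (n%:R + 1) / 4 * r ^+ 2 \/ (n%:R + 1 / 2) * r ^+ 2 <= om ->
  cint setT (fun s => bandf r s * expi (s * (pi * om))) = 0.
Proof.
move=> h; apply: cint_filt_out => //.
rewrite (_ : - (pi * r ^+ 2 * ((5 * n%:R + 3) / 8)) + pi * om = pi * (om - r ^+ 2 * ((5 * n%:R + 3) / 8))); last by ring.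
rewrite normrM (gtr0_norm p0) -mulrA ler_pM2l// ler_normr; case: h => h; apply/orP; [right|left]; lra.
Qed.

End band.
End TimeFilter.

(** * The summands f^(k) and the truncated solution *)

Section Summands.
Variable R : realType.
Local Notation C := R[i].
Local Notation mu := (@lebesgue_measure R).
Variable phi : R -> R.
Hypothesis iphi : mu.-integrable setT (EFin \o phi).
Hypothesis cphi : continuous phi.
Local Notation Phi := (ft1 phi).
Hypothesis supp : forall eta, 1 <= `|eta| -> Phi eta = 0.
Hypothesis phi0 : phi 0 = 1.

Lemma Phi_neq0 eta : Phi eta != 0 -> `|eta| < 1.
Proof. by apply: contraNT; rewrite -leNgt => /supp ->. Qed.

Lemma cmeas_hfirst r : cmeas setT (hfirst phi r).
Proof.
apply: cmeasM; first exact: cmeas_cst.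
apply: (@cmeas_comp _ _ _ Phi (fun xi : R => (xi - r) / Num.sqrt r)).
  exact: cmeas_ft1.
have := measurable_affine (Num.sqrt r)^-1 (- r / Num.sqrt r).
by congr measurable_fun; apply/funext => x; ring.
Qed.

Lemma cmeas_hcomb D lo hi : cmeas setT (hcomb phi D lo hi).
Proof.
apply: cmeas_sum => l _.
apply: (@cmeas_comp _ _ _ Phi (fun xi : R => xi - D * l%:R)); first exact: cmeas_ft1.
have := measurable_affine 1 (- (D * l%:R)).
by congr measurable_fun; apply/funext => x; ring.
Qed.

Lemma hfirst_supp r xi : 0 < r -> hfirst phi r xi != 0 -> `|xi - r| < Num.sqrt r.
Proof.
move=> r0; have s0 : 0 < Num.sqrt r by rewrite sqrtr_gt0.
rewrite /hfirst mulf_eq0 negb_or => /andP[_ /Phi_neq0].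
by rewrite normrM normfV (gtr0_norm s0) ltr_pdivrMr// mul1r.
Qed.

Lemma hcomb_supp r D xi : 0 < r -> 0 < D -> hcomb phi D (comb_lo (r / D)) (comb_hi (r / D)) xi != 0 ->
  r / 2 - 1 < xi < r + 1.
Proof.
move=> r0 D0 h; have X0 : 0 <= r / D by rewrite divr_ge0// ltW.
have [l lr hl] : exists2 l, (comb_lo (r / D) <= l < comb_hi (r / D))%N & Phi (xi - D * l%:R) != 0.
  apply: contrapT => hn; move/negP: h; apply; apply/eqP.
  rewrite /hcomb big1_seq// => l; rewrite mem_index_iota/= => lr.
  by apply: contrapT => /eqP hl; apply: hn; exists l.
move: lr; rewrite -comb_loP// -comb_hiP// => /andP[].
rewrite ltr_pdivlMr// (_ : r / D / 2 = r / 2 / D); last by ring.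
rewrite ltr_pdivrMr// => l1 l2.
by move/Phi_neq0: hl; rewrite ltr_norml => /andP[h1 h2]; apply/andP; split; lra.
Qed.

Lemma hfirst_bound r xi : 1 <= r -> cabs (hfirst phi r xi) <= l1norm phi.
Proof.
move=> r1; have s1 : 1 <= Num.sqrt r by rewrite -sqrtr1 ler_sqrt// ?ler01// (le_trans ler01).
have s0 := lt_le_trans ltr01 s1.
rewrite cabsM cabs_rc gtr0_norm ?invr_gt0//.
apply: le_trans (ft1_le iphi ((xi - r) / Num.sqrt r)).
by rewrite ler_piMl ?cabs_ge0// invf_le1.
Qed.

(* At each frequency at most one tooth of the comb is active. *)
Lemma hcomb_bound D lo hi xi : 2 <= D -> cabs (hcomb phi D lo hi xi) <= l1norm phi.
Proof.
move=> D2; have [[l lr hl]|hn] := pselect (exists2 l, (lo <= l < hi)%N & Phi (xi - D * l%:R) != 0).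
  rewrite /hcomb (bigD1_seq l) ?mem_index_iota ?iota_uniq//= big1_seq ?addr0; first exact: ft1_le.
  move=> j /andP[jl _]; apply: supp; move/Phi_neq0: hl => hl.
  have h1 : 1 <= `|j%:R - l%:R : R|.
    have key u w : (u < w)%N -> 1 <= `|w%:R - u%:R : R|.
      by move=> uw; rewrite -natrB ?(ltnW uw)// normr_nat ler1n subn_gt0.
    by move: jl; rewrite neq_ltn => /orP[/key|/key//]; rewrite distrC.
  have : D * `|j%:R - l%:R| <= `|xi - D * l%:R| + `|xi - D * j%:R|.
    have -> : D * `|j%:R - l%:R| = `|(xi - D * l%:R) - (xi - D * j%:R)|.
      by rewrite -[X in X * _](@ger0_norm _ D) ?(le_trans _ D2)// -normrM; congr `|_|; ring.
    exact: ler_normB.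
  nra.
rewrite /hcomb big1_seq ?cabs0 ?l1norm_ge0// => l; rewrite mem_index_iota/= => lr.
by apply: contrapT => /eqP hl; apply: hn; exists l.
Qed.

Lemma cintegrable_hfirst r : 0 < r -> cintegrable setT (hfirst phi r).
Proof.
move=> r0; apply: cintegrableZ => //.
have s0 : (Num.sqrt r)^-1 != 0 by rewrite invr_eq0 sqrtr_neq0.
have := cintegrable_affine (- r / Num.sqrt r) s0 (cintegrable_ft1 iphi cphi supp).
by apply: eq_cintegrable => // x _; congr Phi; ring.
Qed.

Lemma cintegrable_hcomb D lo hi : cintegrable setT (hcomb phi D lo hi).
Proof.
apply: cintegrable_sum => // l _.
have := cintegrable_affine (- (D * l%:R)) (oner_neq0 R) (cintegrable_ft1 iphi cphi supp).
by apply: eq_cintegrable => // x _; congr Phi; ring.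
Qed.

Lemma Rintegral_subset (A : set R) (f : R -> R) : measurable A ->
  mu.-integrable setT (EFin \o f) -> (forall x, 0 <= f x) ->
  \int[mu]_(x in A) f x <= \int[mu]_x f x.
Proof.
move=> mA fi f0; apply: fine_le.
- by apply: integrable_fin_num => //; apply: integrableS fi.
- exact: integrable_fin_num.
- apply: ge0_subset_integral => //; last by move=> x _; rewrite lee_fin.
  by case/integrableP: fi.
Qed.

Lemma l2sq_le N (h : R -> C) (A : R) : cmeas setT h -> cintegrable setT h ->
  (forall x, cabs (h x) <= A) -> l2sq N h <= A * \int[mu]_x cabs (h x).
Proof.
move=> mh ih hA; have A0 : 0 <= A := le_trans (cabs_ge0 _) (hA 0).
have ic := integrable_cabs measurableT ih.
have ig := rint_mul A measurableT ic.
have le x : cabs (h x) ^+ 2 <= A * cabs (h x) by rewrite expr2 ler_wpM2r ?cabs_ge0.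
have iq : mu.-integrable setT (EFin \o (fun x => cabs (h x) ^+ 2)).
  apply: le_integrable ig => //.
    by apply/measurable_EFinP; apply: measurable_funX; exact: cmeas_cabs.
  move=> x _ /=; rewrite lee_fin ger0_norm ?sqr_ge0//.
  by rewrite ger0_norm// mulr_ge0// cabs_ge0.
rewrite -RintegralZl//; apply: (@le_trans _ _ (\int[mu]_x (cabs (h x) ^+ 2))).
  by apply: Rintegral_subset => // x; exact: sqr_ge0.
exact: le_Rintegral.
Qed.

Lemma l2sq_hfirst N r : 1 <= r -> l2sq N (hfirst phi r) <= l1norm phi * ft1_l1 phi / Num.sqrt r.
Proof.
move=> r1; have r0 := lt_le_trans ltr01 r1; have s0 : 0 < Num.sqrt r by rewrite sqrtr_gt0.
have is0 : (Num.sqrt r)^-1 != 0 by rewrite invr_eq0 sqrtr_neq0.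
have ip := integrable_cabs measurableT (cintegrable_ft1 iphi cphi supp).
apply: le_trans (@l2sq_le N _ (l1norm phi / Num.sqrt r) (cmeas_hfirst r) (cintegrable_hfirst r0) _) _.
  move=> x; rewrite cabsM cabs_rc gtr0_norm ?invr_gt0// mulrC ler_wpM2r ?invr_ge0 ?(ltW s0)//.
  exact: ft1_le.
rewrite -mulrA -[X in _ <= X]mulrA ler_wpM2l ?l1norm_ge0// [X in _ <= X]mulrC ler_wpM2l ?invr_ge0 ?(ltW s0)//.
rewrite [X in X <= _](_ : _ =
  \int[mu]_x ((Num.sqrt r)^-1 * cabs (Phi ((Num.sqrt r)^-1 * x + - r / Num.sqrt r)))); last first.
  apply: eq_Rintegral => x _; rewrite cabsM cabs_rc gtr0_norm ?invr_gt0//.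
  by congr (_ * cabs (Phi _)); ring.
rewrite RintegralZl//; last exact: (integrable_affine _ is0 ip).
rewrite (Rintegral_affine _ is0 ip) gtr0_norm ?invr_gt0// invrK mulrA mulVf ?mul1r//.
exact: sqrtr_neq0.
Qed.

Lemma rint_sum (I : Type) (s : seq I) (F : I -> R -> R) :
  (forall i, mu.-integrable setT (EFin \o F i)) ->
  mu.-integrable setT (EFin \o (fun x => \sum_(i <- s) F i x)) /\
  \int[mu]_x (\sum_(i <- s) F i x) = \sum_(i <- s) \int[mu]_x F i x.
Proof.
move=> iF; elim: s => [|i s [IH1 IH2]].
  split; last by rewrite big_nil; under eq_Rintegral => x _ do rewrite big_nil; rewrite Rintegral_cst// mul0r.
  by apply: (@eq_integrable _ _ _ mu setT _ (fun=> 0%E)) => [//|x _ /=|]; rewrite ?big_nil//; exact: integrable0.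
split.
  have := rint_add measurableT (iF i) IH1.
  by apply: eq_integrable => // x _ /=; rewrite big_cons.
rewrite big_cons; under eq_Rintegral => x _ do rewrite big_cons.
by rewrite RintegralD// IH2.
Qed.

Lemma l2sq_hcomb N D lo hi : 2 <= D ->
  l2sq N (hcomb phi D lo hi) <= l1norm phi * ((hi - lo)%:R * ft1_l1 phi).
Proof.
move=> D2; have ip := integrable_cabs measurableT (cintegrable_ft1 iphi cphi supp).
have isl l : mu.-integrable setT (EFin \o (fun x => cabs (Phi (x - D * l%:R)))).
  have := integrable_affine (- (D * l%:R)) (oner_neq0 R) ip.
  by apply: eq_integrable => // x _ /=; rewrite mul1r.
apply: le_trans (@l2sq_le N _ _ (cmeas_hcomb D lo hi) (cintegrable_hcomb D lo hi)
  (fun x => hcomb_bound lo hi x D2)) _.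
rewrite ler_wpM2l ?l1norm_ge0//.
have -> : (hi - lo)%:R * ft1_l1 phi = \sum_(lo <= l < hi) \int[mu]_x cabs (Phi (x - D * l%:R)).
  have h l : \int[mu]_x cabs (Phi (x - D * l%:R)) = ft1_l1 phi.
    have := Rintegral_affine (- (D * l%:R)) (oner_neq0 R) ip.
    rewrite normr1 invr1 mul1r /ft1_l1 => <-; apply: eq_Rintegral => x _; by rewrite mul1r.
  under eq_bigr do rewrite h.
  by rewrite big_const_nat iter_addr_0 mulr_natl.
have [isum <-] := rint_sum (index_iota lo hi) isl.
apply: le_Rintegral => //; first exact: (integrable_cabs measurableT (cintegrable_hcomb D lo hi)).
by move=> x _; exact: cabs_sum.
Qed.

End Summands.

(** * Factorised form of the summands and of the truncated solution *)

Section Evolution.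
Variable R : realType.
Local Notation C := R[i].
Local Notation mu := (@lebesgue_measure R).
Variables (n : nat) (a b : R) (phi : R -> R).
Hypothesis n2 : (2 <= n)%N.
Hypothesis iphi : mu.-integrable setT (EFin \o phi).
Hypothesis cphi : continuous phi.
Local Notation Phi := (ft1 phi).
Hypothesis supp : forall eta, 1 <= `|eta| -> Phi eta = 0.
Hypothesis phi0 : phi 0 = 1.

Local Notation Rk := (@Rk R).
Local Notation D := (Dk n a b).
Let X k := Rk k / D k.
Definition teeth k := (comb_hi (Rk k / D k) - comb_lo (Rk k / D k))%N.

Definition hk (k i : nat) : R -> C :=
  if i == 0 then hfirst phi (Rk k) else hcomb phi (D k) (comb_lo (Rk k / D k)) (comb_hi (Rk k / D k)).

Lemma Rk_gt0 k : 0 < Rk k. Proof. by rewrite exprn_gt0. Qed.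
Lemma Dk_gt0 k : 0 < D k. Proof. by rewrite powR_gt0// Rk_gt0. Qed.
Let X0 k : 0 <= X k. Proof. by rewrite divr_ge0// ltW// ?Rk_gt0 ?Dk_gt0. Qed.

Lemma Rk_ge1 k : 1 <= Rk k. Proof. by rewrite exprn_ege1// ler1n. Qed.

Definition fphys (k i : nat) (x : R) : C :=
  if i == 0 then expi (2 * pi * Rk k * x) * rc (phi (Num.sqrt (Rk k) * x))
  else rc (phi x) * comb (D k) (comb_lo (Rk k / D k)) (comb_hi (Rk k / D k)) x.

Lemma fk_row k (y : nat -> R) :
  fk n phi a b k (\row_(i < n) y i) = \prod_(0 <= i < n) fphys k i (y i).
Proof.
rewrite /fk /fD cd_row ?(ltn_trans _ n2)// [RHS]big_ltn ?(ltn_trans _ n2)// /fphys/=.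
congr (_ * _); apply: eq_big_nat => j /andP[j0 jn]; rewrite cd_row// gtn_eqF//.
congr (_ * _); rewrite /comb -comb_bigE//; last exact: X0.
apply: eq_big => // l; congr (_ && _).
by rewrite (_ : _ / (2 * _) = Rk k / D k / 2)// invfM; ring.
Qed.

Lemma cintegrable_fphys k i : cintegrable setT (fphys k i).
Proof.
rewrite /fphys; case: (i == 0); first by apply: cintegrable_first => //; exact: Rk_gt0.
exact: cintegrable_phi_comb.
Qed.

Lemma fourier_fk k (xi : 'rV[R]_n) :
  fourier (fk n phi a b k) xi = \prod_(0 <= i < n) hk k i (cd xi i).
Proof.
rewrite /fourier (@rn_int_tensor1 _ n (fun i x => fphys k i x * expi (- (2 * pi * x * cd xi i)))).
- apply: eq_big_nat => i /andP[_ iln]; rewrite /fphys /hk; case: ifP => _.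
    exact: ft_first (Rk_gt0 k).
  by rewrite ft_comb.
- by [].
- move=> i iln; apply: (@cintegrableM_bnd _ _ _ _ 1) => //; first exact: cintegrable_fphys.
    apply: cmeas_expi; have := measurable_affine (- (2 * pi * cd xi i)) 0.
    by congr measurable_fun; apply/funext => x; ring.
  by move=> x _; rewrite cabs_expi.
- move=> y _; rewrite fk_row big_split/=; congr (_ * _).
  rewrite /dotv -expi_sum; congr expi; rewrite mulr_sumr -sumrN big_mkord.
  apply: eq_bigr => i _; rewrite mxE /cd insubT//= => p.
  rewrite mulrA; congr (- (_ * _)).
  by congr (xi _ _); exact: val_inj.
Qed.

Lemma cabs_fphys_le k i x : cabs (fphys k i x) <= (1 + (teeth k)%:R) * (ft1_l1 phi / kap R).
Proof.
have B0 : 0 <= ft1_l1 phi / kap R by rewrite divr_ge0 ?ft1_l1_ge0// ltW// kap_gt0.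
rewrite /fphys; case: ifP => _; rewrite cabsM.
  rewrite cabs_expi mul1r cabs_rc; apply: le_trans (phi_bounded iphi cphi supp _) _.
  by rewrite ler_peMl// lerDl.
rewrite cabs_rc mulrC ler_pM ?cabs_ge0 ?(phi_bounded iphi cphi supp)//.
apply: le_trans (cabs_sum _ _ _) _.
under eq_bigr do rewrite cabs_expi.
by rewrite big_const_nat iter_addr_0 /teeth lerDr.
Qed.

Lemma l2norm_fk k : 2 <= D k -> l2norm (fk n phi a b k) =
  Num.sqrt ((Num.sqrt (Rk k))^-1 * phi_m2 phi * ((teeth k)%:R * phi_m2 phi) ^+ n.-1).
Proof.
move=> D2; rewrite /l2norm; congr Num.sqrt.
rewrite (@rn_int_tensor1 _ n (fun i x => rc (cabs (fphys k i x) ^+ 2))).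
- rewrite big_ltn ?(ltn_trans _ n2)//= {1}/fphys/= l2_first ?Rk_gt0//.
  rewrite (eq_big_nat _ _ (F2 := fun=> rc ((teeth k)%:R * phi_m2 phi))); last first.
    by move=> i /andP[i0 _]; rewrite /fphys (gtn_eqF i0) comb_l2.
  by rewrite big_const_nat iter_mulr_1 subn1 -rcX -rcM.
- by [].
- move=> i _; apply: cintegrable_rc.
  have ic := integrable_cabs measurableT (cintegrable_fphys k i).
  have := rint_mul ((1 + (teeth k)%:R) * (ft1_l1 phi / kap R)) measurableT ic.
  apply: le_integrable => //.
    apply/measurable_EFinP; apply: measurable_funX; apply: cmeas_cabs.
    by case: (cintegrable_meas (cintegrable_fphys k i)).
  move=> x _ /=; rewrite lee_fin ger0_norm ?sqr_ge0// expr2.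
  by rewrite (le_trans _ (ler_norm _))// ler_wpM2r ?cabs_ge0// cabs_fphys_le.
- by move=> y _; rewrite fk_row cabs_prod -rc_prod prodrXl.
Qed.

Variable k0 : nat.
Hypothesis good : forall k, (k0 <= k)%N -> [/\ (2 <= k)%N, 2 <= D k & 4 <= Rk k / D k].

(** The coefficient of f^(k) in g, extended by 0 below k0 so that all sums may start at 0. *)
Definition cf (k : nat) : R :=
  if (k0 <= k)%N then Rk k `^ (- sexp n a b) * k%:R / l2norm (fk n phi a b k) else 0.

Lemma Rk_ge4 k : (2 <= k)%N -> 4 <= Rk k.
Proof.
move=> k2; rewrite /Defs.Rk (_ : 4 = 2 ^+ 2); last by ring.
by rewrite ler_weXn2l// ler1n.
Qed.

Lemma sqrt_Rk_le k : (2 <= k)%N -> Num.sqrt (Rk k) <= Rk k / 2.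
Proof.
move=> /Rk_ge4 h; have s0 := sqrtr_ge0 (Rk k).
have e : Num.sqrt (Rk k) ^+ 2 = Rk k by rewrite sqr_sqrtr// ltW// Rk_gt0.
have : 2 <= Num.sqrt (Rk k).
  rewrite (_ : 2 = Num.sqrt (2 ^+ 2)); last by rewrite sqrtr_sqr ger0_norm.
  by rewrite ler_sqrt ?Rk_gt0//; lra.
nra.
Qed.

Lemma hk_supp0 k xi : (2 <= k)%N -> hk k 0 xi != 0 -> `|xi - Rk k| < Num.sqrt (Rk k).
Proof. by move=> k2; exact: (hfirst_supp supp (Rk_gt0 k)). Qed.

Lemma hk_suppS k i xi : (0 < i)%N -> hk k i xi != 0 -> Rk k / 2 - 1 < xi < Rk k + 1.
Proof. by move=> i0; rewrite /hk gtn_eqF//; apply: hcomb_supp => //; rewrite ?Rk_gt0 ?Dk_gt0. Qed.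

Lemma hk_supp k i xi : (2 <= k)%N -> hk k i xi != 0 -> 0 <= xi <= 2 ^+ k.+1.
Proof.
move=> k2 h; have r4 := Rk_ge4 k2; rewrite exprS -/(Rk k).
case: i h => [|i] h.
  have := sqrt_Rk_le k2; have := hk_supp0 k2 h; rewrite ltr_norml => /andP[h1 h2] h3.
  by apply/andP; split; lra.
by have /andP[h1 h2] := hk_suppS (ltn0Sn i) h; apply/andP; split; lra.
Qed.

Lemma cmeas_hk k i : cmeas setT (hk k i).
Proof. by rewrite /hk; case: ifP => _; [exact: cmeas_hfirst|exact: cmeas_hcomb]. Qed.

Lemma cintegrable_hk k i : cintegrable setT (hk k i).
Proof.
rewrite /hk; case: ifP => _; last exact: cintegrable_hcomb.
by apply: cintegrable_hfirst => //; exact: Rk_gt0.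
Qed.

Lemma hk_bound k i xi : 2 <= D k -> cabs (hk k i xi) <= l1norm phi.
Proof.
move=> D2; rewrite /hk; case: ifP => _; last exact: hcomb_bound.
by apply: hfirst_bound => //; exact: Rk_ge1.
Qed.

Lemma cintegrable_hk_osc k i t x : cintegrable setT (fun xi => hk k i xi * osc t x xi).
Proof.
apply: (@cintegrableM_bnd _ _ _ _ 1) => //; first exact: cintegrable_hk.
  exact: cmeas_osc.
by move=> xi _; rewrite cabs_expi.
Qed.

Lemma gterm_hatE k xi : (k0 <= k)%N ->
  gterm_hat n phi a b k xi = rc (cf k) * \prod_(0 <= i < n) hk k i (cd xi i).
Proof. by move=> kk; rewrite /gterm_hat fourier_fk /cf kk. Qed.

(** The first factor of the k-th summand lives above R_k/2, so no k > J contributes where xi_1 <=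
    2^J, and the limits in [ghat] are those of eventually constant sequences. *)
Lemma ghat_cube J (xi : 'rV[R]_n) : cd xi 0 <= 2 ^+ J ->
  ghat n phi a b k0 xi = \sum_(0 <= k < J.+1) rc (cf k) * \prod_(0 <= i < n) hk k i (cd xi i).
Proof.
move=> xJ; set S := RHS.
have e N : (maxn J.+1 k0 <= N)%N -> \sum_(k0 <= k < N) gterm_hat n phi a b k xi = S.
  rewrite geq_max => /andP[JN kN].
  transitivity (\sum_(0 <= k < N) rc (cf k) * \prod_(0 <= i < n) hk k i (cd xi i)).
    rewrite [RHS](big_cat_nat (n := k0))//= [X in _ = X + _]big_nat_cond [X in _ = X + _]big1 ?add0r.
      by apply: eq_big_nat => k /andP[kk _]; rewrite gterm_hatE.
    by move=> k /andP[/andP[_ kk] _]; rewrite /cf leqNgt kk/= rc0 mul0r.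
  rewrite (big_cat_nat (n := J.+1))//= [X in _ + X]big_nat_cond [X in _ + X]big1 ?addr0// => k /andP[/andP[Jk _] _].
  have [kk|kk] := leqP k0 k; last by rewrite /cf leqNgt kk/= rc0 mul0r.
  have [k2 _ _] := good kk.
  rewrite big_ltn ?(ltn_trans _ n2)//.
  have [->|h] := eqVneq (hk k 0 (cd xi 0)) 0; first by rewrite mul0r mulr0.
  have := sqrt_Rk_le k2; have := hk_supp0 k2 h; rewrite ltr_norml => /andP[h1 h2] h3.
  have : 2 ^+ J.+1 <= Rk k by rewrite /Defs.Rk ler_weXn2l// ler1n.
  by rewrite exprS => h4; exfalso; lra.
have reS (I : Type) (s : seq I) (F : I -> C) : \sum_(i <- s) complex.Re (F i) = complex.Re (\sum_(i <- s) F i).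
  by rewrite cRe_sum.
have imS (I : Type) (s : seq I) (F : I -> C) : \sum_(i <- s) complex.Im (F i) = complex.Im (\sum_(i <- s) F i).
  by rewrite cIm_sum.
apply: complex_ext => /=; apply: lim_near_cst => //; near=> N.
  by rewrite reS e//; near: N; exact: nbhs_infty_ge.
by rewrite imS e//; near: N; exact: nbhs_infty_ge.
Unshelve. all: by end_near. Qed.

(** On a cube each summand stays a product of one-dimensional integrals. *)
Lemma schr_truncE J t (x : 'rV[R]_n) (N : R) : N / 2 <= 2 ^+ J ->
  schr_trunc (ghat n phi a b k0) t x N =
  \sum_(0 <= k < J.+1) rc (cf k) *
    \prod_(0 <= i < n) cint `[- (N / 2), N / 2] (fun xi => hk k i xi * osc t (cd x i) xi).
Proof.
move=> NJ; rewrite /schr_trunc.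
apply: (@rn_int_tensor _ n _ (index_iota 0 J.+1) (fun k => rc (cf k))
  (fun k i xi => hk k i xi * osc t (cd x i) xi)).
- by move=> j _; exact: measurable_itv.
- move=> k j _ _; apply: cintegrableS (cintegrable_hk_osc k j t (cd x j)) => //.
- move=> y hy; rewrite (@ghat_cube J); last first.
    rewrite cd_row ?(ltn_trans _ n2)//; apply: le_trans NJ.
    by have := hy 0%N (ltnW n2); rewrite /= in_itv/= => /andP[].
  rewrite mulr_suml; apply: eq_bigr => k _; rewrite -mulrA; congr (_ * _).
  rewrite big_split/=; congr (_ * _).
    by apply: eq_big_nat => i /andP[_ iln]; rewrite cd_row.
  rewrite /osc -expi_sum; congr expi; rewrite !dotv_row !mulr_sumr -sumrN -big_split/=.
  by apply: eq_big_nat => i /andP[_ iln]; rewrite cd_row//; ring.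
Qed.

Lemma hk_full k i t x T : (k0 <= k)%N -> 2 ^+ k.+1 <= T ->
  cint `[- T, T] (fun xi => hk k i xi * osc t x xi) = cint setT (fun xi => hk k i xi * osc t x xi).
Proof.
move=> /good[k2 _ _] hT; symmetry; apply: (cint_sub measurableT (measurable_itv _) (@subsetT _ _)).
move=> xi _ /=; rewrite in_itv/= => hx.
have [->|h] := eqVneq (hk k i xi) 0; first by rewrite mul0r.
exfalso; apply: hx; have /andP[h1 h2] := hk_supp k2 h.
by apply/andP; split; lra.
Qed.

Lemma hk_full_itv k i t x : (k0 <= k)%N ->
  cint setT (fun xi => hk k i xi * osc t x xi) =
  cint `[0, (2 ^ k.+1)%:R] (fun xi => hk k i xi * osc t x xi).
Proof.
move=> /good[k2 _ _]; apply: (cint_sub measurableT (measurable_itv _) (@subsetT _ _)).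
move=> xi _ /=; rewrite in_itv/= => hx.
have [->|h] := eqVneq (hk k i xi) 0; first by rewrite mul0r.
by exfalso; apply: hx; rewrite natrX; exact: hk_supp h.
Qed.

End Evolution.

(** * The exceptional set *)

Section MaxBounds.
Variable R : realType.
Local Notation C := R[i].
Local Notation mu := (@lebesgue_measure R).
Variables (n : nat) (a b : R) (phi : R -> R).
Hypothesis n2 : (2 <= n)%N.
Hypothesis iphi : mu.-integrable setT (EFin \o phi).
Hypothesis cphi : continuous phi.
Local Notation Phi := (ft1 phi).
Hypothesis supp : forall eta, 1 <= `|eta| -> Phi eta = 0.
Hypothesis phi0 : phi 0 = 1.
Local Notation Rk := (@Rk R).
Local Notation D := (Dk n a b).
Variable k0 : nat.
Hypothesis good : forall k, (k0 <= k)%N -> [/\ (2 <= k)%N, 2 <= D k & 4 <= Rk k / D k].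
Local Notation cf := (cf n a b phi k0).
Local Notation hk := (hk n a b phi).
Local Notation teeth := (teeth n a b).

(** The frequency range [0, 2^(k+1)] is cut into 2^(2k+1) cells of length 1/R_k, which makes the
    freezing error negligible at the cost of 2k+2 dyadic levels, a factor polynomial in k. *)
Definition Wk (k i g : nat) (t : R) : R :=
  Wmax (2 ^ k.+1) (hk k i) (l1norm phi) (2 ^ (2 * k + 1)) (2 * k + 2) g t.

(** Up to constants, a bound for R_k times the squared L^2 norm of the i-th factor. *)
Definition szk (k i : nat) : R :=
  if i == 0 then Num.sqrt (Rk k) else Rk k * (teeth k)%:R.

Definition CW : R := cW R * (32 * (l1norm phi * ft1_l1 phi) + 2 * l1norm phi ^+ 2).

Lemma teeth_ge1 k : 4 <= Rk k / D k -> 1 <= (teeth k)%:R :> R.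
Proof. by move=> h; have [_ /andP[h1 _]] := comb_size h; rewrite /teeth; lra. Qed.

Let ML k : ((2 ^ (2 * k + 1)).+1 < 2 ^ (2 * k + 2))%N.
Proof.
have h : (2 <= 2 ^ (2 * k + 1))%N by rewrite addn1 expnS leq_pmulr// expn_gt0.
by rewrite (addnS _ 1) [X in (_ < X)%N]expnS; move: (2 ^ _)%N h => x; lia.
Qed.
Let Np k : (0 < 2 ^ k.+1)%N. Proof. by rewrite expn_gt0. Qed.
Let Mp k : (0 < 2 ^ (2 * k + 1))%N. Proof. by rewrite expn_gt0. Qed.

Lemma Wk_ge0 k i g t : 0 <= Wk k i g t.
Proof. exact: Wmax_ge0. Qed.

Lemma Wk_sum k i t : (k0 <= k)%N ->
  \sum_(0 <= g < 2 ^ k.+1) Wk k i g t <= CW * (k%:R ^+ 2 * szk k i).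
Proof.
move=> /good[k2 D2 X4]; have r4 := @Rk_ge4 R k k2; have r0 := Rk_gt0 R k.
have A0 := l1norm_ge0 phi; have B0 := ft1_l1_ge0 phi.
have s0 : 0 < Num.sqrt (Rk k) by rewrite sqrtr_gt0.
have t1 := teeth_ge1 X4.
have kR : 2 <= k%:R :> R by rewrite ler_nat.
apply: le_trans (@sum_Wmax _ _ (Np k) _ _ _ (2 * k + 2) (Mp k) (cmeas_hk n a b iphi cphi k i)
  (fun x => hk_bound iphi supp i x D2) t) _.
rewrite /CW -[X in _ <= X]mulrA ler_wpM2l ?cW_ge0//.
have Ldef : (2 * k + 2)%:R ^+ 2 <= 16 * k%:R ^+ 2 :> R.
  rewrite (_ : 16 * _ = (4 * k%:R) ^+ 2); last by ring.
  by rewrite ler_sqr ?nnegrE ?mulr_ge0// -natrM ler_nat; move: k2; clear; lia.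
have Ndef : (2 ^ k.+1)%:R = 2 * Rk k by rewrite natrX exprS.
have ddef : dstep R (2 ^ k.+1) (2 ^ (2 * k + 1)) = (Rk k)^-1.
  rewrite /dstep !natrX exprS exprD exprM expr1 -exprM mulnC exprM -/(Rk k).
  by field; rewrite gt_eqF.
rewrite ddef Ndef.
have l0 : l2sq (2 ^ k.+1) (hk k i) * Rk k <= l1norm phi * ft1_l1 phi * szk k i.
  rewrite /szk /hk; case: eqP => _.
    apply: le_trans (ler_wpM2r (ltW r0) (l2sq_hfirst iphi cphi supp _ (Rk_ge1 R k))) _.
    rewrite -!mulrA !ler_wpM2l// -{2}[Rk k](sqr_sqrtr (ltW r0)) expr2 mulKf// gt_eqF//.
  apply: le_trans (ler_wpM2r (ltW r0) (l2sq_hcomb iphi cphi supp _ _ _ D2)) _.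
  by rewrite /teeth le_eqVlt; apply/orP; left; apply/eqP; ring.
have sz1 : 1 <= szk k i * Rk k.
  rewrite /szk; case: eqP => _; last by nra.
  have : 1 <= Num.sqrt (Rk k) by rewrite -sqrtr1 ler_sqrt//; lra.
  by nra.
have sz0 : 0 <= szk k i.
  by rewrite -(pmulr_lge0 _ r0) (le_trans _ sz1).
have p1 : (2 * k + 2)%:R ^+ 2 * (2 * Rk k) * l2sq (2 ^ k.+1) (hk k i) <=
   32 * (l1norm phi * ft1_l1 phi) * (k%:R ^+ 2 * szk k i).
  have -> : (2 * k + 2)%:R ^+ 2 * (2 * Rk k) * l2sq (2 ^ k.+1) (hk k i) =
     (2 * k + 2)%:R ^+ 2 * (2 * (l2sq (2 ^ k.+1) (hk k i) * Rk k)) by ring.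
  have -> : 32 * (l1norm phi * ft1_l1 phi) * (k%:R ^+ 2 * szk k i) =
    (16 * k%:R ^+ 2) * (2 * (l1norm phi * ft1_l1 phi * szk k i)) by ring.
  apply: ler_pM => //.
  - rewrite mulr_ge0// mulr_ge0 ?(ltW r0)//.
    by apply: Rintegral_ge0 => // x _; exact: sqr_ge0.
  - by rewrite ler_wpM2l.
have p2 : 2 * Rk k * (l1norm phi * (Rk k)^-1) ^+ 2 <= 2 * l1norm phi ^+ 2 * (k%:R ^+ 2 * szk k i).
  have -> : 2 * Rk k * (l1norm phi * (Rk k)^-1) ^+ 2 = 2 * l1norm phi ^+ 2 * (Rk k)^-1.
    by field; rewrite gt_eqF.
  rewrite ler_wpM2l// ?mulr_ge0// ?sqr_ge0//.
  apply: (@le_trans _ _ (szk k i)); first by rewrite -(ler_pM2r r0) mulVf// gt_eqF.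
  by rewrite ler_peMl//; nra.
by rewrite [X in _ <= X]mulrDl; apply: lerD.
Qed.

Lemma Wk_ge k i g t y T : (k0 <= k)%N -> 0 <= T ->
  g%:R / (2 ^ k.+1)%:R <= y <= g.+1%:R / (2 ^ k.+1)%:R ->
  cabs (cint `[- T, T] (fun xi => hk k i xi * osc t y xi)) ^+ 2 <= Wk k i g t.
Proof.
move=> /good[k2 D2 X4] T0 hy.
apply: (Wmax_ge (Np k) (Mp k) (ML k) (cmeas_hk n a b iphi cphi k i)
  (fun x => hk_bound iphi supp i x D2)) => // x.
by apply: contraNeq => /(hk_supp supp k2); rewrite natrX.
Qed.

Lemma measurable_Wk k i g : (k0 <= k)%N -> measurable_fun setT (Wk k i g).
Proof.
move=> /good[k2 D2 X4]; apply: measurable_Wmax => //.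
- exact: cmeas_hk.
- by move=> x; exact: hk_bound.
Qed.

Definition Pk (k : nat) (g : 'I_n -> nat) (t : R) : R := \prod_(i < n) Wk k i (g i) t.

Lemma Pk_ge0 k g t : 0 <= Pk k g t.
Proof. by apply: prodr_ge0 => i _; exact: Wk_ge0. Qed.

Lemma CW_ge0 : 0 <= CW.
Proof. by rewrite mulr_ge0 ?cW_ge0// addr_ge0// !mulr_ge0// ?l1norm_ge0// ft1_l1_ge0. Qed.

Lemma prod_szk k : \prod_(i < n) szk k i = Num.sqrt (Rk k) * (Rk k * (teeth k)%:R) ^+ n.-1.
Proof.
rewrite -(big_mkord xpredT (szk k)) big_ltn ?(ltnW n2)//; congr (_ * _).
rewrite (eq_big_nat _ _ (F2 := fun=> Rk k * (teeth k)%:R)).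
  by rewrite big_const_nat iter_mulr_1 subn1.
by move=> i /andP[i0 _]; rewrite /szk gtn_eqF.
Qed.

(** The sum over product cells of a product is the product of the one-dimensional sums. *)
Lemma Pk_sum k t : (k0 <= k)%N ->
  \sum_(g : {ffun 'I_n -> 'I_(2 ^ k.+1)}) Pk k (fun i => g i) t <=
  CW ^+ n * k%:R ^+ (2 * n) * (Num.sqrt (Rk k) * (Rk k * (teeth k)%:R) ^+ n.-1).
Proof.
move=> kk; rewrite -(bigA_distr_bigA (fun (i : 'I_n) (g : 'I_(2 ^ k.+1)) => Wk k i g t))/=.
rewrite -prod_szk exprM.
have -> : CW ^+ n * k%:R ^+ 2 ^+ n * \prod_(i < n) szk k i = \prod_(i < n) (CW * (k%:R ^+ 2 * szk k i)).
  by rewrite big_split/= [X in _ = _ * X]big_split/= !prodr_const card_ord mulrA.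
apply: ler_prod => i _; rewrite sumr_ge0 => [|g _]; last exact: Wk_ge0.
by have := Wk_sum i t kk; rewrite big_mkord.
Qed.

Lemma Pk_le k (g : {ffun 'I_n -> 'I_(2 ^ k.+1)}) t : (k0 <= k)%N ->
  Pk k (fun i => g i) t <=
  CW ^+ n * k%:R ^+ (2 * n) * (Num.sqrt (Rk k) * (Rk k * (teeth k)%:R) ^+ n.-1).
Proof.
move=> kk; apply: le_trans (Pk_sum t kk).
by rewrite (bigD1 g)//= lerDl sumr_ge0// => g' _; exact: Pk_ge0.
Qed.

Lemma measurable_Pk k g : (k0 <= k)%N -> measurable_fun setT (Pk k g).
Proof. by move=> kk; apply: measurable_prod => i _; exact: measurable_Wk. Qed.

Lemma integrable_wtPk k (g : {ffun 'I_n -> 'I_(2 ^ k.+1)}) : (k0 <= k)%N ->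
  mu.-integrable setT (EFin \o (fun t => wt t * Pk k (fun i => g i) t)).
Proof.
move=> kk; set M := CW ^+ n * k%:R ^+ (2 * n) * (Num.sqrt (Rk k) * (Rk k * (teeth k)%:R) ^+ n.-1).
have := rint_mul M measurableT (@integrable_wt R); apply: le_integrable => //.
  apply/measurable_EFinP; apply: measurable_funM; first exact: measurable_wt.
  exact: measurable_Pk.
move=> t _ /=; rewrite lee_fin ger0_norm ?mulr_ge0 ?Pk_ge0 ?(ltW (wt_gt0 t))//.
rewrite (le_trans _ (ler_norm _))// mulrC ler_wpM2r ?(ltW (wt_gt0 t))//; exact: Pk_le.
Qed.

Definition Zk (k : nat) (g : 'I_n -> nat) : R := cf k ^+ 2 * \int[mu]_t (wt t * Pk k g t).

Definition wt1 : R := \int[mu]_t (wt t : R).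

Lemma wt1_ge0 : 0 <= wt1.
Proof. by apply: Rintegral_ge0 => // t _; exact: (ltW (wt_gt0 t)). Qed.

(** The number of teeth cancels against the norm of f^(k), and the remaining powers of R_k add up to
    n; with the square of R_k^(-s) this is the origin of n - 2s. *)
Lemma cf_sqr k : (k0 <= k)%N ->
  cf k ^+ 2 * (Num.sqrt (Rk k) * (Rk k * (teeth k)%:R) ^+ n.-1) =
  k%:R ^+ 2 * (phi_m2 phi ^+ n)^-1 * Rk k `^ (n%:R - 2 * sexp n a b).
Proof.
move=> kk; have [k2 D2 X4] := good kk.
have r0 := Rk_gt0 R k; have s0 : 0 < Num.sqrt (Rk k) by rewrite sqrtr_gt0.
have t1 := teeth_ge1 X4; have m0 := phi_m2_gt0 iphi cphi supp phi0.
rewrite /cf kk l2norm_fk// exprMn exprVn sqr_sqrtr; last first.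
  by rewrite !mulr_ge0// ?invr_ge0 ?(ltW s0)// ?exprn_ge0// ?mulr_ge0// ltW.
have n1 : n.-1.+1 = n by rewrite prednK// ltnW.
have e1 (z : R) : z ^+ n = z * z ^+ n.-1 by rewrite -exprS n1.
have e2 : Rk k `^ (n%:R - 2 * sexp n a b) = Rk k ^+ n * (Rk k `^ (- sexp n a b)) ^+ 2.
  rewrite (_ : n%:R - _ = n%:R + (- sexp n a b + - sexp n a b)); last by ring.
  by rewrite !powRD ?(gt_eqF r0) ?implybT// powR_mulrn ?(ltW r0)// expr2.
have e3 : Rk k = Num.sqrt (Rk k) ^+ 2 by rewrite sqr_sqrtr// ltW.
have tn := expf_neq0 n.-1 (lt0r_neq0 (lt_le_trans ltr01 t1)).
have mn := expf_neq0 n.-1 (lt0r_neq0 m0).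
have rn := expf_neq0 n.-1 (lt0r_neq0 r0).
rewrite e2 !e1 !exprMn.
move: (_ ^+ n.-1) tn => tn tn0.
move: (phi_m2 phi ^+ n.-1) mn => mn mn0.
move: (Rk k ^+ n.-1) rn => rn rn0.
rewrite [X in _ = _ * (X * _ * _)]e3.
field.
by rewrite mn0 tn0 (gt_eqF m0) (gt_eqF s0).
Qed.

Lemma Zk_sum k : (k0 <= k)%N ->
  \sum_(g : {ffun 'I_n -> 'I_(2 ^ k.+1)}) Zk k (fun i => g i) <=
  CW ^+ n * wt1 / phi_m2 phi ^+ n * k%:R ^+ (2 * n + 2) * Rk k `^ (n%:R - 2 * sexp n a b).
Proof.
move=> kk; rewrite -mulr_sumr.
have ig (g : {ffun 'I_n -> 'I_(2 ^ k.+1)}) := integrable_wtPk g kk.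
have [isum <-] := rint_sum (index_enum {ffun 'I_n -> 'I_(2 ^ k.+1)}) ig.
set M := CW ^+ n * k%:R ^+ (2 * n) * (Num.sqrt (Rk k) * (Rk k * (teeth k)%:R) ^+ n.-1).
apply: (@le_trans _ _ (cf k ^+ 2 * (M * wt1))).
  rewrite ler_wpM2l ?sqr_ge0// /wt1 -RintegralZl//; last exact: integrable_wt.
  apply: le_Rintegral => //.
    by have := rint_mul M measurableT (@integrable_wt R).
  move=> t _; rewrite -mulr_sumr mulrC ler_wpM2r ?(ltW (wt_gt0 t))//.
  exact: Pk_sum.
rewrite (_ : cf k ^+ 2 * (M * wt1) = CW ^+ n * wt1 * k%:R ^+ (2 * n) *
  (cf k ^+ 2 * (Num.sqrt (Rk k) * (Rk k * (teeth k)%:R) ^+ n.-1))); last by rewrite /M; ring.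
rewrite cf_sqr// exprD le_eqVlt; apply/orP; left; apply/eqP; ring.
Qed.

End MaxBounds.

(** * A covering criterion for Hausdorff null sets *)

Section HausdorffNull.
Variable R : realType.

Lemma ler_sum_subset (T : eqType) (s t : seq T) (F : T -> R) : uniq s -> uniq t ->
  {subset s <= t} -> (forall p, 0 <= F p) -> \sum_(p <- s) F p <= \sum_(p <- t) F p.
Proof.
move=> us ut st F0; rewrite [X in _ <= X](bigID (mem s))/= -[X in _ <= X + _]big_filter.
rewrite (perm_big [seq p <- t | p \in s])/=; last first.
  apply: uniq_perm => //; first exact: filter_uniq.
  by move=> p; rewrite mem_filter; case: (boolP (p \in s)) => // /st ->.
by rewrite lerDl sumr_ge0.
Qed.

(** Covers come with two indices and are enumerated by [pickle]; each finite part of the enumeration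
    lies in a rectangle. *)
Lemma sum_pickle_le (F : nat * nat -> R) (B : R) : (forall p, 0 <= F p) ->
  (forall J L, \sum_(0 <= j < J) \sum_(0 <= l < L) F (j, l) <= B) ->
  forall M, \sum_(0 <= i < M) oapp F 0 (pickle_inv i) <= B.
Proof.
move=> F0 hB M.
pose s := pmap (@pickle_inv (nat * nat)%type) (index_iota 0 M).
have -> : \sum_(0 <= i < M) oapp F 0 (pickle_inv i) = \sum_(p <- s) F p by rewrite big_pmap.
have us : uniq s by apply: (pmap_uniq (@pickle_invK _)); exact: iota_uniq.
pose J := (\max_(p <- s) p.1).+1; pose L := (\max_(p <- s) p.2).+1.
apply: le_trans (hB J L).
have -> : \sum_(0 <= j < J) \sum_(0 <= l < L) F (j, l) =
    \sum_(p <- [seq (j, l) | j <- index_iota 0 J, l <- index_iota 0 L]) F p.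
  by rewrite big_allpairs_dep.
apply: ler_sum_subset => //.
  by apply: allpairs_uniq => [||[? ?] [? ?] _ _ [-> ->]//]; exact: iota_uniq.
move=> [j l] hp; apply: allpairs_f; rewrite mem_index_iota/= ltnS.
  exact: (@leq_bigmax_seq _ s xpredT (fun p : nat * nat => p.1) (j, l) hp isT).
exact: (@leq_bigmax_seq _ s xpredT (fun p : nat * nat => p.2) (j, l) hp isT).
Qed.

Lemma diam_ge0 n (U : set 'rV[R]_n) : (0 <= diam U)%E.
Proof. by apply: ereal_sup_ubound; left. Qed.

Lemma diam_set0 n : diam (set0 : set 'rV[R]_n) = 0%E.
Proof.
apply/eqP; rewrite eq_le diam_ge0 andbT; apply: ge_ereal_sup => _ [->//|[z [[]]]].
Qed.

Lemma geometric_tail (rho : R) J J' : 0 <= rho < 1 ->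
  \sum_(J <= j < J') rho ^+ j <= rho ^+ J / (1 - rho).
Proof.
move=> /andP[r0 r1]; have r1' : 0 < 1 - rho by rewrite subr_gt0.
rewrite ler_pdivlMr//; have [JJ|JJ] := leqP J J'; last first.
  by rewrite big_geq ?(ltnW JJ)// mul0r exprn_ge0.
rewrite big_distrl/= (eq_bigr (fun j => - (rho ^+ j.+1 - rho ^+ j))); last first.
  by move=> j _; rewrite exprS; ring.
by rewrite sumrN telescope_sumr// opprB lerBlDr lerDl exprn_ge0.
Qed.

(** For every J the pieces of the generations j >= J cover E, at the cost of a geometric tail. *)
Lemma hausdorff_null n (gam A rho : R) (s : nat -> nat) (U : nat -> nat -> set 'rV[R]_n)
    (dl : nat -> R) (E : set 'rV[R]_n) :
  0 < gam -> 0 <= rho < 1 ->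
  (forall j, 0 <= dl j) -> (forall d, 0 < d -> exists J, forall j, (J <= j)%N -> dl j <= d) ->
  (forall j l, (diam (U j l) <= (dl j)%:E)%E) ->
  (exists J0, forall j, (J0 <= j)%N -> (s j)%:R * dl j `^ gam <= A * rho ^+ j) ->
  (forall x, E x -> forall J, exists j l, [/\ (J <= j)%N, (l < s j)%N & U j l x]) ->
  hausdorff gam E = 0%E.
Proof.
move=> gam0 rho01 dl0 dlcvg hdiam [J0 hs] hE; have /andP[rho0 rho1] := rho01.
have hr : 0 < 1 - rho by rewrite subr_gt0.
have content_ge0 delta : (0 <= hausdorff_content gam delta E)%E.
  apply: le_ereal_inf_tmp => _ [V _ <-]; apply: nneseries_ge0 => i _ _.
  by rewrite lee_fin powR_ge0.
have content_le delta e : 0 < delta -> 0 < e -> (hausdorff_content gam delta E <= e%:E)%E.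
  move=> d0 e0; have [J1 hJ1] := dlcvg _ d0.
  have [J2 hJ2] : exists J, `|A| * (rho ^+ J / (1 - rho)) <= e.
    have c : (fun J => `|A| / (1 - rho) * rho ^+ J) @ \oo --> `|A| / (1 - rho) * 0.
      by apply: cvgMr; apply: cvg_expr; rewrite ger0_norm.
    move: c; rewrite mulr0 => /cvgrPdist_le/(_ _ e0)[J _ hJ].
    exists J; have := hJ J (leqnn J); rewrite /= sub0r normrN => h.
    by apply: le_trans h; rewrite (le_trans _ (ler_norm _))// mulrA mulrAC.
  pose J := maxn J0 (maxn J1 J2).
  pose V i := if pickle_inv i is Some p then
    (if (J <= p.1)%N && (p.2 < s p.1)%N then U p.1 p.2 else set0) else set0.
  pose F (p : nat * nat) := if (J <= p.1)%N && (p.2 < s p.1)%N then dl p.1 `^ gam else 0.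
  have F0 p : 0 <= F p by rewrite /F; case: ifP => // _; exact: powR_ge0.
  have fin j l : diam (U j l) \is a fin_num.
    by rewrite ge0_fin_numE ?diam_ge0// (le_lt_trans (hdiam j l)) ?ltry.
  have hV i : fine (diam (V i)) `^ gam <= oapp F 0 (pickle_inv i).
    rewrite /V; case: (pickle_inv i) => [[j l]|] /=; last by rewrite diam_set0/= powR0// gt_eqF.
    rewrite /F/=; case: ifP => _; last by rewrite diam_set0/= powR0// gt_eqF.
    apply: ge0_ler_powR; rewrite ?nnegrE ?(ltW gam0)//.
      by apply: fine_ge0; exact: diam_ge0.
    by rewrite -lee_fin fineK.
  apply: ge_ereal_inf.
  exists (\sum_(0 <= i <oo) ((fine (diam (V i))) `^ gam)%:E)%E.
    exists V => //; split => [x /hE/(_ J)[j [l [Jj lj Ux]]]|i].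
      exists (pickle (j, l)) => //; rewrite /V pickleK_inv/= Jj lj/=; exact: Ux.
    rewrite /V; case: (pickle_inv i) => [[j l]|]/=; last by rewrite diam_set0 lee_fin ltW.
    case: ifP => [/andP[Jj _]|_]; last by rewrite diam_set0 lee_fin ltW.
    apply: le_trans (hdiam j l) _; rewrite lee_fin; apply: hJ1.
    by apply: leq_trans Jj; rewrite /J !leq_max leqnn orbT.
  apply: lime_le; first by apply: is_cvg_nneseries => i _ _; rewrite lee_fin powR_ge0.
  apply: nearW => M; rewrite sumEFin lee_fin.
  apply: (@le_trans _ _ (\sum_(0 <= i < M) oapp F 0 (pickle_inv i))).
    by apply: ler_sum => i _; exact: hV.
  apply: sum_pickle_le => // J' L'.
  apply: (@le_trans _ _ (\sum_(J <= j < J') `|A| * rho ^+ j)); last first.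
    rewrite -mulr_sumr; apply: le_trans hJ2; rewrite ler_wpM2l//.
    apply: le_trans (geometric_tail J J' rho01) _.
    rewrite ler_wpM2r ?invr_ge0 ?(ltW hr)//.
    by apply: ler_wiXn2l; rewrite ?(ltW rho1)// /J !leq_max leqnn !orbT.
  apply: (@le_trans _ _ (\sum_(0 <= j < J' | (J <= j)%N) `|A| * rho ^+ j)); last first.
    by rewrite [X in _ <= X](@big_nat_widenl _ _ _ J 0).
  rewrite [X in _ <= X]big_mkcond/=; apply: ler_sum => j _; case: ifP => Jj; last first.
    by rewrite big1// => l _; rewrite /F/= Jj.
  apply: (@le_trans _ _ ((s j)%:R * dl j `^ gam)); last first.
    apply: (le_trans (hs j _)); last by rewrite ler_wpM2r ?exprn_ge0// ler_norm.
    by apply: leq_trans Jj; rewrite /J leq_max leqnn.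
  rewrite /F/= Jj/=; set c := dl j `^ gam; have c0 : 0 <= c := powR_ge0 _ _.
  have -> : \sum_(0 <= l < L') (if (l < s j)%N then c else 0) = (minn L' (s j))%:R * c.
    elim: L' => [|m IH]; first by rewrite big_geq// min0n mul0r.
    rewrite big_nat_recr//= IH; case: ltnP => h.
      by rewrite !(minn_idPl _)// ?(ltnW h)// -[m.+1%:R]natr1 mulrDl mul1r.
    by rewrite !(minn_idPr _)// ?(leqW h)// addr0.
  by rewrite ler_wpM2r// ler_nat geq_minr.
apply/eqP; rewrite eq_le; apply/andP; split.
  apply: ge_ereal_sup => _ [d d0 <-]; apply/lee_addgt0Pr => e e0; rewrite add0e.
  exact: content_le.
apply: le_trans (content_ge0 1) _; apply: ereal_sup_ubound; exists 1 => //=.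
Qed.

End HausdorffNull.

(** * Powers of k against powers of R_k *)

Section PolyGeom.
Variable R : realType.

Lemma Rk_powR k (x : R) : Rk k `^ x = expR (x * ln 2) ^+ k.
Proof.
rewrite /powR gt_eqF ?exprn_gt0// /Rk lnXn// -expRM_natl; congr expR.
by rewrite -mulr_natr; ring.
Qed.

(** Half of the exponent e absorbs the polynomial, through (k th)^p <= e^(k th p). *)
Lemma poly_geom (e : R) p : 0 < e -> exists2 A, 0 <= A & forall k,
  k%:R ^+ p * Rk k `^ (- e) <= A * expR (- (e / 2 * ln 2)) ^+ k.
Proof.
move=> e0; have L0 : 0 < ln 2 :> R by rewrite ln_gt0// ltr1n.
(* The divisor p+1 instead of p admits p = 0. *)
pose th := e * ln 2 / 2 / p.+1%:R.
have th0 : 0 < th by rewrite !divr_gt0// mulr_gt0.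
exists (th^-1 ^+ p) => [|k]; first by rewrite exprn_ge0// invr_ge0 ltW.
have h1 : (k%:R * th) ^+ p <= expR (k%:R * (e / 2 * ln 2)).
  apply: (@le_trans _ _ (expR (k%:R * th) ^+ p)).
    have kt0 : 0 <= k%:R * th by rewrite mulr_ge0// ltW.
    apply: lerXn2r; rewrite ?nnegrE ?expR_ge0 ?kt0//.
    by apply: le_trans (expR_ge1Dx _); rewrite lerDr.
  rewrite -expRM_natl ler_expR mulrC.
  rewrite (_ : k%:R * (e / 2 * ln 2) = k%:R * th * p.+1%:R); last first.
    have : p.+1%:R != 0 :> R by rewrite pnatr_eq0.
    by rewrite /th; move: (p.+1%:R : R) => q q0; field.
  by apply: ler_wpM2l; [rewrite mulr_ge0// ltW|rewrite ler_nat].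
rewrite Rk_powR -!expRM_natl.
rewrite (_ : k%:R * (- e * ln 2) = k%:R * - (e / 2 * ln 2) + - (k%:R * (e / 2 * ln 2))); last first.
  by field.
rewrite expRD mulrCA [X in _ <= X]mulrC ler_wpM2l ?expR_ge0// expRN.
rewrite ler_pdivrMr ?expR_gt0// exprVn -ler_pdivrMl ?invr_gt0 ?exprn_gt0// invrK.
by rewrite mulrC -exprMn.
Qed.

Lemma sum_invsqr m : \sum_(1 <= k < m) (k%:R ^- 2 : R) <= 2.
Proof.
(* The sharper bound 2 - 1/(j+1) is the one that passes through the induction. *)
have h j : \sum_(1 <= k < j.+2) (k%:R ^- 2 : R) <= 2 - j.+1%:R^-1.
  elim: j => [|j IH]; first by rewrite big_nat1 expr1n invr1; lra.
  rewrite big_nat_recr//=; apply: le_trans (lerD IH (lexx _)) _.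
  have j0 : 0 < j.+1%:R :> R by rewrite ltr0n.
  have -> : j.+2%:R = j.+1%:R + 1 :> R by rewrite natr1.
  move: (j.+1%:R) j0 => y y0.
  have -> : 2 - (y + 1)^-1 = 2 - y^-1 + (y * (y + 1))^-1.
    by field; rewrite !gt_eqF//; lra.
  by rewrite lerD2l lef_pV2 ?posrE ?exprn_gt0 ?mulr_gt0 ?addr_gt0//; nra.
case: m => [|[|m]]; [by rewrite big_geq|by rewrite big_geq|].
by apply: le_trans (h m) _; rewrite lerBlDr lerDl invr_ge0.
Qed.

End PolyGeom.

(** * Dimension of the exceptional set and summability off it *)

Section Omega.
Variable R : realType.
Local Notation C := R[i].
Local Notation mu := (@lebesgue_measure R).
Variables (n : nat) (a b : R) (phi : R -> R).
Hypothesis n2 : (2 <= n)%N.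
Hypothesis iphi : mu.-integrable setT (EFin \o phi).
Hypothesis cphi : continuous phi.
Local Notation Phi := (ft1 phi).
Hypothesis supp : forall eta, 1 <= `|eta| -> Phi eta = 0.
Hypothesis phi0 : phi 0 = 1.
Local Notation Rk := (@Rk R).
Local Notation D := (Dk n a b).
Variable k0 : nat.
Hypothesis good : forall k, (k0 <= k)%N -> [/\ (2 <= k)%N, 2 <= D k & 4 <= Rk k / D k].
Local Notation cf := (cf n a b phi k0).
Local Notation hk := (hk n a b phi).
Local Notation Zk := (Zk a b phi k0).
Local Notation Pk := (Pk a b phi).

Definition cell k (g : 'I_n -> nat) : set 'rV[R]_n :=
  [set x | forall i : 'I_n, (g i)%:R / (2 ^ k.+1)%:R <= x ord0 i <= (g i).+1%:R / (2 ^ k.+1)%:R].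

(* The threshold k^-4 leaves a factor k^-2 for the summation over k in summable_be. *)
Definition Omega : set 'rV[R]_n := [set x | forall J, exists k, [/\ (J <= k)%N, (k0 <= k)%N &
  exists2 g : {ffun 'I_n -> 'I_(2 ^ k.+1)}, k%:R ^- 4 < Zk k (fun i => g i) &
    cell k (fun i => g i) x]].

Lemma diam_cell k g : (diam (cell k g) <= (n%:R / Rk k)%:E)%E.
Proof.
have r0 := Rk_gt0 R k.
have c0 : 0 <= n%:R / Rk k by rewrite divr_ge0// ltW.
apply: ge_ereal_sup => _ [->|[[x y]/= [hx hy] <-]]; first by rewrite lee_fin.
rewrite lee_fin /enorm -(ger0_norm c0) -sqrtr_sqr ler_sqrt ?sqr_ge0//.
have n1 : 1 <= n%:R :> R by rewrite ler1n ltnW.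
apply: (@le_trans _ _ (\sum_(i < n) (Rk k)^-1 ^+ 2)).
  apply: ler_sum => i _; rewrite -expr2 !mxE -[X in X <= _]real_normK ?num_real//.
  apply: lerXn2r; rewrite ?nnegrE ?invr_ge0 ?(ltW r0)//.
  have N0 : 0 < (2 ^ k.+1)%:R :> R by rewrite ltr0n expn_gt0.
  have Nr : (2 ^ k.+1)%:R^-1 <= (Rk k)^-1.
    by rewrite lef_pV2 ?posrE// natrX exprS -/(Rk k); lra.
  apply: le_trans Nr; move: (hx i) (hy i); rewrite -[(g i).+1%:R]natr1 mulrDl mul1r.
  by rewrite ler_norml => /andP[h1 h2] /andP[h3 h4]; apply/andP; split; lra.
rewrite sumr_const card_ord -[X in X <= _]mulr_natl exprMn ler_wpM2r ?sqr_ge0//.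
by rewrite expr2 ler_peMl.
Qed.

(** Listed as a sequence, because [hausdorff_null] numbers the pieces of a generation by natural
    numbers. *)
Definition bad k : seq ('I_n -> nat) :=
  map (fun (g : {ffun 'I_n -> 'I_(2 ^ k.+1)}) (i : 'I_n) => (g i : nat))
    (seq.filter (fun g : {ffun 'I_n -> 'I_(2 ^ k.+1)} => k%:R ^- 4 < Zk k (fun i => g i))
       (enum {ffun 'I_n -> 'I_(2 ^ k.+1)})).

Definition CZ : R := CW phi ^+ n * wt1 R / phi_m2 phi ^+ n.

Lemma Zk_ge0 k (g : 'I_n -> nat) : 0 <= Zk k g.
Proof.
rewrite mulr_ge0 ?sqr_ge0//; apply: Rintegral_ge0 => // t _.
by rewrite mulr_ge0 ?(ltW (wt_gt0 t)) ?Pk_ge0.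
Qed.

(** Chebyshev's inequality: each bad cell contributes more than k^-4 to the sum of [Zk]. *)
Lemma size_bad k : (k0 <= k)%N ->
  (size (bad k))%:R <= CZ * k%:R ^+ (2 * n + 6) * Rk k `^ (n%:R - 2 * sexp n a b).
Proof.
move=> kk; have [k2 D2 X4] := good kk.
have k0' : 0 < k%:R :> R by rewrite ltr0n (leq_trans _ k2).
have h : (size (bad k))%:R * k%:R ^- 4 <= \sum_(g : {ffun 'I_n -> 'I_(2 ^ k.+1)}) Zk k (fun i => g i).
  rewrite /bad size_map size_filter -sum1_count natr_sum mulr_suml big_enum_cond/=.
  rewrite [X in X <= _]big_mkcond/=; apply: ler_sum => g _; case: ifP => hg; last exact: Zk_ge0.
  by rewrite mul1r ltW.
have := le_trans h (Zk_sum n2 iphi cphi supp phi0 good kk).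
rewrite ler_pdivrMr ?exprn_gt0// => h2; apply: le_trans h2 _.
rewrite /CZ le_eqVlt; apply/orP; left; apply/eqP.
have -> : k%:R ^+ (2 * n + 6) = k%:R ^+ (2 * n + 2) * k%:R ^+ 4 :> R by rewrite -exprD -addnA.
ring.
Qed.

(** Generation k consists of at most k^O(1) R_k^(n-2s) cells of diameter O(1/R_k); the surplus gam -
    (n - 2s) absorbs the powers of k and leaves a geometric series. *)
Lemma hausdorff_Omega (gam : R) : 0 < n%:R - 2 * sexp n a b -> n%:R - 2 * sexp n a b < gam ->
  hausdorff gam Omega = 0%E.
Proof.
set d := n%:R - _ => d0 dg; have g0 := lt_trans d0 dg.
have e0 : 0 < gam - d by rewrite subr_gt0.
have [A A0 hA] := poly_geom (2 * n + 6) e0.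
have L0 : 0 < ln 2 :> R by rewrite ln_gt0// ltr1n.
have CZ0 : 0 <= CZ.
  rewrite divr_ge0 ?mulr_ge0 ?exprn_ge0 ?CW_ge0 ?wt1_ge0//.
  by rewrite ltW// phi_m2_gt0.
apply: (@hausdorff_null _ _ _ (n%:R `^ gam * CZ * A) (expR (- ((gam - d) / 2 * ln 2)))
  (fun k => size (bad k)) (fun k l => cell k (nth (fun=> 0%N) (bad k) l)) (fun k => n%:R / Rk k)).
- exact: g0.
- by rewrite expR_ge0/= expR_lt1 oppr_lt0 mulr_gt0// divr_gt0.
- by move=> j; rewrite divr_ge0// ltW// Rk_gt0.
- move=> e e0'; exists (Num.truncn (n%:R / e)).+1 => j hj.
  rewrite ler_pdivrMr ?Rk_gt0// mulrC -ler_pdivrMr// ltW//.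
  have h1 : n%:R / e < j%:R.
    apply: lt_le_trans (truncnS_gt _) _; by rewrite ler_nat.
  apply: lt_le_trans h1 _; rewrite /Defs.Rk -natrX ler_nat.
  exact: ltnW (ltn_expl _ _).
- by move=> j l; exact: diam_cell.
- exists k0 => k kk; have r0 := Rk_gt0 R k.
  apply: le_trans (ler_wpM2r (powR_ge0 _ _) (size_bad kk)) _.
  rewrite powRM ?invr_ge0 ?(ltW r0)// -powR_inv1 ?(ltW r0)// -powRrM mulN1r.
  rewrite (_ : CZ * _ * _ * (_ * _) = n%:R `^ gam * CZ * (k%:R ^+ (2 * n + 6) *
    (Rk k `^ d * Rk k `^ (- gam)))); last by rewrite /d; ring.
  rewrite -powRD ?(gt_eqF r0) ?implybT// -[X in _ <= X]mulrA ler_wpM2l//.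
    by rewrite mulr_ge0// powR_ge0.
  by rewrite -(opprB gam d); exact: hA.
- move=> x hx J; have [k [Jk kk [g hg cg]]] := hx J.
  have gb : g \in [seq g : {ffun 'I_n -> 'I_(2 ^ k.+1)} <- enum {ffun 'I_n -> 'I_(2 ^ k.+1)} |
     k%:R ^- 4 < Zk k (fun i => g i)] by rewrite mem_filter hg mem_enum.
  exists k, (index g [seq g : {ffun 'I_n -> 'I_(2 ^ k.+1)} <- enum {ffun 'I_n -> 'I_(2 ^ k.+1)} |
     k%:R ^- 4 < Zk k (fun i => g i)]); split => //; first by rewrite size_map index_mem.
  by rewrite (nth_map g) ?index_mem// nth_index.
Qed.

Definition cellof (x : 'rV[R]_n) k (i : 'I_n) : nat := Num.truncn (x ord0 i * (2 ^ k.+1)%:R).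

(** Majorant of |u_k(x,t)| and of all its truncations to cubes; x enters only through its cell. *)
Definition be (x : 'rV[R]_n) k t : R := cf k * Num.sqrt (Pk k (cellof x k) t).

Definition unit_cube (x : 'rV[R]_n) := forall i : 'I_n, 0 <= x ord0 i < 1.

Lemma cellof_lt x k i : unit_cube x -> (cellof x k i < 2 ^ k.+1)%N.
Proof.
move=> /(_ i)/andP[x0 x1]; rewrite /cellof -(ltr_nat R).
have N0 : 0 < (2 ^ k.+1)%:R :> R by rewrite ltr0n expn_gt0.
apply: (@le_lt_trans _ _ (x ord0 i * (2 ^ k.+1)%:R)); last by rewrite gtr_pMl.
by rewrite truncn_le mulr_ge0// ltW.
Qed.

Lemma cellof_cell x k : unit_cube x -> cell k (cellof x k) x.
Proof.
move=> hx i; have /andP[x0 x1] := hx i.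
have N0 : 0 < (2 ^ k.+1)%:R :> R by rewrite ltr0n expn_gt0.
rewrite ler_pdivrMr// ler_pdivlMr//; apply/andP; split.
  by rewrite /cellof truncn_le mulr_ge0// ltW.
by apply: ltW; exact: truncnS_gt.
Qed.

Lemma cellof_ffun x k : unit_cube x ->
  exists g : {ffun 'I_n -> 'I_(2 ^ k.+1)}, cellof x k = (fun i => g i : nat).
Proof.
move=> hx; exists [ffun i => Ordinal (cellof_lt k i hx)].
by apply/funext => i; rewrite ffunE.
Qed.

Lemma cf_ge0 k : 0 <= cf k.
Proof.
rewrite /cf; case: ifP => // _; rewrite divr_ge0 ?mulr_ge0 ?powR_ge0//; exact: sqrtr_ge0.
Qed.

Lemma be_ge0 x k t : 0 <= be x k t.
Proof. by rewrite mulr_ge0 ?cf_ge0 ?sqrtr_ge0. Qed.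

Lemma measurable_be x k : measurable_fun setT (be x k).
Proof.
have [kk|kk] := leqP k0 k; last first.
  rewrite (_ : be x k = fun=> 0)//; apply/funext => t; rewrite /be /cf leqNgt kk/=.
  by rewrite mul0r.
apply: measurable_funM => //; apply: (@measurableT_comp _ _ _ _ _ _ (@Num.sqrt R)).
  exact: continuous_measurable_fun (@sqrt_continuous R).
exact: (measurable_Pk iphi cphi supp good).
Qed.

(** The weights k^2 and k^-2 are adapted to the threshold: off [Omega] the first term has integral
    at most k^2 k^-4/2 from some k on, and the second is summable as it stands. *)
Lemma be_amgm x k t : (0 < k)%N ->
  wt t * be x k t <= (k%:R ^+ 2 * cf k ^+ 2 / 2) * (wt t * Pk k (cellof x k) t) + k%:R ^- 2 / 2 * wt t.
Proof.
move=> kp; have kR : 0 < k%:R :> R by rewrite ltr0n.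
have w0 := wt_gt0 t; have P0 := Pk_ge0 a b phi k (cellof x k) t.
rewrite (_ : _ + _ = wt t * ((k%:R ^+ 2 * (cf k ^+ 2 * Pk k (cellof x k) t) + k%:R ^- 2) / 2)); last by ring.
rewrite ler_wpM2l ?(ltW w0)//.
rewrite -[Pk _ _ _ in X in _ <= X](sqr_sqrtr P0) -exprMn -/(be x k t) -exprMn -exprVn.
move: (be x k t) => z.
have : 0 <= (k%:R * z - k%:R^-1) ^+ 2 by exact: sqr_ge0.
rewrite sqrrB (_ : k%:R * z * k%:R^-1 = z); last by field; rewrite gt_eqF.
rewrite -[_ *+ 2]mulr_natl; lra.
Qed.

Lemma integrable_wt_be x k : unit_cube x -> mu.-integrable setT (EFin \o (fun t => wt t * be x k t)).
Proof.
move=> hx; have [kk|kk] := leqP k0 k; last first.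
  rewrite (_ : (fun t => wt t * be x k t) = fun=> 0); first exact: integrable0.
  by apply/funext => t; rewrite /be /cf leqNgt kk/= mul0r mulr0.
have [k2 _ _] := good kk.
have [g hg] := cellof_ffun k hx.
have i1 := rint_mul (k%:R ^+ 2 * cf k ^+ 2 / 2) measurableT
  (integrable_wtPk n2 iphi cphi supp good g kk).
have i2 := rint_mul (k%:R ^- 2 / 2) measurableT (@integrable_wt R).
have := rint_add measurableT i1 i2; apply: le_integrable => //.
  apply/measurable_EFinP; apply: measurable_funM; first exact: measurable_wt.
  exact: measurable_be.
move=> t _; rewrite /= lee_fin (ger0_norm (mulr_ge0 (ltW (wt_gt0 t)) (be_ge0 x k t))).
rewrite (le_trans _ (ler_norm _))//; have := be_amgm x t (ltnW k2).
by rewrite hg.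
Qed.

Lemma Rintegral_wt_be x k : unit_cube x -> (k0 <= k)%N ->
  \int[mu]_t (wt t * be x k t) <= k%:R ^+ 2 / 2 * Zk k (cellof x k) + k%:R ^- 2 / 2 * wt1 R.
Proof.
move=> hx kk; have [k2 _ _] := good kk.
have [g hg] := cellof_ffun k hx.
have iP := integrable_wtPk n2 iphi cphi supp good g kk.
have i1 := rint_mul (k%:R ^+ 2 * cf k ^+ 2 / 2) measurableT iP.
have i2 := rint_mul (k%:R ^- 2 / 2) measurableT (@integrable_wt R).
apply: (@le_trans _ _ (\int[mu]_t ((k%:R ^+ 2 * cf k ^+ 2 / 2) * (wt t * Pk k (fun i => g i) t)
   + k%:R ^- 2 / 2 * wt t))).
  apply: le_Rintegral => //; first exact: integrable_wt_be.
    exact: rint_add.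
  by move=> t _; have := be_amgm x t (ltnW k2); rewrite hg.
rewrite RintegralD// !RintegralZl//; last exact: integrable_wt.
rewrite hg /Zk /wt1 le_eqVlt; apply/orP; left; apply/eqP; ring.
Qed.

(** Off [Omega] the cell of x satisfies [Zk] <= k^-4 from some k on, so the integrals are
    O(k^-2). *)
Lemma summable_be x : unit_cube x -> ~ Omega x ->
  exists S, forall J, \sum_(0 <= k < J) \int[mu]_t (wt t * be x k t) <= S.
Proof.
move=> hx; move/existsNP => [J0 hJ0].
pose K := maxn J0 (maxn k0 1).
have be0 k : 0 <= \int[mu]_t (wt t * be x k t).
  by apply: Rintegral_ge0 => // t _; rewrite mulr_ge0 ?be_ge0 ?(ltW (wt_gt0 t)).
exists (\sum_(0 <= k < K) \int[mu]_t (wt t * be x k t) + (1 + wt1 R)) => J.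
have w0 := wt1_ge0 R.
apply: (@le_trans _ _ (\sum_(0 <= k < maxn K J) \int[mu]_t (wt t * be x k t))).
  rewrite [X in _ <= X](big_cat_nat (n := J))//=; last by rewrite leq_max leqnn orbT.
  by rewrite lerDl sumr_ge0.
rewrite (big_cat_nat (n := K))//=; last by rewrite leq_max leqnn.
rewrite lerD2l; apply: (@le_trans _ _ (\sum_(K <= k < maxn K J) (1 + wt1 R) / 2 * k%:R ^- 2)).
  apply: ler_sum_nat => k /andP[Kk _].
  have [Jk kk kp] : [/\ (J0 <= k)%N, (k0 <= k)%N & (0 < k)%N].
    by move: Kk; rewrite /K !geq_max => /and3P[].
  have kR : 0 < k%:R :> R by rewrite ltr0n.
  apply: le_trans (Rintegral_wt_be hx kk) _.
  have hZ : Zk k (cellof x k) <= k%:R ^- 4.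
    rewrite leNgt; apply/negP => hlt; apply: hJ0; exists k; split => //.
    by have [g hg] := cellof_ffun k hx; exists g; rewrite -hg//; exact: cellof_cell.
  rewrite (_ : (1 + wt1 R) / 2 * _ = k%:R ^+ 2 / 2 * k%:R ^- 4 + k%:R ^- 2 / 2 * wt1 R); last first.
    by field; rewrite gt_eqF.
  by rewrite lerD2r ler_wpM2l// divr_ge0// sqr_ge0.
rewrite -mulr_sumr; have := sum_invsqr R (maxn K J).
rewrite (big_cat_nat (n := K))//=; last 2 first.
- by rewrite /K !leq_max leqnn !orbT.
- by rewrite leq_max leqnn.
set s1 := \sum_(1 <= i < K) _; have : 0 <= s1 by apply: sumr_ge0 => i _; rewrite invr_ge0 sqr_ge0.
move=> h1; set s2 := \sum_(K <= i < _) _ => h2.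
rewrite (_ : _ / 2 * s2 = (1 + wt1 R) * (s2 / 2)); last by ring.
by rewrite ler_piMr ?addr_ge0//; lra.
Qed.

End Omega.

(** * Existence of the limit and filtering of the solution *)

Section KernelBound.
Variable R : realType.
Local Notation C := R[i].
Local Notation mu := (@lebesgue_measure R).
Variables (be : nat -> R -> R) (S : R).
Hypothesis be0 : forall k t, 0 <= be k t.
Hypothesis mbe : forall k, measurable_fun setT (be k).
Hypothesis ibe : forall k, mu.-integrable setT (EFin \o (fun t => wt t * be k t)).
Hypothesis hS : forall J, \sum_(0 <= k < J) \int[mu]_t (wt t * be k t) <= S.

Let f k t : R := wt t * be k t.
Let f0 k t : 0 <= f k t. Proof. by rewrite mulr_ge0 ?be0// ltW// wt_gt0. Qed.
Let mf k : measurable_fun setT (f k).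
Proof. by apply: measurable_funM; [exact: measurable_wt|exact: mbe]. Qed.
(** Tails with values in the extended reals, as the series is known to converge only for almost
    every t. *)
Let W J t : \bar R := (\sum_(i <oo) (f (i + J) t)%:E)%E.
Let mfE k : measurable_fun setT (EFin \o f k). Proof. exact/measurable_EFinP. Qed.

Let W_ge0 J t : (0 <= W J t)%E.
Proof. by apply: nneseries_ge0 => i _ _; rewrite lee_fin. Qed.

Let mW J : measurable_fun setT (W J).
Proof.
apply: (@ge0_emeasurable_sum _ _ R setT (fun i t => (f (i + J) t)%:E) xpredT) => [k t _ _|k _].
  by rewrite lee_fin.
exact: mfE.
Qed.

Let If k : (\int[mu]_t (f k t)%:E = (\int[mu]_t f k t)%:E)%E.
Proof. by rewrite fineK//; exact: (integrable_fin_num measurableT (ibe k)). Qed.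

Let intW J : (\int[mu]_t W J t = \sum_(J <= k <oo) (\int[mu]_t f k t)%:E)%E.
Proof.
rewrite /W integral_nneseries//; last 2 first.
- by move=> i; exact: mfE.
- by move=> i t _; rewrite lee_fin.
rewrite -(nneseries_addn (f := fun k => (\int[mu]_t f k t)%:E)).
  by apply: eq_eseriesr => i _; rewrite If.
by move=> i; rewrite lee_fin Rintegral_ge0.
Qed.

Let intW_fin : (\sum_(0 <= k <oo) (\int[mu]_t f k t)%:E < +oo)%E.
Proof.
apply: le_lt_trans (ltry S); apply: lime_le.
  by apply: is_cvg_nneseries => i _ _; rewrite lee_fin Rintegral_ge0.
by apply: nearW => m; rewrite sumEFin lee_fin.
Qed.

Let W_ae : {ae mu, forall t, setT t -> W 0 t \is a fin_num}.
Proof.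
apply: integrable_ae => //; apply/integrableP; split; first exact: mW.
under eq_integral => t _ do rewrite gee0_abs//.
by rewrite intW.
Qed.

Variables (u : nat -> R -> C) (M d C1 C2 : R) (kk : R -> R).
Hypothesis mu_ : forall k, cmeas setT (u k).
Hypothesis ub : forall k t, cabs (u k t) <= be k t.
Hypotheses (M0 : 0 <= M) (C10 : 0 <= C1) (C20 : 0 <= C2).
Hypothesis kk0 : forall t, 0 <= kk t.
Hypothesis ikk : mu.-integrable setT (EFin \o kk).
Hypothesis kkwt : forall t, kk t <= C2 * wt t.
Hypothesis kkout : forall t, ~~ (0 < t < d) -> kk t <= C1 * wt t.
Hypothesis hU : forall t, 0 < t < d -> forall B, (forall J, \sum_(0 <= k < J) be k t <= B) ->
  forall J e, 0 < e -> exists2 J', (J <= J')%N &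
    cabs (\sum_(0 <= k < J) u k t) <= M + \sum_(J <= k < J') be k t + e.

Let Ub J t : cabs (\sum_(0 <= k < J) u k t) <= \sum_(0 <= k < J) be k t.
Proof. by apply: le_trans (cabs_sum _ _ _) _; apply: ler_sum => k _. Qed.

(** Off (0,d) the kernel is at most C1 wt and the partial sum is bounded trivially; inside, the
    partial sum is at most M plus a tail, and the kernel in front of the tail is at most C2 wt. *)
Let ptw J t : W 0 t \is a fin_num ->
  ((kk t * cabs (\sum_(0 <= k < J) u k t))%:E <=
   (M * kk t + C1 * \sum_(0 <= k < J) f k t)%:E + C2%:E * W J t)%E.
Proof.
move=> fW; have w0 := wt_gt0 t.
have sf J' : \sum_(0 <= k < J') f k t = wt t * \sum_(0 <= k < J') be k t by rewrite mulr_sumr.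
have W0J J' : ((\sum_(J <= k < J') f k t)%:E <= W J t)%E.
  rewrite /W (nneseries_addn (f := fun k => (f k t)%:E)); last by move=> i; rewrite lee_fin.
  by rewrite -sumEFin; apply: nneseries_lim_ge => i _ _; rewrite lee_fin.
have [ht|ht] := boolP (0 < t < d); last first.
  apply: (@le_trans _ _ (M * kk t + C1 * \sum_(0 <= k < J) f k t)%:E); last first.
    by rewrite leeDl// mule_ge0// ?lee_fin.
  rewrite lee_fin sf mulrA; apply: (@le_trans _ _ (C1 * wt t * \sum_(0 <= k < J) be k t)).
    by apply: ler_pM => //; [exact: cabs_ge0|exact: kkout].
  by rewrite lerDr mulr_ge0.
have hB J' : \sum_(0 <= k < J') be k t <= fine (W 0 t) / wt t.
  rewrite ler_pdivlMr// mulrC -sf -lee_fin fineK//.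
  rewrite -sumEFin /W; under [X in (_ <= X)%E]eq_eseriesr do rewrite addn0.
  by apply: nneseries_lim_ge => i _ _; rewrite lee_fin.
have fWJ : W J t \is a fin_num.
  rewrite ge0_fin_numE//; apply: le_lt_trans (ltry (fine (W 0 t))).
  apply: lime_le; first by apply: is_cvg_nneseries => i _ _; rewrite lee_fin.
  apply: nearW => m; rewrite sumEFin lee_fin.
  have -> : \sum_(0 <= i < m) f (i + J)%N t = \sum_(J <= i < m + J) f i t.
    by rewrite -{2}[J]add0n big_addn addnK.
  apply: (@le_trans _ _ (\sum_(0 <= i < m + J) f i t)).
    by rewrite [X in _ <= X](big_cat_nat (n := J))//= ?leq_addl// lerDr sumr_ge0.
  by rewrite sf -ler_pdivlMl// mulrC.
rewrite -(fineK fWJ) -EFinM -EFinD lee_fin.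
apply/ler_addgt0Pr => e e0.
(* The slack given to [hU] is e divided by this number, so that it stays below e after
   multiplication by the kernel. *)
have c0 : 0 < C2 * wt t + 1 by rewrite ltr_wpDl// mulr_ge0// ltW.
have [J' JJ hJ'] := hU ht hB J (divr_gt0 e0 c0).
apply: (@le_trans _ _ (kk t * (M + \sum_(J <= k < J') be k t + e / (C2 * wt t + 1)))).
  by rewrite ler_wpM2l.
rewrite !mulrDr mulrC -!addrA lerD2l.
have h1 : kk t * \sum_(J <= k < J') be k t <= C2 * fine (W J t).
  apply: (@le_trans _ _ (C2 * wt t * \sum_(J <= k < J') be k t)).
    by rewrite ler_wpM2r// sumr_ge0.
  by rewrite -mulrA ler_wpM2l// mulr_sumr -lee_fin fineK.
have h2 : kk t * (e / (C2 * wt t + 1)) <= e.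
  rewrite mulrA ler_pdivrMr// mulrC ler_wpM2l ?(ltW e0)//.
  by apply: le_trans (kkwt t) _; rewrite lerDl.
have h3 : 0 <= C1 * \sum_(0 <= k < J) f k t by rewrite mulr_ge0// sumr_ge0.
move: h1 h2 h3; move: (kk t * _) (kk t * _) (C1 * _) (C2 * _) => z1 z2 z3 z4; lra.
Qed.

(** C2 multiplies only the integrated tail and disappears into the final 1 once J is large, so it
    may depend on the kernel. C1 multiplies the whole sum S and survives, so the caller must supply
    it uniformly in k. *)
Lemma kernel_bound : exists J0, forall J, (J0 <= J)%N ->
  \int[mu]_t (kk t * cabs (\sum_(0 <= k < J) u k t)) <= M * (\int[mu]_t kk t) + C1 * S + 1.
Proof.
have c1 : 0 < C2 + 1 by rewrite ltr_wpDl.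
have [J0 hJ0] : exists J0, forall J, (J0 <= J)%N -> (C2%:E * \int[mu]_t W J t <= 1%:E)%E.
  have If0 k : (0 <= (\int[mu]_t f k t)%:E)%E by rewrite lee_fin Rintegral_ge0.
  have := @nneseries_tail_cvg R (fun k => (\int[mu]_t f k t)%:E) xpredT intW_fin (fun k _ => If0 k).
  move=> /fine_cvgP[[N1 _ h1]] /cvgrPdist_le/(_ (C2 + 1)^-1)[]; first by rewrite invr_gt0.
  move=> N2 _ h2; exists (maxn N1 N2) => J; rewrite geq_max => /andP[J1 J2].
  have fJ := h1 J J1; have := h2 J J2; rewrite /= sub0r normrN => h3.
  rewrite intW -(fineK fJ) -EFinM lee_fin.
  apply: (@le_trans _ _ (C2 * (C2 + 1)^-1)).
    by rewrite ler_wpM2l// (le_trans (ler_norm _)).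
  by rewrite ler_pdivrMr// mul1r lerDl.
exists J0 => J JJ; rewrite -lee_fin.
have mU : measurable_fun setT (fun t => cabs (\sum_(0 <= k < J) u k t)).
  by apply: cmeas_cabs; apply: cmeas_sum => k _; exact: mu_.
have mkk : measurable_fun setT kk by apply/measurable_EFinP; case/integrableP: ikk.
have [if_ If_] := rint_sum (index_iota 0 J) ibe.
have iU : mu.-integrable setT (EFin \o (fun t => kk t * cabs (\sum_(0 <= k < J) u k t))).
  have := rint_mul C2 measurableT if_; apply: le_integrable => //.
    by apply/measurable_EFinP; exact: measurable_funM.
  move=> t _; rewrite /= lee_fin (ger0_norm (mulr_ge0 (kk0 t) (cabs_ge0 _))).
  rewrite (le_trans _ (ler_norm _))// -mulr_sumr mulrA.
  by apply: ler_pM => //; exact: cabs_ge0.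
have i1 := rint_mul M measurableT ikk.
have i2 := rint_mul C1 measurableT if_.
have i3 := rint_add measurableT i1 i2.
rewrite [X in (X%:E <= _)%E]/Rintegral fineK; last exact: (integrable_fin_num measurableT iU).
apply: (@le_trans _ _ (\int[mu]_t ((M * kk t + C1 * \sum_(0 <= k < J) f k t)%:E + C2%:E * W J t))%E).
  apply: ae_ge0_le_integral => //.
  - by move=> t _; rewrite lee_fin mulr_ge0// cabs_ge0.
  - by apply/measurable_EFinP; exact: measurable_funM.
  - move=> t _; rewrite adde_ge0 ?mule_ge0 ?lee_fin//.
    by rewrite addr_ge0// mulr_ge0// sumr_ge0.
  - apply: emeasurable_funD; last by apply: measurable_funeM; exact: mW.
    by case/integrableP: i3.
  - case: W_ae => N [mN N0 sub]; exists N; split=> // t ht; apply: sub => /= hw.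
    by apply: ht => _; exact: ptw (hw I).
rewrite ge0_integralD//; last 4 first.
- by move=> t _; rewrite lee_fin addr_ge0// mulr_ge0// sumr_ge0.
- by case/integrableP: i3.
- by move=> t _; rewrite mule_ge0// lee_fin.
- by apply: measurable_funeM; exact: mW.
rewrite ge0_integralZl// ?lee_fin//; last exact: mW.
rewrite [X in (_ <= X)%E]EFinD; apply: leeD; last exact: hJ0.
rewrite -(fineK (integrable_fin_num measurableT i3)) lee_fin.
rewrite -/(Rintegral _ _ _) RintegralD// !RintegralZl// If_ lerD2l ler_wpM2l//.
Qed.

End KernelBound.

(** * Limits of truncations dominated by a summable series *)

Section Limits.
Variable R : realType.
Local Notation C := R[i].

(** Once N is large for J, the truncation differs from the J-th partial sum by a piece of the tail
    of the summable majorant; hence both have the same limit. *)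
Lemma real_limit (tr : R -> R) (u be : nat -> R) (B : R) :
  (forall k, `|u k| <= be k) -> (forall J, \sum_(0 <= k < J) be k <= B) ->
  (forall J, exists N0, forall N, N0 <= N -> exists2 J', (J <= J')%N &
     `|tr N - \sum_(0 <= k < J) u k| <= \sum_(J <= k < J') be k) ->
  exists v : R, tr @ pinfty_nbhs R --> v /\ (fun J => \sum_(0 <= k < J) u k) @ \oo --> v.
Proof.
move=> ub hB htr.
have be0 k : 0 <= be k := le_trans (normr_ge0 _) (ub k).
have cbe : cvgn (series be).
  apply: nondecreasing_is_cvgn; first by apply: nondecreasing_series => k _ _.
  by exists B => _ [J _ <-]; exact: hB.
have cu : cvgn (series u).
  by apply: normed_cvg; apply: (series_le_cvg (v_ := be)) => // k; exact: normr_ge0.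
have hlim : (fun J => \sum_(0 <= k < J) u k) @ \oo --> limn (series u) by exact: cu.
exists (limn (series u)); split => //.
apply/cvgrPdist_le => e e0.
have e2 : 0 < e / 2 by rewrite divr_gt0.
move/cvgrPdist_le: hlim => /(_ _ e2)[J1 _ hJ1].
move/cvgrPdist_le: (cbe : series be @ \oo --> limn (series be)) => /(_ (e / 4))[|J2 _ hJ2].
  by rewrite divr_gt0.
pose J := maxn J1 J2; have [N0 hN0] := htr J.
have hN : \forall N \near pinfty_nbhs R, N0 <= N by exact: nbhs_pinfty_ge (num_real _).
apply: filterS hN => N /hN0[J' JJ' h].
have h1 := hJ1 J (leq_maxl _ _).
have h2 : \sum_(J <= k < J') be k <= e / 2.
  have -> : \sum_(J <= k < J') be k = series be J' - series be J.
    by rewrite /series/= [X in _ = X - _](big_cat_nat (n := J))//= addrAC subrr add0r.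
  have := hJ2 J (leq_maxr _ _); have := hJ2 J' (leq_trans (leq_maxr _ _) JJ').
  move=> /= g1 g2.
  rewrite (_ : series be J' - series be J = (limn (series be) - series be J) - (limn (series be) - series be J')); last by ring.
  apply: le_trans (ler_norm _) _; apply: le_trans (ler_normB _ _) _.
  by move: g1 g2 => /=; lra.
rewrite (_ : _ - tr N = (limn (series u) - \sum_(0 <= k < J) u k) - (tr N - \sum_(0 <= k < J) u k)); last by ring.
apply: le_trans (ler_normB _ _) _; move: h1 h => /=; lra.
Qed.

Lemma complex_limit (tr : R -> C) (u : nat -> C) (be : nat -> R) (B : R) :
  (forall k, cabs (u k) <= be k) -> (forall J, \sum_(0 <= k < J) be k <= B) ->
  (forall J, exists N0, forall N, N0 <= N -> exists2 J', (J <= J')%N &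
     cabs (tr N - \sum_(0 <= k < J) u k) <= \sum_(J <= k < J') be k) ->
  exists v : C, [/\ (fun N => complex.Re (tr N)) @ pinfty_nbhs R --> complex.Re v,
    (fun N => complex.Im (tr N)) @ pinfty_nbhs R --> complex.Im v &
    forall J e, 0 < e -> exists2 J', (J <= J')%N &
      cabs (\sum_(0 <= k < J) u k) <= cabs v + \sum_(J <= k < J') be k + e].
Proof.
move=> ub hB htr.
have [v1 [r1 s1]] : exists v : R, (fun N => complex.Re (tr N)) @ pinfty_nbhs R --> v /\
    (fun J => \sum_(0 <= k < J) complex.Re (u k)) @ \oo --> v.
  apply: (@real_limit _ _ be B) => // [k|J]; first exact: le_trans (Re_le_cabs _) (ub k).
  have [N0 h] := htr J; exists N0 => N /h[J' JJ hJ]; exists J' => //; apply: le_trans hJ.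
  by apply: le_trans (Re_le_cabs _); rewrite !cE cRe_sum.
have [v2 [r2 s2]] : exists v : R, (fun N => complex.Im (tr N)) @ pinfty_nbhs R --> v /\
    (fun J => \sum_(0 <= k < J) complex.Im (u k)) @ \oo --> v.
  apply: (@real_limit _ _ be B) => // [k|J]; first exact: le_trans (Im_le_cabs _) (ub k).
  have [N0 h] := htr J; exists N0 => N /h[J' JJ hJ]; exists J' => //; apply: le_trans hJ.
  by apply: le_trans (Im_le_cabs _); rewrite !cE cIm_sum.
exists (Complex v1 v2); split => // J e e0.
have e2 : 0 < e / 2 by rewrite divr_gt0.
move/cvgrPdist_le: s1 => /(_ _ e2)[J1 _ hJ1].
move/cvgrPdist_le: s2 => /(_ _ e2)[J2 _ hJ2].
pose J' := maxn J (maxn J1 J2).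
exists J'; first exact: leq_maxl.
have h1 := hJ1 J' (leq_trans (leq_maxl _ _) (leq_maxr _ _)).
have h2 := hJ2 J' (leq_trans (leq_maxr _ _) (leq_maxr _ _)).
have h3 : cabs (Complex v1 v2 - \sum_(0 <= k < J') u k) <= e.
  apply: le_trans (cabs_le_ReIm _) _.
  by rewrite !cE cRe_sum cIm_sum /=; move: h1 h2 => /=; lra.
have h4 : cabs (\sum_(J <= k < J') u k) <= \sum_(J <= k < J') be k.
  by apply: le_trans (cabs_sum _ _ _) _; apply: ler_sum => k _.
have -> : \sum_(0 <= k < J) u k =
    Complex v1 v2 - ((Complex v1 v2 - \sum_(0 <= k < J') u k) + \sum_(J <= k < J') u k).
  by rewrite [in X in _ = X](big_cat_nat (n := J) (p := J'))//=; [ring|exact: leq_maxl].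
apply: le_trans (cabsD _ _) _; rewrite cabsN -[X in _ <= X]addrA lerD2l.
by apply: le_trans (cabsD _ _) _; rewrite addrC; exact: lerD.
Qed.

End Limits.

(** * Existence of the solution, and its k-th summand recovered by the filter *)

Section Solution.
Variable R : realType.
Local Notation C := R[i].
Local Notation mu := (@lebesgue_measure R).
Variables (n : nat) (a b : R) (phi : R -> R).
Hypothesis n2 : (2 <= n)%N.
Hypothesis iphi : mu.-integrable setT (EFin \o phi).
Hypothesis cphi : continuous phi.
Local Notation Phi := (ft1 phi).
Hypothesis supp : forall eta, 1 <= `|eta| -> Phi eta = 0.
Hypothesis phi0 : phi 0 = 1.
Local Notation Rk := (@Rk R).
Local Notation D := (Dk n a b).
Variable k0 : nat.
Hypothesis good : forall k, (k0 <= k)%N -> [/\ (2 <= k)%N, 2 <= D k & 4 <= Rk k / D k].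
Local Notation cf := (cf n a b phi k0).
Local Notation hk := (hk n a b phi).
Local Notation be := (be a b phi k0).

Definition vf k i t y : C := cint setT (fun xi => hk k i xi * osc t y xi).
Definition uf (x : 'rV[R]_n) k t : C := rc (cf k) * \prod_(0 <= i < n) vf k i t (cd x i).
Definition up T (x : 'rV[R]_n) k t : C :=
  rc (cf k) * \prod_(0 <= i < n) cint `[- T, T] (fun xi => hk k i xi * osc t (cd x i) xi).

Lemma cd_ord (x : 'rV[R]_n) (i : 'I_n) : cd x i = x ord0 i.
Proof. by rewrite /cd insubT//= => p; congr (x _ _); exact: val_inj. Qed.

Lemma cf_lt k : (k < k0)%N -> cf k = 0.
Proof. by rewrite /cf ltnNge => /negbTE ->. Qed.

(** [Wk_ge] is uniform in the cut-off, hence a single majorant serves all T. *)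
Lemma up_le T x k t : unit_cube x -> 0 <= T -> cabs (up T x k t) <= be x k t.
Proof.
move=> hx T0; have [kk|kk] := leqP k0 k; last first.
  by rewrite /up /be cf_lt// rc0 !mul0r cabs0.
rewrite /up /be cabsM cabs_rc (ger0_norm (cf_ge0 n a b phi k0 k)) ler_wpM2l ?cf_ge0//.
set P := \prod_(_ <= _ < _) _; rewrite -[cabs P]ger0_norm ?cabs_ge0// -sqrtr_sqr.
rewrite ler_sqrt ?Pk_ge0// /P cabs_prod big_mkord -prodrXl.
apply: ler_prod => i _; rewrite sqr_ge0 cd_ord/=.
have h := @Wk_ge R n a b phi n2 iphi cphi supp k0 good k i (cellof x k i) t (x ord0 i) T kk T0 (cellof_cell k hx i).
exact: h.
Qed.

Lemma up_uf T x k t : 2 ^+ k.+1 <= T -> up T x k t = uf x k t.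
Proof.
move=> hT; have [kk|kk] := leqP k0 k; last by rewrite /up /uf cf_lt// rc0 !mul0r.
by congr (_ * _); apply: eq_bigr => i _; exact: (hk_full supp good).
Qed.

Lemma uf_le x k t : unit_cube x -> cabs (uf x k t) <= be x k t.
Proof. by move=> hx; rewrite -(@up_uf (2 ^+ k.+1))//; exact: up_le. Qed.

Lemma schr_converges x t B : unit_cube x -> (forall J, \sum_(0 <= k < J) be x k t <= B) ->
  exists2 v, schr_at (ghat n phi a b k0) t x v & forall J e, 0 < e -> exists2 J', (J <= J')%N &
      cabs (\sum_(0 <= k < J) uf x k t) <= cabs v + \sum_(J <= k < J') be x k t + e.
Proof.
move=> hx hB; have [||v [h1 h2 h3]] := @complex_limit R (fun N => schr_trunc (ghat n phi a b k0) t x N)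
  (fun k => uf x k t) (fun k => be x k t) B _ hB; last by exists v.
  by move=> k; exact: uf_le.
(* For N >= 2 * 2^J the summands k < J are not cut at all; the later ones are left to the
   majorant. *)
move=> J; exists (2 * 2 ^+ J) => N hN.
have N0 : 0 <= N / 2 by rewrite divr_ge0//; apply: le_trans hN; rewrite mulr_ge0// exprn_ge0.
pose m := maxn (Num.truncn (N / 2)).+1 J.
have hm : N / 2 <= 2 ^+ m.
  apply: le_trans (ltW (truncnS_gt _)) _; rewrite -natrX ler_nat.
  by apply: leq_trans (ltnW (ltn_expl _ _)); rewrite ?leq_maxl.
exists m.+1; first by rewrite ltnW// ltnS leq_maxr.
rewrite (schr_truncE n2 iphi cphi supp good t x hm).
rewrite (big_cat_nat (n := J))//=; last by rewrite ltnW// ltnS leq_maxr.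
rewrite (eq_big_nat _ _ (F2 := fun k => uf x k t)); last first.
  move=> k /andP[_ kJ]; rewrite -(@up_uf (N / 2))//.
  apply: (@le_trans _ _ (2 ^+ J)); first by apply: ler_weXn2l; rewrite ?ler1n.
  by rewrite ler_pdivlMr// mulrC.
rewrite addrAC subrr add0r; apply: le_trans (cabs_sum _ _ _) _.
by apply: ler_sum => k _; exact: up_le.
Qed.

Lemma cmeas_vf k i y : (k0 <= k)%N -> cmeas setT (fun t => vf k i t y).
Proof.
move=> kk; have [k2 D2 X4] := good kk.
have m : cmeas setT (fun xi => hk k i xi * expi (2 * pi * y * xi)).
  apply: cmeasM; first exact: cmeas_hk.
  by apply: cmeas_expi; exact: measurable_funM.
have bnd xi : cabs (hk k i xi * expi (2 * pi * y * xi)) <= l1norm phi.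
  by rewrite cabsM cabs_expi mulr1; exact: hk_bound.
have := @cmeas_oscint R (2 ^ k.+1) _ _ m bnd.
congr cmeas; apply/funext => t; rewrite /vf (hk_full_itv supp good)// /oscint.
by apply: eq_cint => xi _; rewrite /osc -mulrA -expiD addrC.
Qed.

Lemma vf_le k i y t : cabs (vf k i t y) <= \int[mu]_xi cabs (hk k i xi).
Proof.
apply: cabs_cint_dom => //.
- by apply: cmeasM; [exact: cmeas_hk|exact: cmeas_osc].
- by apply: integrable_cabs => //; exact: cintegrable_hk.
- by move=> xi _; rewrite cabsM cabs_expi mulr1.
Qed.

Lemma cmeas_uf x k : cmeas setT (uf x k).
Proof.
have [kk|kk] := leqP k0 k; last first.
  by rewrite (_ : uf x k = fun=> 0); [exact: cmeas_cst|apply/funext => t; rewrite /uf cf_lt// rc0 mul0r].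
by apply: cmeasM; [exact: cmeas_cst|apply: cmeas_prod => i _; exact: cmeas_vf].
Qed.

Lemma uf_bounded x k : exists M, forall t, cabs (uf x k t) <= M.
Proof.
exists (`|cf k| * \prod_(0 <= i < n) \int[mu]_xi cabs (hk k i xi)) => t.
rewrite /uf cabsM cabs_rc ler_wpM2l// cabs_prod; apply: ler_prod => i _.
by rewrite cabs_ge0; exact: vf_le.
Qed.


Section bands.
Hypothesis big : forall k, (k0 <= k)%N -> 256 <= Rk k /\ 24 * n%:R <= Rk k.

(** The first coordinate is r up to sqrt r, the others lie between r/2 - 1 and r + 1. To leading
    order |xi|^2/r^2 is thus between (n+3)/4 and n, and the lower bounds on r keep the errors below
    the margin 1/4. *)
Lemma band_sum k (y : nat -> R) : (k0 <= k)%N -> (forall i, (i < n)%N -> hk k i (y i) != 0) ->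
  (n%:R + 2) / 4 * Rk k ^+ 2 <= \sum_(0 <= i < n) y i ^+ 2 <= (n%:R + 1 / 4) * Rk k ^+ 2.
Proof.
move=> kk hy; have [k2 D2 X4] := good kk; have [r256 rn] := big kk.
have r0 := Rk_gt0 R k.
have s0 := sqrtr_ge0 (Rk k); have sE : Num.sqrt (Rk k) ^+ 2 = Rk k by rewrite sqr_sqrtr// ltW.
have s16 : 16 <= Num.sqrt (Rk k).
  rewrite (_ : 16 = Num.sqrt (16 ^+ 2)); last by rewrite sqrtr_sqr ger0_norm.
  by rewrite ler_sqrt//; lra.
have h0 := hk_supp0 supp k2 (hy 0%N (ltnW n2)).
have hi i : (0 < i < n)%N -> (Rk k / 2 - 1) ^+ 2 <= y i ^+ 2 <= (Rk k + 1) ^+ 2.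
  move=> /andP[i0 iln]; have /andP[h1 h2] := hk_suppS supp i0 (hy i iln).
  by apply/andP; split; apply: lerXn2r; rewrite ?nnegrE; lra.
have n1 : (n.-1)%:R = n%:R - 1 :> R by rewrite -subn1 natrB// ltnW.
have lo : (n%:R - 1) * (Rk k / 2 - 1) ^+ 2 <= \sum_(1 <= i < n) y i ^+ 2.
  rewrite -n1 mulr_natl -subn1 -sumr_const_nat; apply: ler_sum_nat => i hin.
  by case/andP: (hi i hin).
have up : \sum_(1 <= i < n) y i ^+ 2 <= (n%:R - 1) * (Rk k + 1) ^+ 2.
  rewrite -n1 mulr_natl -subn1 -sumr_const_nat; apply: ler_sum_nat => i hin.
  by case/andP: (hi i hin).
rewrite big_ltn ?(ltnW n2)//.
move: h0; rewrite ltr_norml => /andP[h1 h2].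
have rs : 16 * Num.sqrt (Rk k) <= Rk k by rewrite -[X in _ <= X]sE expr2 ler_wpM2r.
have sq0 : Num.sqrt (Rk k) * Rk k <= Rk k ^+ 2 / 16 by nra.
have y0l : (Rk k - Num.sqrt (Rk k)) ^+ 2 <= y 0%N ^+ 2.
  by apply: lerXn2r; rewrite ?nnegrE; lra.
have y0u : y 0%N ^+ 2 <= (Rk k + Num.sqrt (Rk k)) ^+ 2.
  by apply: lerXn2r; rewrite ?nnegrE; lra.
have n2R : 2 <= n%:R :> R by rewrite ler_nat.
have nr : n%:R * Rk k <= Rk k ^+ 2 / 24 by nra.
have rr : 256 * Rk k <= Rk k ^+ 2 by nra.
rewrite sqrrB sE in y0l; rewrite sqrrD sE in y0u.
rewrite sqrrB expr1n in lo; rewrite sqrrD expr1n in up.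
rewrite -[_ *+ 2]mulr_natl in y0l y0u lo up.
apply/andP; split; nra.
Qed.

Lemma filter_uf (x : 'rV[R]_n) j k t : (k0 <= k)%N ->
  cint setT (fun s => bandf n (Rk k) s * uf x j (t - s)) = if j == k then uf x k t else 0.
Proof.
move=> kk; have r0 := Rk_gt0 R k; have [jk|jk] := leqP k0 j; last first.
  rewrite (ltn_eqF (leq_trans jk kk)) -[RHS](cint0 setT); apply: eq_cint => s _.
  by rewrite /uf cf_lt// rc0 mul0r mulr0.
have key lam : (forall y : nat -> R, (forall i, (i < n)%N -> hk j i (y i) != 0) ->
     cint setT (fun s => bandf n (Rk k) s * expi (s * \sum_(0 <= i < n) pi * y i ^+ 2)) = lam) ->
    cint setT (fun s => bandf n (Rk k) s * uf x j (t - s)) = lam * uf x j t.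
  move=> h.
  have ft := @filter_tensor R t (hk j) (cd x) (fun i => \int[mu]_xi cabs (hk j i xi)) lam n
    (cintegrable_hk n a b iphi cphi supp j) (fun i => cmeas_vf i (cd x i) jk)
    (fun i s => vf_le j i (cd x i) s) _ (cintegrable_bandf n r0) h.
  rewrite /uf mulrCA -ft -cintZ//.
    by apply: eq_cint => s _; rewrite mulrCA.
  apply: (@cintegrableM_bnd _ _ _ _ (\prod_(0 <= i < n) \int[mu]_xi cabs (hk j i xi))) => //.
  - exact: cintegrable_bandf.
  - apply: cmeas_prod => i _.
    have := cmeas_vf i (cd x i) jk => m.
    apply: (@cmeas_comp _ _ _ (fun s => vf j i s (cd x i)) (fun s : R => t - s)) => //.
    have := measurable_affine (-1) t.
    by congr measurable_fun; apply/funext => s; ring.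
  - by move=> s _; rewrite cabs_prod; apply: ler_prod => i _; rewrite cabs_ge0; exact: vf_le.
have rj0 := Rk_gt0 R j.
have nR : 2 <= n%:R :> R by rewrite ler_nat.
(* A factor of at least 4 between the squares of two scales carries each band past the transition
   zones of the other. *)
have dbl u w : (u < w)%N -> 4 * Rk u ^+ 2 <= Rk w ^+ 2.
  move=> uw; rewrite (_ : 4 * _ = (2 * Rk u) ^+ 2); last by ring.
  apply: lerXn2r; rewrite ?nnegrE ?mulr_ge0 ?(ltW (Rk_gt0 R _))//.
  by rewrite -exprS; apply: ler_weXn2l; rewrite ?ler1n.
case: eqP => [jkE|/eqP jkN].
  rewrite -[RHS]mul1r jkE; rewrite jkE in key; apply: key => y hy.
  rewrite -mulr_sumr; apply: bandf_in => //; exact: band_sum.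
rewrite (key 0) ?mul0r// => y hy; rewrite -mulr_sumr; apply: bandf_out => //.
have /andP[h1 h2] := band_sum jk hy.
move: jkN; rewrite neq_ltn => /orP[/dbl h|/dbl h]; [left; apply: le_trans h2 _|right; apply: le_trans h1].
  have := sqr_ge0 (Rk j); nra.
have := sqr_ge0 (Rk k); nra.
Qed.

(** The filter annihilates every summand of the partial sum except the k-th. The bound is therefore
    available for every J > k. *)
Lemma uf_reproduce (x : 'rV[R]_n) k t J : (k0 <= k)%N -> (k < J)%N ->
  cabs (uf x k t) <= \int[mu]_tau (bandf_dom n (Rk k) (t - tau) * cabs (\sum_(0 <= j < J) uf x j tau)).
Proof.
move=> kk kJ; have r0 := Rk_gt0 R k.
have mt j : cmeas setT (fun s : R => uf x j (t - s)).
  apply: (@cmeas_comp _ _ _ (uf x j) (fun s : R => t - s)); first exact: cmeas_uf.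
  have := measurable_affine (-1) t.
  by congr measurable_fun; apply/funext => s; ring.
have iK j : cintegrable setT (fun s => bandf n (Rk k) s * uf x j (t - s)).
  have [M hM] := uf_bounded x j.
  by apply: (@cintegrableM_bnd _ _ _ _ M) => //; exact: cintegrable_bandf.
have e : uf x k t = cint setT (fun s => bandf n (Rk k) s * \sum_(0 <= j < J) uf x j (t - s)).
  transitivity (cint setT (fun s => \sum_(0 <= j < J) bandf n (Rk k) s * uf x j (t - s))).
    rewrite cint_sum//; under eq_bigr => j _ do rewrite (filter_uf x j t kk).
    rewrite (bigD1_seq k) ?mem_index_iota ?iota_uniq//= eqxx big1 ?addr0// => j jk.
    by rewrite (negbTE jk).
  by apply: eq_cint => s _; rewrite mulr_sumr.
have [M hM] : exists M, forall s, cabs (\sum_(0 <= j < J) uf x j s) <= M.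
  elim: (index_iota 0 J) => [|j s [M hM]]; first by exists 0 => s; rewrite big_nil cabs0.
  have [M' hM'] := uf_bounded x j; exists (M' + M) => s'; rewrite big_cons.
  by apply: le_trans (cabsD _ _) _; apply: lerD.
have mU : measurable_fun setT (fun s => cabs (\sum_(0 <= j < J) uf x j s)).
  by apply: cmeas_cabs; apply: cmeas_sum => j _; exact: cmeas_uf.
have N1 : -1 != 0 :> R by rewrite oppr_eq0 oner_eq0.
pose F tau := bandf_dom n (Rk k) (t - tau) * cabs (\sum_(0 <= j < J) uf x j tau).
have idom : mu.-integrable setT (EFin \o (fun tau => bandf_dom n (Rk k) (t - tau))).
  have := integrable_affine t N1 (integrable_bandf_dom n (Rk k)).
  by apply: eq_integrable => // tau _ /=; congr ((bandf_dom _ _ _)%:E); ring.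
have iF : mu.-integrable setT (EFin \o F).
  have := rint_mul M measurableT idom; apply: le_integrable => //.
    apply/measurable_EFinP; apply: measurable_funM => //.
    by apply/measurable_EFinP; case/integrableP: idom.
  move=> tau _; rewrite /= lee_fin ger0_norm; last by rewrite mulr_ge0 ?cabs_ge0 ?bandf_dom_ge0.
  by rewrite (le_trans _ (ler_norm _))// /F mulrC ler_wpM2r ?bandf_dom_ge0.
have iF' := integrable_affine t N1 iF.
have := Rintegral_affine t N1 iF; rewrite normrN normr1 invr1 mul1r => <-.
rewrite {1}e; apply: cabs_cint_dom => //.
- apply: cmeasM; last by apply: cmeas_sum => j _; exact: mt.
  by case: (cintegrable_meas (cintegrable_bandf n r0)).
- move=> s _; rewrite /F (_ : -1 * s + t = t - s); last by ring.
  rewrite (_ : t - (t - s) = s); last by ring.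
  by rewrite cabsM ler_wpM2r ?cabs_ge0// cabs_bandf.
Qed.

End bands.
End Solution.

(** * The main term *)

Section Exponents.
Variable R : realType.

Lemma pow_big (e M : R) : 0 < e -> exists K, forall k, (K <= k)%N -> M * (1 + k%:R) <= Rk k `^ e.
Proof.
move=> e0; have [A A0 hA] := poly_geom 2 e0.
have L0 : 0 < ln 2 :> R by rewrite ln_gt0// ltr1n.
have A1 : 0 < A + 1 by rewrite ltr_wpDl.
exists (Num.truncn (2 * `|M| * (A + 1))).+1 => k hk.
have k1 : 1 <= k%:R :> R by rewrite ler1n (leq_trans _ hk).
have hk' : 2 * `|M| * (A + 1) <= k%:R.
  by apply: ltW; apply: lt_le_trans (truncnS_gt _) _; rewrite ler_nat.
have r0 : 0 < Rk k `^ e by rewrite powR_gt0// exprn_gt0.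
have h : k%:R ^+ 2 <= (A + 1) * Rk k `^ e.
  have := hA k; rewrite powRN ler_pdivrMr// => h; apply: le_trans h _.
  rewrite ler_wpM2r ?(ltW r0)//; apply: (@le_trans _ _ A); last by rewrite lerDl.
  rewrite ler_piMr// exprn_ile1 ?expR_ge0//.
  by rewrite expR_le1 oppr_le0 mulr_ge0 ?(ltW L0)// ltW// divr_gt0.
rewrite -(ler_pM2l A1); apply: le_trans h.
apply: (@le_trans _ _ ((A + 1) * (2 * `|M| * k%:R))).
  rewrite ler_wpM2l ?(ltW A1)//; apply: (@le_trans _ _ (`|M| * (1 + k%:R))).
    by rewrite ler_wpM2r ?ler_norm// addr_ge0.
  rewrite (_ : 2 * `|M| * k%:R = `|M| * (2 * k%:R)); last by ring.
  by rewrite ler_wpM2l//; lra.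
by rewrite mulrA expr2 ler_wpM2r// mulrC.
Qed.

Variables (n : nat) (a b : R).
Hypothesis n2 : (2 <= n)%N.
Hypotheses (ha : 0 < a <= 1) (hb : 0 < b <= 1 / 2) (hab : 1 + b <= 2 * a).
Let nR : 2 <= n%:R :> R. Proof. by rewrite ler_nat. Qed.
Let n1 : 0 < n%:R + 1 :> R. Proof. by move: nR; lra. Qed.

Definition gex : R := (n%:R - (n%:R - 1) * a - b) / (n%:R + 1).

Lemma gex_gt0 : 0 < gex.
Proof.
case/andP: ha => a0 a1; case/andP: hb => b0 b1; rewrite divr_gt0//.
have : (n%:R - 1) * a <= n%:R - 1 by rewrite ler_piMr//; move: nR; lra.
lra.
Qed.

(** This balance makes the main term on the slabs free of R_k. *)
Lemma sexpE : 2 * sexp n a b = 1 / 2 + (n%:R - 1) * gex.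
Proof. by rewrite /sexp /gex; move: n1 => h; field; rewrite gt_eqF. Qed.

(** The hypothesis 2a >= 1 + b gives gex < 1/2, hence 2s < n/2. Thus every gam > n - 2s is positive,
    as the covering criterion requires. *)
Lemma dim_gt0 : 0 < n%:R - 2 * sexp n a b.
Proof.
case/andP: ha => a0 a1; case/andP: hb => b0 b1; rewrite sexpE.
have g1 : gex < 1 / 2.
  rewrite /gex ltr_pdivrMr//.
  have : (n%:R - 1) * (1 + b) <= (n%:R - 1) * (2 * a) by rewrite ler_wpM2l//; move: nR; lra.
  have : 0 < (n%:R - 1) * b by rewrite mulr_gt0//; move: nR; lra.
  lra.
have : (n%:R - 1) * gex <= (n%:R - 1) * (1 / 2) by rewrite ler_wpM2l ?(ltW g1)//; move: nR; lra.
by move: nR; lra.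
Qed.

Lemma Dk_exp_gt0 : 0 < (n%:R - (n%:R - 1) * a + n%:R * b) / (n%:R + 1).
Proof.
case/andP: ha => a0 a1; case/andP: hb => b0 b1; rewrite divr_gt0//.
have : (n%:R - 1) * a <= n%:R - 1 by rewrite ler_piMr//; move: nR; lra.
have : 0 <= n%:R * b by rewrite mulr_ge0// ltW.
lra.
Qed.

Lemma RDk_exp_gt0 : 0 < (1 + (n%:R - 1) * a - n%:R * b) / (n%:R + 1).
Proof.
case/andP: ha => a0 a1; case/andP: hb => b0 b1; rewrite divr_gt0//.
have : (n%:R - 1) * (1 + b) <= (n%:R - 1) * (2 * a) by rewrite ler_wpM2l//; move: nR; lra.
have : n%:R * b <= n%:R * (1 / 2) by rewrite ler_wpM2l//.
have : n%:R * b + b <= (n%:R + 1) * (1 / 2).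
  by rewrite -[X in _ + X]mul1r -mulrDl ler_wpM2l// ltW.
move: n1 nR; lra.
Qed.

Lemma Rk_over_Dk k : Rk k / Dk n a b k = Rk k `^ ((1 + (n%:R - 1) * a - n%:R * b) / (n%:R + 1)) :> R.
Proof.
have r0 : 0 < Rk k :> R by rewrite exprn_gt0.
rewrite /Dk -powRN -{1}[Rk k]powRr1 ?(ltW r0)// -powRD ?(gt_eqF r0) ?implybT//.
by congr (_ `^ _); field; rewrite gt_eqF.
Qed.

Lemma Rk_over_DkQk k : Rk k / Dk n a b k / Qk n a b k = Rk k `^ gex :> R.
Proof.
have r0 : 0 < Rk k :> R by rewrite exprn_gt0.
rewrite Rk_over_Dk /Qk -powRN -powRD ?(gt_eqF r0) ?implybT//.
by congr (_ `^ _); rewrite /gex; field; rewrite gt_eqF.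
Qed.

Lemma Qk_le k : Qk n a b k <= Rk k :> R.
Proof.
case/andP: ha => a0 a1; case/andP: hb => b0 b1.
have r1 : 1 <= Rk k :> R by rewrite exprn_ege1// ler1n.
rewrite -[X in _ <= X]powRr1 ?(le_trans ler01)// /Qk; apply: ler_powR => //.
rewrite -[X in _ <= X](mulr1 1).
apply: ler_pM.
- by rewrite divr_ge0 ?(ltW n1)//; move: nR; lra.
- by move: hab; lra.
- by rewrite ler_pdivrMr//; lra.
- by move: hab; lra.
Qed.

(** Each condition compares a constant or a linear function of k with a positive power of R_k =
    2^k. *)
Lemma scale_conditions (c c1 : R) : 0 < c1 -> exists K, forall k, (K <= k)%N ->
  [/\ [/\ (2 <= k)%N, 2 <= Dk n a b k & 4 <= Rk k / Dk n a b k],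
      256 <= Rk k :> R /\ 24 * n%:R <= Rk k :> R,
      180 * (1 + 4 * k%:R) <= Rk k `^ gex &
      c / Num.sqrt (Rk k) <= c1 / 10].
Proof.
move=> c10.
have [K1 h1] := pow_big 2 Dk_exp_gt0.
have [K2 h2] := pow_big 4 RDk_exp_gt0.
have [K3 h3] := pow_big (256 + 24 * n%:R) (ltr01 : 0 < 1 :> R).
have [K4 h4] := pow_big 720 gex_gt0.
have e2 : 0 < 2^-1 :> R by rewrite invr_gt0.
have [K5 h5] := pow_big (`|c| / (c1 / 10)) e2.
exists (maxn (maxn 2 (maxn K1 K2)) (maxn K3 (maxn K4 K5))) => k; rewrite !geq_max.
move=> /andP[/and3P[k2 /h1 g1 /h2 g2] /and3P[/h3 g3 /h4 g4 /h5 g5]].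
have kR : 0 <= k%:R :> R by [].
have r0 : 0 < Rk k :> R by rewrite exprn_gt0.
have n0 : 0 <= n%:R :> R by [].
have nn : 0 <= 256 + 24 * n%:R :> R := addr_ge0 (ler0n R 256) (mulr_ge0 (ler0n R 24) n0).
split; [split=> //|split| |].
- by apply: le_trans g1; rewrite mulrDr mulr1 lerDl mulr_ge0.
- by rewrite Rk_over_Dk; apply: le_trans g2; rewrite mulrDr mulr1 lerDl mulr_ge0.
- move: g3; rewrite powRr1 ?(ltW r0)//; apply: le_trans; rewrite mulrDr mulr1.
  have : 0 <= (256 + 24 * n%:R) * k%:R :> R by exact: mulr_ge0 nn kR.
  lra.
- move: g3; rewrite powRr1 ?(ltW r0)//; apply: le_trans; rewrite mulrDr mulr1.
  have : 0 <= (256 + 24 * n%:R) * k%:R :> R by exact: mulr_ge0 nn kR.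
  lra.
- by apply: le_trans g4; lra.
have s0 : 0 < Num.sqrt (Rk k) :> R by rewrite sqrtr_gt0.
have c10' : 0 < c1 / 10 by rewrite divr_gt0.
rewrite ler_pdivrMr//; apply: le_trans (ler_norm _) _.
rewrite mulrC -ler_pdivrMr//; move: g5; rewrite powR12_sqrt ?(ltW r0)//; apply: le_trans.
by rewrite mulrDr mulr1 lerDl mulr_ge0// divr_ge0// ltW.
Qed.

End Exponents.

(** * Parity of admissible fractions *)

Section Parity.

(** If u is odd, then q = 2 mod 4 and p_j is odd, as is p_1 u because p_1 is prime to the even q. If
    u is even, then 4 | q and both p_j and p_1 u are even. This is the condition of [gsum_ge]. *)
Lemma admissible_parity n (p : nat -> int) (q u j : nat) : admissible n p q ->
  (2 <= j <= n)%N -> q = u.*2 -> (2 %| p j - p 1%N * u%:Z)%Z.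
Proof.
move=> [cop adm4 adm2] hj qu.
have u2 : (u%:Z = (u./2)%:Z * 2 + (odd u)%:Z)%R.
  by rewrite -{1}(odd_double_half u) -muln2 PoszD PoszM addrC.
case ou : (odd u) u2 => u2.
  have o x : ~~ (2 %| x)%Z -> exists y : int, x = y * 2 + 1.
    move=> h; exists (x %/ 2)%Z; rewrite {1}(divz_eq x 2); congr (_ + _).
    have h0 := @modz_ge0 x 2 isT; have h2 := @ltz_pmod x 2 isT.
    have : (x %% 2)%Z != 0 by apply: contra h => /eqP h; apply/dvdz_mod0P.
    lia.
  have q2 : (q%:Z %% 4)%Z = 2.
    rewrite modz_nat qu -(odd_double_half u) ou; congr Posz.
    by rewrite doubleD -!muln2 -mulnA addnC modnMDl.
  have [y hy] := o _ (adm2 q2 j hj).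
  have [z hz] : exists z : int, p 1%N = z * 2 + 1.
    apply: o; apply/negP => h; have : (2 %| gcdz (p 1%N) q)%Z.
      rewrite dvdz_gcd h qu -muln2 PoszM; exact: dvdz_mull.
    by rewrite cop.
  rewrite hy hz u2 (_ : _ - _ = (y - (z * ((u./2)%:Z * 2 + 1) + (u./2)%:Z)) * 2); last first.
    by rewrite /=; ring.
  exact: dvdz_mull.
have q4 : (4 %| q%:Z)%Z.
  rewrite qu -(odd_double_half u) ou add0n -!muln2 -mulnA PoszM; exact: dvdz_mull.
rewrite rpredB ?(adm4 q4 j hj)// u2 addr0 mulrA; exact: dvdz_mull.
Qed.

End Parity.

(** * Size of the k-th summand on the k-th slabs *)

Section MainTerm.
Variable R : realType.
Local Notation C := R[i].
Local Notation mu := (@lebesgue_measure R).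
Variables (n : nat) (a b : R) (phi : R -> R).
Hypothesis n2 : (2 <= n)%N.
Hypotheses (ha : 0 < a <= 1) (hb : 0 < b <= 1 / 2) (hab : 1 + b <= 2 * a).
Hypothesis iphi : mu.-integrable setT (EFin \o phi).
Hypothesis cphi : continuous phi.
Local Notation Phi := (ft1 phi).
Hypothesis supp : forall eta, 1 <= `|eta| -> Phi eta = 0.
Hypothesis phi0 : phi 0 = 1.
Local Notation Rk := (@Rk R).
Local Notation D := (Dk n a b).
Local Notation ka := (kap R).
Local Notation B := (ft1_l1 phi).
Variable k0 : nat.
Hypothesis good : forall k, (k0 <= k)%N -> [/\ (2 <= k)%N, 2 <= D k & 4 <= Rk k / D k].
Local Notation cf := (cf n a b phi k0).
Local Notation hk := (hk n a b phi).
Local Notation vf := (vf n a b phi).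
Local Notation uf := (@uf R n a b phi k0).
Local Notation teeth := (teeth n a b).

(** [cf_sqr] with s expressed through [gex]: the power of R_k left over is that of the number of
    Gauss periods. *)
Lemma cf_teeth k : (k0 <= k)%N ->
  cf k ^+ 2 * (teeth k)%:R ^+ n.-1 = k%:R ^+ 2 / phi_m2 phi ^+ n / (Rk k `^ gex n a b) ^+ n.-1.
Proof.
move=> kk; have [k2 D2 X4] := good kk.
have r0 := Rk_gt0 R k; have s0 : 0 < Num.sqrt (Rk k) by rewrite sqrtr_gt0.
have g0 : 0 < Rk k `^ gex n a b by rewrite powR_gt0.
have := cf_sqr n2 iphi cphi supp phi0 good kk.
have n1 : (n.-1)%:R = n%:R - 1 :> R by rewrite -subn1 natrB// ltnW.
rewrite sexpE//.
have -> : n%:R - (1 / 2 + (n%:R - 1) * gex n a b) = 2^-1 + n.-1%:R + - (gex n a b * n.-1%:R).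
  by rewrite n1; field.
rewrite !powRD ?(gt_eqF r0) ?implybT// powRN powRrM !powR_mulrn ?(ltW r0) ?(ltW g0)//.
rewrite powR12_sqrt ?(ltW r0)// exprMn => h.
have sr : Num.sqrt (Rk k) * Rk k ^+ n.-1 != 0 by rewrite mulf_neq0 ?expf_neq0// gt_eqF.
apply: (mulfI sr).
transitivity (cf k ^+ 2 * (Num.sqrt (Rk k) * (Rk k ^+ n.-1 * (teeth k)%:R ^+ n.-1))); first by ring.
by rewrite h; ring.
Qed.

Definition cmain : R := Num.sqrt ((ka / 2) ^+ (2 * n) / phi_m2 phi ^+ n / 4 ^+ n.-1).

Lemma cmain_gt0 : 0 < cmain.
Proof.
have m0 := phi_m2_gt0 iphi cphi supp phi0.
by rewrite sqrtr_gt0 !divr_gt0 ?exprn_gt0 ?divr_gt0 ?kap_gt0.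
Qed.

(** In the square of the product, with T the number of teeth, T^(n-1) normalises the coefficient by
    [cf_teeth], and (T/q)^(n-1) is at least (R_k^gex/4)^(n-1), which cancels the remaining power of
    R_k. Only k^2 and constants survive. *)
Lemma uf_lower_of_factors (x : 'rV[R]_n) k t (q : R) : (k0 <= k)%N -> 0 < q ->
  Rk k `^ gex n a b / 4 <= (teeth k)%:R / q ->
  ka / 2 <= cabs (vf k 0 t (cd x 0)) ->
  (forall i, (0 < i < n)%N -> ka / 2 * ((teeth k)%:R / q * Num.sqrt q) <= cabs (vf k i t (cd x i))) ->
  cmain * k%:R <= cabs (uf x k t).
Proof.
move=> kk q0 hT h0 hi; have m0 := phi_m2_gt0 iphi cphi supp phi0.
have k20 : 0 < ka / 2 by rewrite divr_gt0// kap_gt0.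
have g0 : 0 < Rk k `^ gex n a b by rewrite powR_gt0// Rk_gt0.
set T := (teeth k)%:R in hT hi *; have T0 : 0 <= T by [].
have kT0 := mulr_ge0 (ltW k20) (mulr_ge0 (divr_ge0 T0 (ltW q0)) (sqrtr_ge0 q)).
have P : (ka / 2) * (ka / 2 * (T / q * Num.sqrt q)) ^+ n.-1 <= \prod_(0 <= i < n) cabs (vf k i t (cd x i)).
  rewrite big_ltn ?(ltnW n2)//; apply: ler_pM => //.
  - exact: ltW.
  - exact: exprn_ge0.
  rewrite -subn1 -prodr_const_nat !big_nat; apply: ler_prod => i hin.
  by rewrite hi// andbT.
have -> : cabs (uf x k t) = cf k * \prod_(0 <= i < n) cabs (vf k i t (cd x i)).
  by rewrite /uf cabsM cabs_rc cabs_prod ger0_norm ?cf_ge0.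
apply: le_trans (ler_wpM2l (cf_ge0 n a b phi k0 k) P).
set Q := _ * _ ^+ n.-1 in P *.
have Q0 : 0 <= Q.
  exact: mulr_ge0 (ltW k20) (exprn_ge0 _ kT0).
have cQ0 : 0 <= cf k * Q by rewrite mulr_ge0 ?cf_ge0.
rewrite -(ger0_norm cQ0) -sqrtr_sqr -[k%:R]ger0_norm// -sqrtr_sqr /cmain -sqrtrM; last first.
  by rewrite !divr_ge0 ?exprn_ge0 ?divr_ge0 ?(ltW (kap_gt0 R)) ?(ltW m0).
rewrite ler_sqrt ?sqr_ge0//.
have -> : (cf k * Q) ^+ 2 = (ka / 2) ^+ (2 * n) * ((cf k ^+ 2 * T ^+ n.-1) * (T / q) ^+ n.-1).
  have e1 : (ka / 2 * (T / q * Num.sqrt q)) ^+ 2 = (ka / 2) ^+ 2 * (T * (T / q)).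
    by rewrite exprMn [X in _ * X]exprMn sqr_sqrtr ?(ltW q0)//; field; rewrite gt_eqF.
  have e2 : (ka / 2) ^+ (2 * n) = (ka / 2) ^+ 2 * ((ka / 2) ^+ 2) ^+ n.-1.
    by rewrite exprM -exprS prednK// ltnW.
  rewrite /Q [LHS]exprMn [X in _ * X]exprMn (exprAC _ n.-1 2) e1 [X in _ * (_ * X)]exprMn.
  by rewrite [X in _ * (_ * (_ * X))]exprMn e2; ring.
rewrite cf_teeth//.
apply: (@le_trans _ _ ((ka / 2) ^+ (2 * n) * (k%:R ^+ 2 / phi_m2 phi ^+ n / (Rk k `^ gex n a b) ^+ n.-1 *
   (Rk k `^ gex n a b / 4) ^+ n.-1))).
  rewrite le_eqVlt; apply/orP; left; apply/eqP; rewrite [X in _ = _ * (_ * X)]exprMn exprVn.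
  have gn := expf_neq0 n.-1 (lt0r_neq0 g0).
  have mn := expf_neq0 n (lt0r_neq0 m0).
  have fn : 4 ^+ n.-1 != 0 :> R by rewrite expf_neq0.
  move: (_ ^+ n.-1) gn => G G0; move: (phi_m2 phi ^+ n) mn => X X0.
  move: (4 ^+ n.-1) fn => Y Y0; move: ((ka / 2) ^+ (2 * n)) => Z.
  by field; rewrite X0 Y0 G0.
rewrite ler_wpM2l ?exprn_ge0 ?(ltW k20)// ler_wpM2l//.
  by rewrite !divr_ge0 ?exprn_ge0 ?(ltW m0) ?(ltW g0).
by apply: lerXn2r; rewrite ?nnegrE ?divr_ge0 ?(ltW g0) ?(ltW q0).
Qed.

(** For t = 2 p_1/(q D_k^2) the slab puts x_1 within c/(2 sqrt R_k) <= c1/20 of R_k t, so R_k t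
    inherits the two-sided bounds on x_1. All phase errors are then controlled by c + 8 c1. *)
Lemma uf_lower (c c1 : R) (x : 'rV[R]_n) k : (k0 <= k)%N ->
  0 < c -> 0 < c1 -> pi * (c + 8 * c1) * B <= ka / 10 -> c / Num.sqrt (Rk k) <= c1 / 10 ->
  180 * (1 + 4 * k%:R) <= Rk k `^ gex n a b ->
  Fk n a b c k x -> region n (c1 / 10) c1 x ->
  exists t, c1 / 20 <= Rk k * t <= 2 * c1 /\ cmain * k%:R <= cabs (uf x k t).
Proof.
move=> kk c0 c10 hcB hcR hL [p [qz [q1 qQ [cop adm4 adm2] [sl0 slj]]]] [/andP[x0 x1] xj].
have [k2 D2 X4] := good kk.
have r0 := Rk_gt0 R k; have r1 := Rk_ge1 R k; have D0 := Dk_gt0 n a b k.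
have s0 : 0 < Num.sqrt (Rk k) by rewrite sqrtr_gt0.
have sE : Num.sqrt (Rk k) ^+ 2 = Rk k by rewrite sqr_sqrtr// ltW.
have p0 : 0 < pi :> R := pi_gt0 R.
have B0 := ft1_l1_ge0 phi; have ka0 := kap_gt0 R.
case: qz q1 qQ cop adm4 adm2 sl0 slj => [q|//] q1 qQ cop adm4 adm2 sl0 slj.
have q0 : (0 < q)%N by rewrite -ltz_nat (lt_le_trans ltr01 q1).
have qR : 0 < q%:R :> R by rewrite ltr0n.
rewrite -pmulrn in qQ sl0 slj.
set t := 2 * (p 1%N)%:~R / (q%:R * D k ^+ 2).
have tE : 2 * (p 1%N)%:~R * Rk k / (q%:R * D k ^+ 2) = t * Rk k by rewrite /t; ring.
have sqE : Rk k `^ (- (1 / 2)) = (Num.sqrt (Rk k))^-1 by rewrite powRN mul1r powR12_sqrt// ltW.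
rewrite tE sqE in sl0.
have tl : c1 / 20 <= t * Rk k by move: sl0; rewrite ler_norml => /andP[h1 h2]; lra.
have tu : t * Rk k <= 2 * c1 by move: sl0; rewrite ler_norml => /andP[h1 h2]; lra.
have tR0 : 0 <= t * Rk k by apply: le_trans tl; rewrite divr_ge0// ltW.
have t0 : 0 <= t by move: tR0; rewrite pmulr_lge0.
exists t; split; first by rewrite [Rk k * t]mulrC tl.
have [lohi /andP[Tlo Thi]] := comb_size X4.
have adm : admissible n p q by split.
(* The largest error is that of the comb: |dl| r <= c/2, t r <= 2 c1 and |x| <= c1 give c + 6 c1 + 2
   c1. *)
have hB z : z <= c + 8 * c1 -> pi * z * B <= ka / 10.
  by move=> hz; apply: le_trans hcB; rewrite ler_wpM2r// ler_wpM2l// ltW.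
(* The comb has at least R_k/(4 D_k) teeth, and q <= Q_k. *)
have hT : Rk k `^ gex n a b / 4 <= (teeth k)%:R / q%:R.
  rewrite -Rk_over_DkQk// mulrAC; apply: ler_pM => //.
  - by rewrite divr_ge0// divr_ge0 ?(ltW r0) ?(ltW D0).
  - by rewrite invr_ge0 powR_ge0.
  - by rewrite lef_pV2 ?posrE// powR_gt0.
apply: (uf_lower_of_factors kk qR hT).
  apply: (le_trans _ (hfirst_lower iphi cphi supp phi0 t (cd x 0) r0)).
  have g1 : Num.sqrt (Rk k) * `|cd x 0 - t * Rk k| <= c / 2.
    apply: le_trans (ler_wpM2l (ltW s0) sl0) _.
    by rewrite le_eqVlt; apply/orP; left; apply/eqP; field; rewrite gt_eqF.
  have := hB (`|t * Rk k| + 2 * (Num.sqrt (Rk k) * `|cd x 0 - t * Rk k|)).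
  rewrite (ger0_norm tR0) => h; have := h; set z := pi * _ * B; move: (z) => {}z hz.
  have : z <= ka / 10 by apply: hz; lra.
  lra.
move=> i /andP[i0 iln]; have [xi0 xi1] := andP (xj i (introT andP (conj i0 iln))).
have sli := slj i (introT andP (conj i0 iln)).
rewrite /vf /hk (gtn_eqF i0).
have hiE : comb_hi (Rk k / D k) = (comb_lo (Rk k / D k) + teeth k)%N by rewrite subnKC.
rewrite [X in hcomb _ _ _ X]hiE.
have X0 : 0 <= Rk k / D k by rewrite divr_ge0 ?(ltW r0) ?(ltW D0).
apply: (@hcomb_lower _ phi iphi cphi supp phi0 (D k) (Rk k) t (cd x i) _ _ D0 r1 t0 _ _ q q0 (p 1%N) (p i.+1)
  _ k _ _ _ (cd x i - (p i.+1)%:~R / (D k * q%:R)) _ (ka / 10)) => //.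
- move=> l /andP[_ lh]; rewrite mulrC -ler_pdivlMr// ltW//.
  by rewrite comb_hiP// hiE.
- by rewrite -ler_pdivlMr.
- by apply/eqP.
(* The bound K for log_2 q is k itself, since q <= Q_k <= R_k = 2^k. *)
- rewrite -(ler_nat R) natrX; apply: le_trans qQ _; exact: Qk_le.
- by move=> u qu; apply: (admissible_parity adm) qu; rewrite ltnS i0.
- by rewrite /t; field; rewrite !gt_eqF.
- by rewrite addrC subrK.
- apply: hB; rewrite (ger0_norm xi0).
  have : `|cd x i - (p i.+1)%:~R / (D k * q%:R)| * Rk k <= c / 2.
    apply: le_trans (ler_wpM2r (ltW r0) sli) _.
    by rewrite le_eqVlt; apply/orP; left; apply/eqP; field; rewrite gt_eqF.
  lra.
- apply: le_trans hT; lra.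
Qed.

End MainTerm.

(** * Blow-up off the exceptional set *)

Section Blowup.
Variable R : realType.
Local Notation mu := (@lebesgue_measure R).
Variables (n : nat) (a b : R) (phi : R -> R).
Hypothesis n2 : (2 <= n)%N.
Hypotheses (ha : 0 < a <= 1) (hb : 0 < b <= 1 / 2) (hab : 1 + b <= 2 * a).
Hypothesis iphi : mu.-integrable setT (EFin \o phi).
Hypothesis cphi : continuous phi.
Local Notation Phi := (ft1 phi).
Hypothesis supp : forall eta, 1 <= `|eta| -> Phi eta = 0.
Hypothesis phi0 : phi 0 = 1.
Local Notation Rk := (@Rk R).
Variables (c c1 : R) (k0 : nat).
Hypotheses (c0 : 0 < c) (c10 : 0 < c1) (c12 : c1 <= 1 / 2).
Hypothesis hcB : pi * (c + 8 * c1) * ft1_l1 phi <= kap R / 10.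
Hypothesis scale : forall k, (k0 <= k)%N ->
  [/\ [/\ (2 <= k)%N, 2 <= Dk n a b k & 4 <= Rk k / Dk n a b k],
      256 <= Rk k /\ 24 * n%:R <= Rk k,
      180 * (1 + 4 * k%:R) <= Rk k `^ gex n a b & c / Num.sqrt (Rk k) <= c1 / 10].

Lemma blowup (x : 'rV[R]_n) :
  divset n a b c x -> region n (c1 / 10) c1 x -> ~ Omega a b phi k0 x ->
  schr_blowup (ghat n phi a b k0) x.
Proof.
move=> hdiv hreg hOm; apply: contrapT => hno.
have good k : (k0 <= k)%N -> [/\ (2 <= k)%N, 2 <= Dk n a b k & 4 <= Rk k / Dk n a b k].
  by move=> /scale[].
have big k : (k0 <= k)%N -> 256 <= Rk k /\ 24 * n%:R <= Rk k by move=> /scale[].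
(* Without blow-up the solution is bounded at those times of (0,d) where the limit exists; nothing
   is claimed about the other times. *)
have [M0 [d [d0 hM]]] : exists M d, 0 < d /\ forall t, 0 < t < d -> forall v,
    schr_at (ghat n phi a b k0) t x v -> cabs v <= M.
  apply: contrapT => hn; apply: hno => M d d0; apply: contrapT => hn2; apply: hn.
  exists M, d; split => // t ht v hv; rewrite leNgt; apply/negP => hlt.
  by apply: hn2; exists t; split => //; exists v.
have hx : unit_cube x.
  move=> i; rewrite -cd_ord; case: hreg => [/andP[h1 h2] h3].
  have [i0|i0] := posnP i; first by rewrite i0; apply/andP; split; move: c10 c12 h1 h2; move: (cd x 0) => z; lra.
  have /andP[g1 g2] : 0 <= cd x i <= c1 by apply: h3; rewrite i0/=.
  by rewrite g1/=; apply: le_lt_trans g2 _; move: c12; lra.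
have [S hS] := summable_be n2 iphi cphi supp good hx hOm.
pose M := Num.max M0 0.
have M0' : 0 <= M by rewrite le_max lexx orbT.
have JC0 := @JC_gt0 R; have p0 : 0 < pi :> R := pi_gt0 R.
pose C1 := 16 / (@JC R * pi) / (c1 / 20) ^+ 2.
have C10 : 0 <= C1 by rewrite !divr_ge0 ?exprn_ge0 ?mulr_ge0 ?divr_ge0 ?(ltW c10) ?(ltW JC0) ?(ltW p0).
(* The upper bound that the filter will give for |u_k(x,t)|; it does not depend on k, whereas the
   lower bound grows like k. *)
pose T := M * (3 * n%:R) + C1 * S + 1.
have cm := cmain_gt0 n iphi cphi supp phi0.
pose N := maxn k0 (maxn (Num.truncn (3 / d)).+1 (Num.truncn (T / cmain n phi)).+1).
have [k [Nk hF]] := hdiv N.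
have [kk k1 k3] : [/\ (k0 <= k)%N, 3 / d < k%:R & T / cmain n phi < k%:R].
  move: Nk; rewrite /N !geq_max => /and3P[kk h1 h2]; split => //.
    by apply: lt_le_trans (truncnS_gt _) _; rewrite ler_nat.
  by apply: lt_le_trans (truncnS_gt _) _; rewrite ler_nat.
have [_ [r256 _] hL hcR] := scale kk; have r0 := Rk_gt0 R k.
have [t [/andP[tl tu] hlow]] := uf_lower n2 ha hb hab iphi cphi supp phi0 good kk c0 c10 hcB hcR hL hF hreg.
have rd : 3 <= Rk k * d.
  have : k%:R <= Rk k by rewrite /Defs.Rk -natrX ler_nat ltnW// ltn_expl.
  by move: k1; rewrite ltr_pdivrMr// => h1 h2; nra.
have t0 : 0 < t by rewrite -(pmulr_rgt0 _ r0); apply: lt_le_trans tl; rewrite divr_gt0.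
(* R_k t <= 2 c1 <= 1, whereas R_k d >= 3. *)
have td : 2 * t <= d by rewrite -(ler_pM2l r0) mulrCA; move: c12 tu rd; lra.
pose kf tau := bandf_dom n (Rk k) (t - tau).
have N1 : -1 != 0 :> R by rewrite oppr_eq0 oner_eq0.
have idom := integrable_bandf_dom n (Rk k).
have kfE tau : kf tau = bandf_dom n (Rk k) (-1 * tau + t) by rewrite /kf; congr bandf_dom; ring.
have ikf : mu.-integrable setT (EFin \o kf).
  have := integrable_affine t N1 idom.
  by apply: eq_integrable => // tau _ /=; rewrite kfE.
have kf1 : \int[mu]_tau kf tau = 3 * n%:R.
  under eq_Rintegral do rewrite kfE.
  by rewrite (Rintegral_affine t N1 idom) normrN normr1 invr1 mul1r bandf_dom_l1.
have [C2 C20 hC2] := bandf_dom_wt n r0 t.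
have kf0 tau : 0 <= kf tau by exact: bandf_dom_ge0.
have kfout tau : ~~ (0 < tau < d) -> kf tau <= C1 * wt tau.
  have c20 : 0 < c1 / 20 <= 1 by rewrite divr_gt0//=; move: c12; lra.
  have r3 : 3 <= Rk k by apply: le_trans r256; lra.
  exact: (bandf_dom_out n r0 c20 tl t0 td r3 rd).
have hU tau : 0 < tau < d -> forall B, (forall J, \sum_(0 <= k < J) be a b phi k0 x k tau <= B) ->
    forall J e, 0 < e -> exists2 J', (J <= J')%N &
    cabs (\sum_(0 <= k < J) uf a b phi k0 x k tau) <= M + \sum_(J <= k < J') be a b phi k0 x k tau + e.
  move=> ht B hB J e e0.
  have [v hv hv2] := schr_converges n2 iphi cphi supp good hx hB.
  have [J' JJ h] := hv2 J e e0; exists J' => //; apply: le_trans h _.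
  by rewrite !lerD2r le_max (hM tau ht v hv).
have mbe k' : measurable_fun setT (be a b phi k0 x k') by exact: measurable_be.
have ibe k' : mu.-integrable setT (EFin \o (fun tau => wt tau * be a b phi k0 x k' tau)).
  exact: integrable_wt_be.
have muf k' : cmeas setT (uf a b phi k0 x k') by exact: cmeas_uf.
have ufle k' tau : cabs (uf a b phi k0 x k' tau) <= be a b phi k0 x k' tau by exact: uf_le.
have [J0 hJ0] := kernel_bound (fun k t => be_ge0 a b phi k0 x k t) mbe ibe hS muf ufle
  M0' C10 C20 kf0 ikf hC2 kfout hU.
have h1 := hJ0 (maxn J0 k.+1) (leq_maxl _ _).
have h2 := uf_reproduce n2 iphi cphi supp good big x t kk (leq_maxr J0 k.+1).
move: k3; rewrite ltr_pdivrMr// mulrC => k3.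
have := lt_le_trans k3 (le_trans hlow (le_trans h2 h1)).
by rewrite -/(kf _) kf1 ltxx.
Qed.

End Blowup.

Unset Implicit Arguments.
Set Strict Implicit.

Theorem theorem4p3 (R : realType) (n : nat) (a b : R) (phi : R -> R) :
  (2 <= n)%N ->
  0 < a <= 1 -> 0 < b <= 1 / 2 -> 1 + b <= 2 * a ->
  smooth phi -> (forall x, 0 < phi x) -> phi 0 = 1 ->
  (@lebesgue_measure R).-integrable setT (EFin \o phi) ->
  ft_supp_in_unit phi ->
  exists cbar : R, 0 < cbar /\ forall c : R, 0 < c < cbar ->
  exists c1bar : R, 0 < c1bar /\ forall c1 : R, 0 < c1 < c1bar ->
  exists K : nat, forall k0 : nat, (K <= k0)%N ->
  exists Omega : set 'rV[R]_n,
    (forall gam : R, n%:R - 2 * sexp n a b < gam -> hausdorff gam Omega = 0%E) /\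
    forall x : 'rV[R]_n,
      (divset n a b c `&` region n (c1 / 10) c1) x -> ~ Omega x ->
      schr_blowup (ghat n phi a b k0) x.
Proof.
move=> n2 ha hb hab sphi _ phi0 iphi [r [r1 hr]].
have cphi : continuous phi.
  move=> x; have := sphi 0%N x; rewrite /= => /derivable1_diffP.
  exact: differentiable_continuous.
have supp eta : 1 <= `|eta| -> ft1 phi eta = 0.
  by move=> h; apply: hr; exact: lt_le_trans r1 h.
have ka0 := kap_gt0 R; have p0 : 0 < pi :> R := pi_gt0 R.
have B0 : 0 < ft1_l1 phi.
  exact: lt_le_trans ka0 (ft1_l1_ge_kap iphi cphi supp phi0).
have pB : 0 < pi * ft1_l1 phi by exact: mulr_gt0.
(* The thresholds for c and c1 give kap/20 each to the bound kap/10 on the phase error c + 8 c1; c1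
   < 1/2 keeps the region inside the unit cube. *)
exists (kap R / (20 * (pi * ft1_l1 phi))); split; first by rewrite divr_gt0// mulr_gt0.
move=> c /andP[c0 cb].
exists (Num.min (1 / 2) (kap R / (160 * (pi * ft1_l1 phi)))); split.
  by rewrite lt_min !divr_gt0// mulr_gt0.
move=> c1 /andP[c10]; rewrite lt_min => /andP[c12 c1b].
have hcB : pi * (c + 8 * c1) * ft1_l1 phi <= kap R / 10.
  move: cb c1b; rewrite !ltr_pdivlMr ?mulr_gt0//.
  move: (pi * ft1_l1 phi) (mulrAC pi (c + 8 * c1) (ft1_l1 phi)) => z ->; lra.
have [K hK] := scale_conditions n2 ha hb hab c c10.
exists K => k0 Kk0.
have scale k : (k0 <= k)%N -> _ := fun h => hK k (leq_trans Kk0 h).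
exists (Omega a b phi k0); split=> [gam|x [hdiv hreg] hOm].
  apply: hausdorff_Omega => //; last exact: dim_gt0.
  by move=> k /scale[].
exact: (blowup n2 ha hb hab iphi cphi supp phi0 c0 c10 (ltW c12) hcB scale).
Qed.
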